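(* Let $\mu>0$, $\beta>1$, $n\in\mathbb{N}$ with $n\ge 1$, and let $R\ge 1$. Assume that $f\in H^1(\mathbb{R}^n)$ and $g\in L^2(\mathbb{R}^n)$ are both non-negative and compactly supported, and that $g$ does not vanish identically. Let $p>1$ and let $q$ satisfy $$1<q<\min\left\{1+\frac{4}{(n-1)p-2},\ \frac{2n}{n-2}\right\}\quad\text{if } n\ge 2,\qquad 1<q\quad\text{if } n=1,$$ where $\frac{2n}{n-2}$ is understood as $+\infty$ when $n=2$. Then there exist a constant $\varepsilon_0=\varepsilon_0(f,g,n,p,\mu,\beta,R)>0$ and a constant $C>0$ independent of $\varepsilon$ such that the following holds for every $0<\varepsilon\le\varepsilon_0$: if $T>0$ and $u$ is an energy solution on $[0,T)$ of $$u_{tt}-\Delta u+\frac{\mu}{(1+t)^\beta}u_t=|u_t|^p+|u|^q,\qquad u(x,0)=\varepsilon f(x),\quad u_t(x,0)=\varepsilon g(x),$$ satisfying $$\operatorname{supp} u\subset\{(x,t)\in\mathbb{R}^n\times[0,\infty):\ |x|\le t+R\},$$ then $$T\le C\,\varepsilon^{-2p(q-1)/\{2q+2-(n-1)p(q-1)\}}.$$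
   Context: The Cauchy problem is posed for a real-valued unknown $u=u(x,t)$, $x\in\mathbb{R}^n$, $t\ge0$. A function $u$ is called an energy solution of the problem on $[0,T)$ if $$u\in C([0,T),H^1(\mathbb{R}^n))\cap C^1([0,T),L^2(\mathbb{R}^n))\cap C^1((0,T),L^p(\mathbb{R}^n))\cap L^q_{loc}(\mathbb{R}^n\times(0,T)),$$ $u(x,0)=\varepsilon f(x)$ in $H^1(\mathbb{R}^n)$, and $$\int_{\mathbb{R}^n}u_t(x,t)\phi(x,t)\,dx-\int_{\mathbb{R}^n}\varepsilon g(x)\phi(x,0)\,dx+\int_0^t ds\int_{\mathbb{R}^n}\{-u_t(x,s)\phi_t(x,s)+\nabla u(x,s)\cdot\nabla\phi(x,s)\}\,dx+\int_0^t ds\int_{\mathbb{R}^n}\frac{\mu u_t(x,s)}{(1+s)^\beta}\phi(x,s)\,dx$$ $$=\int_0^t ds\int_{\mathbb{R}^n}|u_t(x,s)|^p\phi(x,s)\,dx+\int_0^t ds\int_{\mathbb{R}^n}|u(x,s)|^q\phi(x,s)\,dx$$ for every $\phi\in C_0^\infty(\mathbb{R}^n\times[0,T))$ and every $t\in[0,T)$. The condition on $q$ for $n\ge2$ is taken literally, with $(n-1)p\neq 2$ so that the fraction $4/((n-1)p-2)$ is defined. *)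

(* Defs.v *)
From HB Require Import structures.
From mathcomp Require Import all_boot all_order all_algebra.
From mathcomp Require Import all_classical all_reals all_analysis.

Set Implicit Arguments.
Unset Strict Implicit.
Unset Printing Implicit Defensive.
Import Order.TTheory GRing.Theory Num.Theory.
Import numFieldNormedType.Exports.

Local Open Scope classical_set_scope.
Local Open Scope ring_scope.

Definition rV_display : measure_display. Proof. exact. Qed.

Section measurable_rV.
Context {R : realType} (n : nat).

Definition rV_coord (i : 'I_n) (x : 'rV[R]_n) : R := x 0 i.

Let rV_set0 : g_sigma_preimage rV_coord set0.
Proof. exact: sigma_algebra0. Qed.

Let rV_setC A : g_sigma_preimage rV_coord A -> g_sigma_preimage rV_coord (~` A).
Proof. exact: sigma_algebraC. Qed.

Let rV_bigcup (F : (set 'rV[R]_n)^nat) :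
  (forall i, g_sigma_preimage rV_coord (F i)) ->
  g_sigma_preimage rV_coord (\bigcup_i (F i)).
Proof. exact: sigma_algebra_bigcup. Qed.

HB.instance Definition _ := @isMeasurable.Build rV_display 'rV[R]_n
  (g_sigma_preimage rV_coord) rV_set0 rV_setC rV_bigcup.

End measurable_rV.

Section measurable_rV_lemmas.
Context {R : realType}.

Lemma measurable_rV_coord n (i : 'I_n) :
  measurable_fun setT (fun x : 'rV[R]_n => x 0 i).
Proof.
move=> _ Y mY; rewrite setTI; apply: sub_sigma_algebra => /=.
rewrite -bigcup_seq/=; exists i => /=; first by rewrite mem_index_enum.
by exists Y => //; rewrite setTI.
Qed.

Lemma measurable_fun_rVP d (T : measurableType d) n (f : T -> 'rV[R]_n) :
  (forall i, measurable_fun setT (fun t => f t 0 i)) -> measurable_fun setT f.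
Proof.
move=> mf _ A mA; rewrite setTI.
suff H : @measurable _ 'rV[R]_n `<=` [set B | measurable (f @^-1` B)] by exact: H.
apply: smallest_sub.
  split => [|B /= mB|F /= mF]; first by rewrite /= preimage_set0.
    by rewrite setTD -preimage_setC; exact: measurableC.
  by rewrite preimage_bigcup; exact: bigcup_measurable.
rewrite -bigcup_seq/=; apply: bigcup_sub => i _ _ [B mB <-] /=.
by rewrite setTI -[X in measurable X]setTI; exact: mf.
Qed.

Definition rV_cons n (z : R * 'rV[R]_n) : 'rV[R]_n.+1 :=
  row_mx (z.1%:M : 'rV[R]_1) z.2.

Lemma rV_cons0 n (z : R * 'rV[R]_n) : rV_cons z 0 ord0 = z.1.
Proof.
by rewrite mxE; case: splitP => [j _|j //]; rewrite ord1 mxE eqxx mulr1n.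
Qed.

Lemma rV_consS n (z : R * 'rV[R]_n) i : rV_cons z 0 (lift ord0 i) = z.2 0 i.
Proof.
rewrite mxE; case: splitP => [j|j [] /ord_inj ->//].
by rewrite ord1.
Qed.

Lemma measurable_rV_cons n : measurable_fun setT
  (@rV_cons n : measurableTypeR R * 'rV[R]_n -> 'rV[R]_n.+1).
Proof.
apply: measurable_fun_rVP => i.
have [->|[j ->]] : i = ord0 \/ exists j, i = lift ord0 j.
  by case: (unliftP ord0 i) => [j ->|->]; [right; exists j|left].
  under eq_fun do rewrite rV_cons0.
  exact: measurable_fst.
under eq_fun do rewrite rV_consS.
exact: (measurableT_comp (measurable_rV_coord j)).
Qed.

Definition rV_uncons n (x : 'rV[R]_n.+1) : measurableTypeR R * 'rV[R]_n :=
  (x 0 ord0, \row_j x 0 (lift ord0 j)).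

Lemma rV_consK n : cancel (@rV_cons n) (@rV_uncons n).
Proof.
move=> [a x]; rewrite /rV_uncons rV_cons0; congr pair.
by apply/rowP => j; rewrite mxE rV_consS.
Qed.

Lemma measurable_rV_uncons n : measurable_fun setT (@rV_uncons n).
Proof.
apply: measurable_fun_pair; first exact: measurable_rV_coord.
apply: measurable_fun_rVP => i; under eq_fun do rewrite mxE.
exact: measurable_rV_coord.
Qed.

End measurable_rV_lemmas.

Lemma product_measure_sigma_finite d1 d2 (T1 : measurableType d1)
    (T2 : measurableType d2) (R : realType)
    (m1 : {sigma_finite_measure set T1 -> \bar R})
    (m2 : {sigma_finite_measure set T2 -> \bar R}) :
  sigma_finite setT (m1 \x m2)%E.
Proof.
have /sigma_finiteP[F [TF ndF Foo]] := sigma_finiteT m1.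
have /sigma_finiteP[G [TG ndG Goo]] := sigma_finiteT m2.
exists (fun n => F n `*` G n).
  rewrite -setXTT TF TG predeqE => -[x y]; split.
    move=> [/= [n _ Fnx] [k _ Gky]]; exists (maxn n k) => //; split.
    - by move: x Fnx; exact/subsetPset/ndF/leq_maxl.
    - by move: y Gky; exact/subsetPset/ndG/leq_maxr.
  by move=> [n _ []/= ? ?]; split; exists n.
move=> k; have [? ?] := Foo k; have [? ?] := Goo k.
split; first exact: measurableX.
by rewrite product_measure1E// lte_mul_pinfty// ge0_fin_numE.
Qed.

Section lebesgue_rVS.
Context {R : realType} (n : nat).
Variable m : {sigma_finite_measure set 'rV[R]_n -> \bar R}.

Definition lebesgue_rVS : set 'rV[R]_n.+1 -> \bar R :=
  pushforward (@lebesgue_measure R \x m)%E (@rV_cons R n).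

Let mcons := @measurable_rV_cons R n.

Let lebesgue_rVS0 : lebesgue_rVS set0 = 0%E.
Proof. by rewrite /lebesgue_rVS /pushforward preimage_set0 measure0. Qed.

Let lebesgue_rVS_ge0 A : (0 <= lebesgue_rVS A)%E.
Proof. exact: measure_ge0. Qed.

Let lebesgue_rVS_sigma_additive : semi_sigma_additive lebesgue_rVS.
Proof.
move=> F mF tF mUF; rewrite /lebesgue_rVS /pushforward preimage_bigcup.
apply: measure_semi_sigma_additive.
- by move=> k; rewrite -[X in measurable X]setTI; exact: mcons.
- apply/trivIsetP => /= i j _ _ ij; rewrite -preimage_setI.
  by move/trivIsetP : tF => /(_ _ _ _ _ ij) ->//; rewrite preimage_set0.
- by rewrite -preimage_bigcup -[X in measurable X]setTI; exact: mcons.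
Qed.

HB.instance Definition _ := isMeasure.Build _ _ _ lebesgue_rVS
  lebesgue_rVS0 lebesgue_rVS_ge0 lebesgue_rVS_sigma_additive.

Let lebesgue_rVS_sigma_finite : sigma_finite setT lebesgue_rVS.
Proof.
have [F FT mF] := product_measure_sigma_finite (@lebesgue_measure R) m.
exists (fun k => @rV_uncons R n @^-1` F k).
  by rewrite -preimage_bigcup -FT preimage_setT.
move=> k; have [mFk Fk_fin] := mF k; split.
  by rewrite -[X in measurable X]setTI; exact: measurable_rV_uncons.
rewrite /lebesgue_rVS /pushforward -comp_preimage.
by rewrite (_ : _ \o _ = id) ?preimage_id//; apply/funext => z; exact: rV_consK.
Qed.

HB.instance Definition _ := @Measure_isSigmaFinite.Build _ _ _
  lebesgue_rVS lebesgue_rVS_sigma_finite.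

End lebesgue_rVS.

Section lebesgue_rV.
Context {R : realType}.

Fixpoint lebesgue_rV n : {sigma_finite_measure set 'rV[R]_n -> \bar R} :=
  if n is n'.+1 then lebesgue_rVS (lebesgue_rV n')
  else \d_(0 : 'rV[R]_0).

Lemma lebesgue_rV_box n (A : 'I_n -> set R) : (forall i, measurable (A i)) ->
  lebesgue_rV n [set x | forall i, A i (x 0 i)] =
  (\prod_(i < n) lebesgue_measure (A i))%E.
Proof.
elim: n A => [|n IHn] A mA.
  by rewrite big_ord0 /= diracE mem_set// => -[].
rewrite big_ord_recl -IHn; last by move=> i; exact: mA.
have mB : measurable [set x : 'rV[R]_n | forall i, A (lift ord0 i) (x 0 i)].
  have -> : [set x : 'rV[R]_n | forall i, A (lift ord0 i) (x 0 i)] =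
      \bigcap_(i in [set: 'I_n])
        ((fun x : 'rV[R]_n => x 0 i) @^-1` A (lift ord0 i)).
    by apply/seteqP; split => x /= h i; [move=> _|]; exact: h.
  apply: fin_bigcap_measurable => [|i _]; first exact: finite_finset.
  rewrite -[X in measurable X]setTI.
  exact: (measurable_rV_coord i measurableT (mA _)).
rewrite /= /lebesgue_rVS /pushforward -product_measure1E//; last exact: mA.
congr (_ _); apply/seteqP; split => -[a x] /= h.
  split; first by have := h ord0; rewrite rV_cons0.
  by move=> i; have := h (lift ord0 i); rewrite rV_consS.
case: h => ha hx i; case: (unliftP ord0 i) => [j ->|->].
  by rewrite rV_consS.
by rewrite rV_cons0.
Qed.

End lebesgue_rV.

Section euclidean.
Context {R : realType}.

(* The norm of the library on 'rV[R]_n is the sup norm. *)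
Definition enorm n (x : 'rV[R]_n) : R := Num.sqrt (\sum_(i < n) x 0 i ^+ 2).

(* Essential support of f, for F the filter of conull sets. *)
Definition ess_supp (V : topologicalType) (F : set_system V) (f : V -> R) :
    set V :=
  ~` \bigcup_(U in [set U | open U /\ F [set x | U x -> f x = 0]]) U.

(* For V of finite dimension, being C^infinity amounts to having all iterated
   directional derivatives, each of them continuous. *)
Definition smooth (V : normedModType R) (f : V -> R) : Prop :=
  forall vs : seq V, let h := foldr (fun v k => 'D_v k) f vs in
  continuous h /\ forall x v, derivable h x v.

Definition test_function (V : normedModType R) (U : set V) (phi : V -> R) :=
  let supp := closure [set x | phi x != 0] in
  [/\ smooth phi, compact supp & supp `<=` U].

End euclidean.

Section function_spaces.
Context {R : realType} {n : nat}.
Implicit Types (v dv : 'rV[R]_n -> R) (w dw : R -> 'rV[R]_n -> R).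

Local Notation leb := (lebesgue_rV n).

Definition is_weak_partial (i : 'I_n) v dv : Prop :=
  forall psi : 'rV[R]_n -> R, test_function setT psi ->
  \int[leb]_x (v x * 'D_(delta_mx 0 i) psi x) = - \int[leb]_x (dv x * psi x).

Definition sobolev_H1 v : Prop := v \in Lfun leb 2%:E /\
  forall i, exists2 dv, dv \in Lfun leb 2%:E & is_weak_partial i v dv.

Definition C0_Lp (p : R) (I : set R) w : Prop := forall t, I t ->
  w t \in Lfun leb p%:E /\
  Lnorm leb p%:E (EFin \o (w s \- w t)) @[s --> within I (nbhs t)] --> 0%E.

(* The derivative dw is one-sided at an endpoint belonging to I. *)
Definition C1_Lp (p : R) (I : set R) w dw : Prop :=
  [/\ C0_Lp p I w, C0_Lp p I dw & forall t, I t ->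
    Lnorm leb p%:E
      (EFin \o (fun x => (s - t)^-1 * (w s x - w t x) - dw t x))
      @[s --> within I (dnbhs t)] --> 0%E].

Definition C0_H1 (I : set R) w (dw : 'I_n -> R -> 'rV[R]_n -> R) : Prop :=
  [/\ C0_Lp 2 I w, forall i, C0_Lp 2 I (dw i) &
    forall i t, I t -> is_weak_partial i (w t) (dw i t)].

Definition Lq_loc (q : R) (I : set R) w : Prop :=
  measurable_fun (setT `*` I)
    (fun z : 'rV[R]_n * measurableTypeR R => w z.2 z.1) /\
  forall K : set ('rV[R]_n * R), compact K -> K `<=` setT `*` I ->
    (\int[leb \x @lebesgue_measure R]_(z in K) (`|w z.2 z.1| `^ q)%:E < +oo)%E.

End function_spaces.

Section energy_solution.
Context {R : realType} {n : nat}.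
Variables (mu beta p q : R) (f g : 'rV[R]_n -> R) (eps T : R).
Implicit Types (u ut : R -> 'rV[R]_n -> R) (du : 'I_n -> R -> 'rV[R]_n -> R).

Local Notation leb := (lebesgue_rV n).
Local Notation lambda := (@lebesgue_measure R).

Definition energy_regularity u ut du : Prop :=
  [/\ C0_H1 `[0, T[ u du, C1_Lp 2 `[0, T[ u ut, C1_Lp p `]0, T[ u ut &
      Lq_loc q `]0, T[ u].

Definition weak_identity u ut du (phi : 'rV[R]_n * R -> R) (t : R) : Prop :=
  let phit z := 'D_((0 : 'rV[R]_n), 1) phi z in
  let dphi i z := 'D_(delta_mx 0 i, 0 : R) phi z in
  \int[leb]_x (ut t x * phi (x, t))
  - \int[leb]_x (eps * g x * phi (x, 0))
  + \int[lambda]_(s in `[0, t]) (\int[leb]_x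
      (- (ut s x * phit (x, s)) + \sum_(i < n) du i s x * dphi i (x, s)))
  + \int[lambda]_(s in `[0, t]) (\int[leb]_x
      (mu * ut s x / (1 + s) `^ beta * phi (x, s)))
  = \int[lambda]_(s in `[0, t]) (\int[leb]_x (`|ut s x| `^ p * phi (x, s)))
  + \int[lambda]_(s in `[0, t]) (\int[leb]_x (`|u s x| `^ q * phi (x, s))).

(* The library assigns a value to divergent integrals, so the convergence of
   the integrals of the nonlinear terms down to s = 0 has to be required. *)
Definition nonlinear_terms_integrable u ut (phi : 'rV[R]_n * R -> R) (t : R) :=
  lambda.-integrable `[0, t]
    (fun s => \int[leb]_x (`|ut s x| `^ p * phi (x, s))%:E)%E /\
  lambda.-integrable `[0, t]
    (fun s => \int[leb]_x (`|u s x| `^ q * phi (x, s))%:E)%E.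

(* Functions in C_0^infinity(R^n x [0, T)) are the restrictions to t >= 0 of
   test functions on R^n x (-oo, T). *)
Definition energy_solution u : Prop := exists ut du,
  [/\ energy_regularity u ut du,
      \forall x \ae leb, u 0 x = eps * f x &
      forall phi, test_function [set z : 'rV[R]_n * R | z.2 < T] phi ->
      forall t, 0 <= t < T ->
      nonlinear_terms_integrable u ut phi t /\ weak_identity u ut du phi t].

(* The values of u outside [0, T) are irrelevant, hence the truncation. *)
Definition spacetime_supp u : set ('rV[R]_n * R) :=
  ess_supp (almost_everywhere (leb \x lambda)%E)
    (fun z => if 0 <= z.2 < T then u z.2 z.1 else 0).

End energy_solution.

(* Main.v *)
(* Test the equation with cutoffs of the plane waves e^(k.x - |k| s), k = (-1, y).
   Since beta > 1 the damping is integrable in time, so the resulting ODE gives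
   int u_t e^(k.x - |k| s) dx >= c eps for all s. A wave with a single k charges
   only a parabolic cap of the ball |x| <= s + R, of volume O(s^((n-1)/2)); the
   waves with y on a grid of mesh s^(-1/2) in [0, 1]^(n-1) have a bounded sum.
   The power mean inequality on each of them and summation yield
   int |u_t|^p dx >= c eps^p s^((n-1)(1-p/2)).
   For k = 0, F(s) = int u dx is then bounded below through F'' ~ int |u_t|^p and
   satisfies F(x + h) >= c h^2 s^(-n(q-1)) F(x)^q through int |u|^q. At the time
   tau ~ eps^(-2p(q-1)/theta), theta = 2q + 2 - (n-1)p(q-1), these two facts force
   the blow-up of F before 2 tau. *)
From HB Require Import structures.
Require Import Defs.
From mathcomp Require Import all_boot all_order all_algebra.
From mathcomp Require Import all_classical all_reals all_analysis.
From mathcomp Require Import measurable_realfun.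
From mathcomp Require Import ring lra.

Set Implicit Arguments.
Unset Strict Implicit.
Unset Printing Implicit Defensive.
Import Order.TTheory GRing.Theory Num.Theory.
Import numFieldNormedType.Exports.

Local Open Scope classical_set_scope.
Local Open Scope ring_scope.

(** * Smooth test functions *)

Section elem.
Context {R : realType}.

(** The grid of directions gains a factor s^((n-1)/2), the number of waves: each alone yields only
    eps^p s^((n-1)(1-p)/2). It stands in for the spherical average of e^(x.omega), and needs a
    Gaussian integral and a geometric series instead of the asymptotics of that average. The
    obstacle on the ODE side is that the time integrals of the nonlinear terms are only known to be
    nondecreasing, so the identities cannot be differentiated: each unknown is split into a
    differentiable part and a monotone part, and [gronwall_lower] works on this splitting. For a
    plane wave, velocity H and position G are coupled through lam^2 G, a term of good sign only
    while H stays positive; a first-zero argument breaks this circle. All estimates on [0, t1] share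
    one cutoff radius M >= t1 + rad + 2, so that the cutoffs equal 1 on the light cone that carries
    u. Writing tau = sigma^2 turns square roots of time into powers of sigma; theta is the exponent
    of sigma in the blow-up condition, and p(q-1) that of eps. *)

Definition Cinf (k : R -> R) := forall n x, derivable (derive1n n k) x 1.

Lemma Cinf_derive1 k : Cinf k -> Cinf (derive1 k).
Proof. by move=> kC n x; rewrite -derive1Sn; exact: kC. Qed.

(** [smooth] asks for all iterated directional derivatives. The Leibniz and chain rules send this
    class into itself as soon as the base functions have constant derivatives ([affine_base]); every
    member is then smooth, by induction on the list of directions. *)
Inductive elem (V : normedModType R) (L : set (V -> R)) : (V -> R) -> Prop :=
| elem_cst c : elem L (cst c)
| elem_base l : L l -> elem L l
| elem_add h k : elem L h -> elem L k -> elem L (h \+ k)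
| elem_mul h k : elem L h -> elem L k -> elem L (h \* k)
| elem_inv h : (forall x, h x != 0) -> elem L h -> elem L (fun x => (h x)^-1)
| elem_comp k h : Cinf k -> elem L h -> elem L (k \o h).

Definition affine_base (V : normedModType R) (L : set (V -> R)) :=
  forall l, L l -> (forall x, differentiable l x) /\
    forall v, exists c, 'D_v l = cst c.

Lemma elem_subst (V W : normedModType R) (L : set (V -> R)) (L' : set (W -> R))
    (g : W -> V) : (forall l, L l -> elem L' (l \o g)) ->
  forall h, elem L h -> elem L' (h \o g).
Proof.
move=> Lg h; elim => {h} [c|l Ll|h k _ ih _ ik|h k _ ih _ ik|h h0 _ ih|k h kC _ ih].
- exact: (elem_cst _ c).
- exact: Lg.
- exact: (elem_add ih ik).
- exact: (elem_mul ih ik).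
- by apply: (@elem_inv _ _ (h \o g)) => // x; exact: h0.
- exact: (elem_comp kC ih).
Qed.

Lemma elem_diff (V : normedModType R) (L : set (V -> R)) : affine_base L ->
  forall h, elem L h ->
  (forall x, differentiable h x) /\ forall v, elem L ('D_v h).
Proof.
move=> aL h; elim => {h} [c|l Ll|h k _ [dh ih] ek [dk ik]|h k eh [dh ih] ek [dk ik]|h h0 eh [dh ih]|k h kC eh [dh ih]].
- split=> [x|v]; first exact: differentiable_cst.
  by rewrite (_ : 'D_v _ = cst 0); [exact: elem_cst|apply/funext => x; rewrite derive_cst].
- have [dl cl] := aL _ Ll; split=> // v; have [c ->] := cl v; exact: elem_cst.
- split=> [x|v]; first exact: differentiableD.
  rewrite (_ : 'D_v _ = 'D_v h \+ 'D_v k); first exact: elem_add.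
  by apply/funext => x; rewrite deriveD//; exact: diff_derivable.
- split=> [x|v]; first exact: differentiableM.
  rewrite (_ : 'D_v _ = (h \* 'D_v k) \+ (k \* 'D_v h)).
    by apply: elem_add; apply: elem_mul.
  by apply/funext => x; rewrite deriveM//; exact: diff_derivable.
- split=> [x|v]; first exact: differentiableV.
  rewrite (_ : 'D_v _ = cst (-1) \* ((fun x => (h x)^-1) \* (fun x => (h x)^-1)) \* 'D_v h).
    apply: elem_mul => //; apply: elem_mul; first exact: elem_cst.
    by apply: elem_mul; apply: elem_inv.
  apply/funext => x; rewrite deriveV//=; last exact: diff_derivable.
  by rewrite /GRing.scale/= -expr2 mulN1r -exprVn.
- have dk x : differentiable k x by apply/derivable1_diffP; exact: (kC 0%N).
  split=> [x|v]; first by apply: differentiable_comp.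
  rewrite (_ : 'D_v _ = (derive1 k \o h) \* 'D_v h).
    by apply: elem_mul => //; apply: elem_comp => //; exact: Cinf_derive1.
  apply/funext => x; rewrite deriveE; last exact: differentiable_comp.
  rewrite diff_comp//= diff1E//= deriveE// /GRing.scale/= mulrC.
  by rewrite derive1E.
Qed.

Lemma elem_smooth (V : normedModType R) (L : set (V -> R)) h :
  affine_base L -> elem L h -> smooth h.
Proof.
move=> aL eh vs; set k := foldr _ _ _.
have ek : elem L k.
  by rewrite /k; elim: vs {k} => [//|v vs ih] /=; exact: (elem_diff aL ih).2.
have dk := (elem_diff aL ek).1; split=> [x|x v].
  exact: differentiable_continuous.
exact: diff_derivable.
Qed.

End elem.

(** * Functions flat at the origin *)

Section bump.
Context {R : realType}.

Lemma Cinf_expR : Cinf (@expR R).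
Proof.
have E n : derive1n n (@expR R) = expR.
  elim: n => [//|n ih]; rewrite derive1nS ih; apply/funext => x.
  by rewrite derive1E; exact: derive_val.
by move=> n x; rewrite E; exact: derivable_expR.
Qed.

(** The inequality z <= e^z at z = y / k, raised to the power k. *)
Lemma exprn_le_expR (k : nat) (y : R) : 0 <= y -> y ^+ k <= k%:R ^+ k * expR y.
Proof.
move=> y0; case: k => [|k]; first by rewrite !expr0 mul1r -expR0 ler_expR.
have k0 : (0 : R) < k.+1%:R by rewrite ltr0n.
have -> : expR y = expR (y / k.+1%:R) ^+ k.+1.
  by rewrite -expRM_natr divfK// gt_eqF.
rewrite -exprMn; apply: lerXn2r; rewrite ?nnegrE// ?mulr_ge0 ?expR_ge0//.
rewrite mulrC -ler_pdivrMr//.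
by apply: (le_trans _ (expR_ge1Dx _)); rewrite lerDr.
Qed.

Lemma horner_le_expR (p : {poly R}) : exists2 C : R, 0 <= C &
  forall y, 0 <= y -> `|p.[y]| <= C * expR y.
Proof.
exists (\sum_(i < size p) `|p`_i| * i%:R ^+ i).
  by apply: sumr_ge0 => i _; rewrite mulr_ge0// exprn_ge0.
move=> y y0; rewrite horner_coef mulr_suml; apply: (le_trans (ler_norm_sum _ _ _)).
apply: ler_sum => i _; rewrite normrM -mulrA ler_wpM2l//.
by rewrite ger0_norm ?exprn_ge0//; exact: exprn_le_expR.
Qed.

(** The factor p(1/x) makes the family of functions p(1/x) e^(-1/x) stable under differentiation, so
    that one derivative formula yields all orders. *)
Definition flat (p : {poly R}) (x : R) : R :=
  if 0 < x then p.[x^-1] * expR (- x^-1) else 0.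

Lemma is_derive_flat p (x : R) :
  is_derive x 1 (flat p) (flat ((p - p^`()) * 'X^2) x).
Proof.
have [x0|x0|->] := ltgtP x 0.
- rewrite [X in is_derive _ _ _ X]/flat ltNge (ltW x0)/=.
  apply: (@near_eq_is_derive _ _ _ (cst 0)).
    near=> z; rewrite /flat ltNge (_ : z <= 0)//=; apply: ltW; near: z.
    exact: lt_nbhsl.
- rewrite [X in is_derive _ _ _ X]/flat x0/=.
  apply: (@near_eq_is_derive R R^o R^o (fun x : R => p.[x^-1] * expR (- x^-1)) (flat p) x 1).
  + near=> z; rewrite /flat (_ : 0 < z)//; near: z; exact: lt_nbhsr.
  + have xn0 : x != 0 by rewrite gt_eqF.
    have dV : is_derive x 1 (fun x : R => x^-1) (- x ^- 2).
      apply: is_derive_eq; first exact: is_deriveV.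
      by rewrite /GRing.scale/= mulr1.
    have d1 : is_derive (x^-1) 1 (horner p) p^`().[x^-1].
      apply: DeriveDef; first exact: derivable_horner.
      by rewrite -derive1E -derivE.
    have d2 := @is_derive1_comp _ (horner p) (fun x : R => x^-1) x _ _ d1 dV.
    have d3 : is_derive x 1 (fun x : R => - x^-1) (x ^- 2).
      by apply: is_derive_eq; rewrite opprK.
    have d4 := @is_derive1_comp _ expR (fun x : R => - x^-1) x _ _ (is_derive_expR _) d3.
    have d5 := is_deriveM d2 d4.
    apply: is_derive_eq.
    rewrite /GRing.scale/= hornerM hornerXn hornerD hornerN/= -!exprVn; ring.
- rewrite [X in is_derive _ _ _ X]/flat ltxx.
  (* The bound is taken for p X^2 and not for p: at y = 1/z it reads |flat p z| <= C z^2, which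
     makes the difference quotient at 0 of order h. *)
  have [C C0 HC] := horner_le_expR (p * 'X^2).
  have ub z : `|flat p z| <= C * z ^+ 2.
    rewrite /flat; case: ifPn => [z0|_]; last first.
      by rewrite normr0 mulr_ge0// sqr_ge0.
    have := HC z^-1; rewrite invr_ge0 (ltW z0) => /(_ erefl).
    rewrite hornerM hornerXn normrM (ger0_norm (x := _ ^+ 2)) ?exprn_ge0 ?invr_ge0 ?(ltW z0)//.
    rewrite normrM (ger0_norm (expR_ge0 _)) expRN => h.
    rewrite ler_pdivrMr ?expR_gt0//.
    have zn : z != 0 by rewrite gt_eqF.
    rewrite (_ : `|_| = (`|p.[z^-1]| * z^-1 ^+ 2) * z ^+ 2); last by field.
    by rewrite [leRHS]mulrAC ler_wpM2r// sqr_ge0.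
  have lim0 : (fun h : R => h^-1 *: ((flat p \o shift 0) (h *: (1:R)) - flat p 0)) @ 0^' --> (0 : R).
    apply/cvgrPdist_le => e e0; near=> h.
    rewrite sub0r normrN normrM /= addr0 /GRing.scale/= mulr1.
    rewrite [flat p 0]/flat ltxx subr0.
    have hn0 : 0 < `|h| by rewrite normr_gt0; near: h; exact: nbhs_dnbhs_neq.
    rewrite normfV mulrC ler_pdivrMr//; apply: (le_trans (ub h)).
    rewrite -real_normK ?num_real// expr2 mulrA ler_wpM2r//.
    apply: (@le_trans _ _ (C * (e / (C + 1)))).
      rewrite ler_wpM2l//; near: h; apply: dnbhs0_le; rewrite divr_gt0//.
      by rewrite ltr_wpDl.
    rewrite mulrCA ger_pMr// ler_pdivrMr ?mul1r ?lerDl//.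
    by rewrite ltr_wpDl.
  apply: DeriveDef; first by apply/cvg_ex; exists 0.
  by apply/cvg_lim => //; exact: lim0.
Unshelve. all: by end_near. Qed.

Lemma Cinf_flat p : Cinf (flat p).
Proof.
have E n : exists q, derive1n n (flat p) = flat q.
  elim: n => [|n [q ih]]; first by exists p.
  exists ((q - q^`()) * 'X^2); rewrite derive1nS ih; apply/funext => x.
  by rewrite derive1E; apply: derive_val; exact: is_derive_flat.
by move=> n x; have [q ->] := E n; case: (is_derive_flat q x).
Qed.
End bump.

(** * Cutoffs and truncated plane waves *)

Section cutoffs.
Context {R : realType}.

Lemma affine_base_linear (V : normedModType R) (L : set (V -> R)) :
  (forall l, L l -> linear (l : V -> R^o) /\ continuous l) -> affine_base L.
Proof.
move=> HL l /HL[ll cl].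
pose lM := GRing.isLinear.Build _ _ _ _ _ ll.
pose f : {linear V -> R^o} := HB.pack l lM.
have dl x : differentiable (l : V -> R^o) x by exact: (@linear_differentiable _ _ _ f).
split=> // v; exists (l v); apply/funext => x.
by rewrite deriveE//=; rewrite (@diff_lin _ _ _ f).
Qed.

Definition idbase : set (R -> R) := [set id].
Definition xbase n : set ('rV[R]_n -> R) := range (fun (i : 'I_n) (x : 'rV[R]_n) => x 0 i).
Definition xtbase n : set ('rV[R]_n * R -> R) :=
  range (fun (i : 'I_n) (z : 'rV[R]_n * R) => z.1 0 i) `|` [set snd].

Lemma affine_idbase : affine_base idbase.
Proof. by apply: affine_base_linear => l ->; split=> // x; exact: cvg_id. Qed.

Lemma affine_xbase n : affine_base (@xbase n).
Proof.
apply: affine_base_linear => _ [i _ <-]; split; last exact: coord_continuous.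
by move=> a x y; rewrite !mxE.
Qed.

Lemma affine_xtbase n : affine_base (@xtbase n).
Proof.
apply: affine_base_linear => _ [[i _ <-]|->]; split.
- by move=> a x y; rewrite !mxE.
- move=> z; apply: (@continuous_comp _ _ _ fst (fun x : 'rV[R]_n => x 0 i)).
    exact: cvg_fst.
  exact: coord_continuous.
- by [].
- by move=> z; exact: cvg_snd.
Qed.

Lemma elem_sum (V : normedModType R) (L : set (V -> R)) (I : Type) (s : seq I)
    (h : I -> V -> R) : (forall i, elem L (h i)) ->
  elem L (fun x => \sum_(i <- s) h i x).
Proof.
move=> eh; elim: s => [|i s ih].
  by rewrite (_ : (fun _ => _) = cst 0); [exact: elem_cst|apply/funext => x; rewrite big_nil].
rewrite (_ : (fun _ => _) = h i \+ (fun x => \sum_(i <- s) h i x)).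
  exact: elem_add.
by apply/funext => x; rewrite big_cons.
Qed.

Lemma elem_prod (V : normedModType R) (L : set (V -> R)) (I : Type) (s : seq I)
    (h : I -> V -> R) : (forall i, elem L (h i)) ->
  elem L (fun x => \prod_(i <- s) h i x).
Proof.
move=> eh; elim: s => [|i s ih].
  by rewrite (_ : (fun _ => _) = cst 1); [exact: elem_cst|apply/funext => x; rewrite big_nil].
rewrite (_ : (fun _ => _) = h i \* (fun x => \prod_(i <- s) h i x)).
  exact: elem_mul.
by apply/funext => x; rewrite big_cons.
Qed.

Lemma flat1_gt0 (x : R) : 0 < x -> 0 < flat 1 x.
Proof. by move=> x0; rewrite /flat x0 hornerC mul1r expR_gt0. Qed.

Lemma flat1_ge0 (x : R) : 0 <= flat 1 x.
Proof. by rewrite /flat; case: ifP => // _; rewrite hornerC mul1r expR_ge0. Qed.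

Lemma flat1_eq0 (x : R) : x <= 0 -> flat 1 x = 0.
Proof. by rewrite /flat ltNge => ->. Qed.

(** A smooth transition from the value 1 on x <= 0 to the value 0 on x >= 1. The denominator is
    positive because x and 1 - x are never both nonpositive. *)
Definition step (x : R) : R := flat 1 (1 - x) / (flat 1 x + flat 1 (1 - x)).

Lemma step_den (x : R) : 0 < flat 1 x + flat 1 (1 - x).
Proof.
have [x0|x0] := leP x 0.
  by rewrite ltr_wpDl ?flat1_ge0// flat1_gt0//; lra.
by rewrite ltr_pwDl ?flat1_ge0// flat1_gt0.
Qed.

Lemma step_ge0 x : 0 <= step x.
Proof. by rewrite divr_ge0// ?flat1_ge0// ltW// step_den. Qed.

Lemma step_le1 x : step x <= 1.
Proof. by rewrite ler_pdivrMr ?step_den// mul1r lerDr flat1_ge0. Qed.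

Lemma step_eq1 x : x <= 0 -> step x = 1.
Proof.
move=> x0; rewrite /step (flat1_eq0 x0) add0r divff// gt_eqF// flat1_gt0//; lra.
Qed.

Lemma step_eq0 x : 1 <= x -> step x = 0.
Proof. by move=> x1; rewrite /step (@flat1_eq0 (1 - x)) ?mul0r//; lra. Qed.

Lemma elem_affine (a b : R) : elem idbase (fun x => a * x + b).
Proof.
apply: (@elem_add _ _ idbase (fun x => a * x) (cst b)); last exact: elem_cst.
by apply: (@elem_mul _ _ idbase (cst a) id); [exact: elem_cst|exact: elem_base].
Qed.

Lemma elem_step : elem idbase step.
Proof.
have e0 : elem idbase (flat 1 : R -> R).
  exact: (@elem_comp _ _ idbase _ id (@Cinf_flat R 1) (elem_base (erefl _))).
have e1 : elem idbase (fun x : R => flat 1 (1 - x)).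
  apply: (@elem_comp _ _ idbase _ (fun x => 1 - x) (@Cinf_flat R 1)).
  have := elem_affine (-1) 1.
  by under eq_fun do rewrite mulN1r addrC.
apply: (@elem_mul _ _ idbase (fun x : R => flat 1 (1 - x)) (fun x => (flat 1 x + flat 1 (1 - x))^-1)) => //.
apply: elem_inv => [x|]; first by rewrite gt_eqF// step_den.
exact: (elem_add e0 e1).
Qed.

(** Equal to 1 on [a, b]; [d] is the width of the two transitions, so the support lies in
    [a - d, b + d]. *)
Definition plateau (a b d : R) (x : R) := step ((x - b) / d) * step ((a - x) / d).

Lemma plateau_ge0 a b d x : 0 <= plateau a b d x.
Proof. by rewrite mulr_ge0// step_ge0. Qed.

Lemma plateau_le1 a b d x : plateau a b d x <= 1.
Proof. by rewrite mulr_ile1 ?step_ge0 ?step_le1. Qed.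

Lemma plateau_eq1 a b d x : 0 < d -> a <= x <= b -> plateau a b d x = 1.
Proof.
move=> d0 /andP[ax xb]; rewrite /plateau !step_eq1 ?mul1r//.
  by rewrite pmulr_lle0 ?invr_gt0// subr_le0.
by rewrite pmulr_lle0 ?invr_gt0// subr_le0.
Qed.

Lemma plateau_neq0 a b d x : 0 < d -> plateau a b d x != 0 -> a - d <= x <= b + d.
Proof.
move=> d0; apply: contraR; rewrite negb_and -!ltNge => /orP[h|h].
  by rewrite /plateau (@step_eq0 ((a - x) / d)) ?mulr0// ler_pdivlMr// mul1r; lra.
by rewrite /plateau step_eq0 ?mul0r// ler_pdivlMr// mul1r; lra.
Qed.

Lemma elem_plateau a b d : elem idbase (plateau a b d).
Proof.
apply: (@elem_mul _ _ idbase (fun x => step ((x - b) / d)) (fun x => step ((a - x) / d))).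
  apply: (@elem_subst _ _ _ idbase idbase (fun x => (x - b) / d)) elem_step => _ ->.
  rewrite (_ : _ \o _ = (fun x => d^-1 * x + (- b / d))); first exact: elem_affine.
  by apply/funext => x /=; ring.
apply: (@elem_subst _ _ _ idbase idbase (fun x => (a - x) / d)) elem_step => _ ->.
rewrite (_ : _ \o _ = (fun x => - d^-1 * x + (a / d))); first exact: elem_affine.
by apply/funext => x /=; ring.
Qed.

Definition dotp n (k x : 'rV[R]_n) : R := \sum_i k 0 i * x 0 i.

(** A product over the coordinates, because these are smooth base functions whereas the Euclidean
    norm is not smooth at 0. The level sets are therefore cubes. *)
Definition cutoff n (M : R) (x : 'rV[R]_n) := \prod_i plateau (- M) M 1 (x 0 i).

(** Where the cutoffs equal 1, the product with [time_test] at [lam = enorm k] is e^(k.x - |k| s), a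
    solution of the free wave equation. *)
Definition space_test n (M : R) (k x : 'rV[R]_n) := cutoff M x * expR (dotp k x).

Definition time_test (a b d lam s : R) := plateau a b d s * expR (- lam * s).

Lemma elem_space_test n M (k : 'rV[R]_n) : elem (@xbase n) (space_test M k).
Proof.
apply: elem_mul.
  apply: elem_prod => i; apply: (elem_subst _ (elem_plateau (- M) M 1)) => _ ->.
  by apply: elem_base; exists i.
apply: (elem_comp Cinf_expR); apply: elem_sum => i.
apply: (@elem_mul _ _ (@xbase n) (cst (k 0 i)) (fun x => x 0 i)); first exact: elem_cst.
by apply: elem_base; exists i.
Qed.

Lemma elem_time_test a b d lam : elem idbase (time_test a b d lam).
Proof.
apply: elem_mul; first exact: elem_plateau.
apply: (elem_comp Cinf_expR); have := elem_affine (- lam) 0.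
by under eq_fun do rewrite addr0.
Qed.

Lemma elem_space_time n (X : 'rV[R]_n -> R) (S : R -> R) :
  elem (@xbase n) X -> elem idbase S -> elem (@xtbase n) (fun z => X z.1 * S z.2).
Proof.
move=> eX eS; apply: (@elem_mul _ _ (@xtbase n) (X \o fst) (S \o snd)).
  by apply: elem_subst eX => _ [i _ <-]; apply: elem_base; left; exists i.
by apply: elem_subst eS => _ ->; apply: elem_base; right.
Qed.

Lemma cutoff_ge0 n M (x : 'rV[R]_n) : 0 <= cutoff M x.
Proof. by apply: prodr_ge0 => i _; exact: plateau_ge0. Qed.

Lemma cutoff_le1 n M (x : 'rV[R]_n) : cutoff M x <= 1.
Proof. by apply: prodr_ile1 => i _; rewrite plateau_ge0 plateau_le1. Qed.

Lemma cutoff_eq1 n M (x : 'rV[R]_n) : (forall i, `|x 0 i| <= M) -> cutoff M x = 1.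
Proof. by move=> h; apply: big1 => i _; apply: plateau_eq1 => //; rewrite -ler_norml. Qed.

Lemma cutoff_neq0 n M (x : 'rV[R]_n) : cutoff M x != 0 -> forall i, `|x 0 i| <= M + 1.
Proof.
move=> + i; rewrite /cutoff (bigD1 i)//= mulf_eq0 negb_or => /andP[+ _].
by move=> /(plateau_neq0 ltr01); rewrite ler_norml opprD.
Qed.

Definition cube n (M : R) : set 'rV[R]_n := [set x | forall i, `|x 0 i| <= M].

Lemma compact_cube n M : compact (@cube n M).
Proof.
have -> : @cube n M = [set x | forall i, `[- M, M]%classic (x 0 i)].
  by apply/seteqP; split => x /= h i; have := h i; rewrite in_itv/= ler_norml.
by apply: (@rV_compact R n (fun=> `[- M, M]%classic)) => i; exact: segment_compact.
Qed.

Lemma closed_cube n M : closed (@cube n M).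
Proof. by apply: compact_closed; [exact: norm_hausdorff|exact: compact_cube]. Qed.

Lemma test_function_space n (X : 'rV[R]_n -> R) M :
  elem (@xbase n) X -> (forall x, X x != 0 -> cube M x) -> test_function setT X.
Proof.
move=> eX XM; split => //; first exact: elem_smooth (@affine_xbase n) eX.
apply: (subclosed_compact _ (@compact_cube n M)); first exact: closed_closure.
by rewrite [X in _ `<=` X](closure_id _).1; [apply: closure_subset => x; exact: XM|exact: closed_cube].
Qed.

Lemma test_function_space_time n (X : 'rV[R]_n -> R) (S : R -> R) M a b T :
  elem (@xbase n) X -> (forall x, X x != 0 -> cube M x) ->
  elem idbase S -> (forall s, S s != 0 -> a <= s <= b) -> b < T ->
  test_function [set z : 'rV[R]_n * R | z.2 < T] (fun z => X z.1 * S z.2).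
Proof.
move=> eX XM eS Sab bT.
have cK : compact (@cube n M `*` `[a, b]).
  by apply: compact_setX; [exact: compact_cube|exact: segment_compact].
have sub : closure [set z : 'rV[R]_n * R | X z.1 * S z.2 != 0] `<=` @cube n M `*` `[a, b].
  rewrite [X in _ `<=` X](closure_id _).1.
    apply: closure_subset => -[x s] /=; rewrite mulf_eq0 negb_or => /andP[/XM ? /Sab ?].
    by split => //=; rewrite in_itv.
  by apply: compact_closed cK; exact: norm_hausdorff.
split.
- exact: elem_smooth (@affine_xtbase n) (elem_space_time eX eS).
- by apply: (subclosed_compact _ cK) => //; exact: closed_closure.
- by move=> z /sub[_ /=]; rewrite in_itv/= => /andP[_ zb]; exact: le_lt_trans bT.
Qed.

End cutoffs.

(** * L2 pairings *)

Lemma cvge0_near_lt (R : realType) (S : Type) (F : set_system S) (f : S -> \bar R) c :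
  f s @[s --> F] --> 0%E -> 0 < c -> \forall s \near F, (f s < c%:E)%E.
Proof.
move=> fF c0; apply: (fF [set y | (y < c%:E)%E]).
by apply: open_nbhs_nbhs; split; [exact: open_ereal_lt_ereal|rewrite /= lte_fin].
Qed.

Section L2.
Context d (T : measurableType d) (R : realType).
Variable mu : {measure set T -> \bar R}.
Implicit Types f g h X : T -> R.

Lemma Lfun_measurable p f : f \in Lfun mu p -> measurable_fun setT f.
Proof. by rewrite inE => /andP[/[!inE]]. Qed.

Lemma Lfun2_fin_norm f : f \in Lfun mu 2%:E -> ('N[mu]_2%:E[EFin \o f] < +oo)%E.
Proof. by rewrite inE => /andP[_]; rewrite inE. Qed.

Lemma Lfun2_lin (a : R) f g : f \in Lfun mu 2%:E -> g \in Lfun mu 2%:E ->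
  (fun x => a * f x + g x) \in Lfun mu 2%:E.
Proof.
move=> f2 g2; have [|_ H] := @Lfun_submod_closed _ _ _ mu 2%:E.
  by rewrite lee_fin ler1n.
exact: (H a _ _ f2 g2).
Qed.

Lemma Lfun2B f g : f \in Lfun mu 2%:E -> g \in Lfun mu 2%:E ->
  (f \- g) \in Lfun mu 2%:E.
Proof.
move=> f2 g2; rewrite (_ : f \- g = (fun x => -1 * g x + f x)); first exact: Lfun2_lin.
by apply/funext => x /=; rewrite mulN1r addrC.
Qed.

Lemma Lfun2Z (a : R) f : f \in Lfun mu 2%:E -> (fun x => a * f x) \in Lfun mu 2%:E.
Proof.
move=> f2; rewrite (_ : (fun x => _) = (fun x => (a - 1) * f x + f x)); first exact: Lfun2_lin.
by apply/funext => x /=; ring.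
Qed.

Lemma Lfun2_bounded X (A : set T) C : measurable_fun setT X -> measurable A ->
  (mu A < +oo)%E -> (forall x, `|X x| <= C) -> (forall x, X x != 0 -> A x) ->
  X \in Lfun mu 2%:E.
Proof.
move=> mX mA Aoo XC XA; rewrite inE; apply/andP; split; rewrite inE//=.
rewrite /finite_norm unlock poweR_lty//.
apply: (@le_lt_trans _ _ (\int[mu]_(x in A) (C `^ 2)%:E)%E).
  rewrite [leRHS]integral_mkcond; apply: ge0_le_integral => //.
  - by move=> x _; rewrite lee_fin powR_ge0.
  - apply/measurable_EFinP; apply: (measurableT_comp (measurable_powR _)) => //.
    exact: measurableT_comp.
  - by apply/(measurable_restrictT _ mA); exact: measurable_cst.
  - move=> x _; rewrite patchE; case: ifPn => xA.
      by rewrite lee_fin ge0_ler_powR ?nnegrE// (le_trans _ (XC x)).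
    have X0 : X x = 0 by apply/eqP; apply: contraNT xA => /XA; rewrite inE.
    by rewrite /= X0 normr0 powR0// pnatr_eq0.
rewrite integral_cst// lte_mul_pinfty// ?lee_fin ?powR_ge0//.
Qed.

Definition pairing f X : R := \int[mu]_x (f x * X x).

Lemma pairing_integrable f X : f \in Lfun mu 2%:E -> X \in Lfun mu 2%:E ->
  mu.-integrable setT (EFin \o (fun x => f x * X x)).
Proof. by move=> f2 X2; apply/Lfun1_integrable; exact: Lfun2_mul_Lfun1. Qed.

Lemma pairing_lin (a : R) f g X : f \in Lfun mu 2%:E -> g \in Lfun mu 2%:E ->
  X \in Lfun mu 2%:E ->
  pairing (fun x => a * f x + g x) X = a * pairing f X + pairing g X.
Proof.
move=> f2 g2 X2; rewrite /pairing -RintegralZl//; last exact: pairing_integrable.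
rewrite -RintegralD//.
- by apply: eq_Rintegral => x _; ring.
- rewrite (_ : _ \o _ = (EFin \o (fun x => (a * f x) * X x))).
    by apply: pairing_integrable => //; exact: Lfun2Z.
  by apply/funext => x /=; rewrite mulrA.
- exact: pairing_integrable.
Qed.

Lemma pairingB f g X : f \in Lfun mu 2%:E -> g \in Lfun mu 2%:E ->
  X \in Lfun mu 2%:E -> pairing (f \- g) X = pairing f X - pairing g X.
Proof.
move=> f2 g2 X2; rewrite -[- pairing g X]mulN1r addrC -pairing_lin//.
by congr pairing; apply/funext => x /=; rewrite mulN1r addrC.
Qed.

Lemma pairingZ (a : R) f X : f \in Lfun mu 2%:E ->
  X \in Lfun mu 2%:E -> pairing (fun x => a * f x) X = a * pairing f X.
Proof.
move=> f2 X2; rewrite /pairing -RintegralZl//; last exact: pairing_integrable.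
by apply: eq_Rintegral => x _; rewrite mulrA.
Qed.

Lemma norm_pairing_le f X : f \in Lfun mu 2%:E -> X \in Lfun mu 2%:E ->
  (`|pairing f X|%:E <= 'N[mu]_2%:E[EFin \o f] * 'N[mu]_2%:E[EFin \o X])%E.
Proof.
move=> f2 X2; have ifX := pairing_integrable f2 X2.
apply: le_trans (@hoelder _ _ _ mu f X 2 2 _ _ _ _ _) => //; last first.
- by rewrite [RHS]splitr !div1r.
- exact: Lfun_measurable X2.
- exact: Lfun_measurable f2.
rewrite Lnorm1 /pairing.
have /integrable_fin_num h := integrable_abse ifX.
apply: (@le_trans _ _ (\int[mu]_x `|f x * X x|)%:E).
  by rewrite lee_fin; exact: le_normr_Rintegral.
by rewrite /Rintegral fineK//; exact: h.
Qed.

Lemma cvg_pairing (S : Type) (F : set_system S) (w : S -> T -> R) w0 X :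
  Filter F -> (\forall s \near F, w s \in Lfun mu 2%:E) ->
  w0 \in Lfun mu 2%:E -> X \in Lfun mu 2%:E ->
  Lnorm mu 2%:E (EFin \o (w s \- w0)) @[s --> F] --> 0%E ->
  pairing (w s) X @[s --> F] --> pairing w0 X.
Proof.
move=> FF w2 w02 X2 wF; apply/cvgrPdist_lt => e e0.
set K := ('N[mu]_2%:E[EFin \o X])%E.
have Kfin : K \is a fin_num by rewrite ge0_fin_numE ?Lnorm_ge0//; exact: Lfun2_fin_norm.
have K0 : 0 <= fine K by rewrite fine_ge0// Lnorm_ge0.
near=> s; have ws2 : w s \in Lfun mu 2%:E by near: s.
rewrite distrC -pairingB// -lte_fin.
apply: (le_lt_trans (norm_pairing_le (Lfun2B ws2 w02) X2)).
apply: (@le_lt_trans _ _ ((e / (fine K + 1))%:E * K)%E).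
  apply: lee_pmul; rewrite ?Lnorm_ge0//; apply: ltW; near: s.
  by apply: (cvge0_near_lt wF); rewrite divr_gt0// ltr_wpDl.
rewrite -(fineK Kfin) -EFinM lte_fin mulrAC ltr_pdivrMr ?ltr_wpDl//.
by rewrite ltr_pM2l// ltrDl.
Unshelve. all: by end_near. Qed.

(** If [w s] vanishes on A, the integral of |w0|^2 over A equals that of |w s - w0|^2, hence is at
    most the square of a norm that tends to 0. A general filter is allowed, since the limits are
    later taken along restricted sets of times. *)
Lemma Lfun2_lim_ae0 (S : Type) (F : set_system S) (w : S -> T -> R) w0 (A : set T) :
  ProperFilter F -> measurable A ->
  (\forall s \near F, w s \in Lfun mu 2%:E) -> w0 \in Lfun mu 2%:E ->
  Lnorm mu 2%:E (EFin \o (w s \- w0)) @[s --> F] --> 0%E ->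
  (\forall s \near F, \forall x \ae mu, A x -> w s x = 0) ->
  \forall x \ae mu, A x -> w0 x = 0.
Proof.
move=> FF mA w2 w02 wF wA.
have mw0 := Lfun_measurable w02.
set J := (\int[mu]_(x in A) (`|w0 x| ^+ 2)%:E)%E.
have m1 : measurable_fun setT (fun x => (`|w0 x| ^+ 2)%:E).
  by apply/measurable_EFinP; apply: measurable_funX; exact: measurableT_comp.
have J0 : J = 0%E.
  apply/eqP; rewrite eq_le; apply/andP; split; last first.
    by apply: integral_ge0 => x _; rewrite lee_fin exprn_ge0.
  apply/lee_addgt0Pr => e e0; rewrite add0e.
  have [s [ws2 wsA wsN]] : exists s, [/\ w s \in Lfun mu 2%:E,
      (\forall x \ae mu, A x -> w s x = 0) &
      ('N[mu]_2%:E[EFin \o (w s \- w0)%R] < (Num.sqrt e)%:E)%E].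
    near F => s; exists s; split; [by near: s|by near: s|].
    by near: s; apply: (cvge0_near_lt wF); rewrite sqrtr_gt0.
  have mws := Lfun_measurable ws2.
  pose D x := `|w s x - w0 x| ^+ 2.
  have m2 : measurable_fun setT (fun x => (D x)%:E).
    apply/measurable_EFinP; apply: measurable_funX; apply: measurableT_comp => //.
    exact: measurable_funB.
  apply: (@le_trans _ _ (\int[mu]_(x in A) (D x)%:E)%E).
    apply: ae_ge0_le_integral => //.
    - exact: (measurable_funS measurableT (@subsetT _ _) m1).
    - by move=> x _; rewrite lee_fin /D exprn_ge0.
    - exact: (measurable_funS measurableT (@subsetT _ _) m2).
    - by apply: filterS wsA => x h Ax; rewrite /D h// sub0r normrN.
  apply: (@le_trans _ _ (\int[mu]_x (D x)%:E)%E).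
    by apply: ge0_subset_integral => // x _; rewrite lee_fin /D exprn_ge0.
  rewrite (_ : (\int[mu]_x _)%E = ('N[mu]_2%:E[EFin \o (w s \- w0)%R] `^ 2)%E); last first.
    rewrite poweR_Lnorm ?pnatr_eq0//; apply: eq_integral => x _ /=.
    by rewrite powR_mulrn.
  apply: (@le_trans _ _ ((Num.sqrt e)%:E `^ 2)%E).
    apply: gt0_ler_poweR => //; rewrite ?in_itv/= ?Lnorm_ge0 ?leey ?lee_fin ?sqrtr_ge0//.
    exact: ltW.
  by rewrite poweR_EFin lee_fin powR_mulrn ?sqrtr_ge0// sqr_sqrtr// ltW.
have /ae_eq_integral_abs : measurable_fun A (fun x => (`|w0 x| ^+ 2)%:E).
  exact: (measurable_funS measurableT (@subsetT _ _) m1).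
move=> /(_ mu mA)[H _].
have : ae_eq mu A (fun x => (`|w0 x| ^+ 2)%:E) (cst 0%E).
  apply: H; rewrite -J0; apply: eq_integral => x _.
  by rewrite gee0_abs// lee_fin exprn_ge0.
apply: filterS => x /= h /h [] /eqP; rewrite expf_eq0/= normr_eq0 => /eqP //.
Unshelve. all: by end_near. Qed.

End L2.

(** * Differential inequalities *)

Section ode.
Context {R : realType}.
Implicit Types (f g H G P V D A a b : R -> R).
Local Notation lambda := (@lebesgue_measure R).

Lemma within_continuousD (K : set R) f g : {within K, continuous f} ->
  {within K, continuous g} -> {within K, continuous (fun x => f x + g x)}.
Proof. by move=> cf cg x; apply: cvgD; [exact: cf|exact: cg]. Qed.

Lemma within_continuousM (K : set R) f g : {within K, continuous f} ->
  {within K, continuous g} -> {within K, continuous (fun x => f x * g x)}.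
Proof. by move=> cf cg x; apply: cvgM; [exact: cf|exact: cg]. Qed.

Lemma within_continuous_comp (K : set R) f g : continuous g ->
  {within K, continuous f} -> {within K, continuous (g \o f)}.
Proof. by move=> cg cf x; apply: (@continuous_comp (subspace K) _ _ f g); [exact: cf|exact: cg]. Qed.

Lemma within_continuousB (K : set R) f g : {within K, continuous f} ->
  {within K, continuous g} -> {within K, continuous (fun x => f x - g x)}.
Proof. by move=> cf cg x; apply: cvgB; [exact: cf|exact: cg]. Qed.

Lemma within_cst (K : set R) (c : R) : {within K, continuous (fun=> c)}.
Proof. by apply: continuous_subspaceT => x; exact: cvg_cst. Qed.

Lemma ftc_segment f t : 0 < t -> {within `[0, t], continuous f} ->
  {within `[0, t], continuous (fun x => \int[lambda]_(s in `[0, x]) f s)} /\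
  forall x, x \in `]0, t[%R ->
    is_derive x 1 (fun x => \int[lambda]_(s in `[0, x]) f s) (f x).
Proof.
move=> t0 cf; have fi : lambda.-integrable `[0, t] (EFin \o f).
  by apply: continuous_compact_integrable => //; exact: segment_compact.
split; first by apply: parameterized_integral_continuous => //; exact: ltW.
move=> x xt; have [x0 xt'] : 0 < x /\ x < t by move: xt; rewrite in_itv/= => /andP[].
have cfx : {for x, continuous f}.
  have : {in `]0, t[%classic, continuous f}.
    rewrite -continuous_open_subspace//.
    by apply: continuous_subspaceW cf; exact: subset_itv_oo_cc.
  by apply; rewrite inE/= in_itv/= x0.
have [d1 d2] := continuous_FTC1_closed xt' fi x0 cfx.
by apply: DeriveDef => //; rewrite -derive1E.
Qed.

Lemma ge0_derive_le D dD t x y : {within `[0, t], continuous D} ->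
  (forall s, s \in `]0, t[%R -> is_derive s 1 D (dD s)) ->
  (forall s, s \in `]0, t[%R -> 0 <= dD s) -> 0 <= x -> x <= y -> y <= t ->
  D x <= D y.
Proof.
move=> cD iD D0 x0 xy yt; apply: (ger0_derive1_le_cc _ _ cD) => //.
- by move=> s /iD[].
- by move=> s st; rewrite derive1E; have := iD _ st => iDs; rewrite derive_val; exact: D0.
- by rewrite in_itv/= x0 (le_trans xy).
- by rewrite in_itv/= yt (le_trans x0).
Qed.

Lemma integral_segment_nondecreasing f t x y : 0 < t ->
  {within `[0, t], continuous f} -> (forall s, s \in `]0, t[%R -> 0 <= f s) ->
  0 <= x -> x <= y -> y <= t ->
  \int[lambda]_(s in `[0, x]) f s <= \int[lambda]_(s in `[0, y]) f s.
Proof.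
move=> t0 cf f0; have [cF dF] := ftc_segment t0 cf.
exact: (ge0_derive_le cF dF f0).
Qed.

Lemma integral_segment0 f : \int[lambda]_(s in `[0, 0]) f s = 0.
Proof. by rewrite set_itv1 Rintegral_set1. Qed.

(* [s |-> e^(A s) (D s + P t)] is nondecreasing because its derivative is
   [e^(A s) (a s) (P t - P s)]. *)
Lemma gronwall_lower V D P A a t : 0 <= t ->
  (forall s, 0 <= s <= t -> V s = D s + P s) ->
  {within `[0, t], continuous D} ->
  (forall s, s \in `]0, t[%R -> is_derive s 1 D (- (a s * V s))) ->
  {within `[0, t], continuous A} ->
  (forall s, s \in `]0, t[%R -> is_derive s 1 A (a s)) ->
  (forall s, s \in `]0, t[%R -> 0 <= a s) ->
  A 0 = 0 ->
  (forall s, 0 <= s <= t -> P s <= P t) ->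
  expR (- A t) * (D 0 + P t) <= V t.
Proof.
move=> t0 VDP cD dD cA dA a0 A0 Pt.
have [t_eq0|t_neq0] := eqVneq t 0.
  by rewrite t_eq0 A0 oppr0 expR0 mul1r VDP// t_eq0 lexx.
have tt : 0 < t by rewrite lt_def t_neq0.
pose Z s := expR (A s) * (D s + P t).
have : Z 0 <= Z t.
  apply: (@ge0_derive_le Z (fun s => expR (A s) * (a s) * (P t - P s)) t) => //.
  - apply: within_continuousM.
      by apply: (@within_continuous_comp _ A expR) => //; exact: continuous_expR.
    by apply: within_continuousD => //; exact: within_cst.
  - move=> s st; have dDs := dD _ st; have dAs := dA _ st.
    have d1 := @is_derive1_comp _ expR A s _ _ (is_derive_expR _) dAs.
    have d2 : is_derive s 1 (fun s => D s + P t) (- (a s * V s) + 0).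
      exact: is_deriveD.
    have d3 := is_deriveM d1 d2.
    apply: is_derive_eq.
    have -> : V s = D s + P s.
      by apply: VDP; move: st; rewrite in_itv/= => /andP[/ltW -> /ltW ->].
    by rewrite /GRing.scale/=; ring.
  - move=> s st; rewrite mulr_ge0// ?mulr_ge0 ?expR_ge0 ?a0// subr_ge0 Pt//.
    by move: st; rewrite in_itv/= => /andP[/ltW -> /ltW ->].
rewrite /Z A0 expR0 mul1r -VDP ?t0 ?lexx// => h.
by rewrite expRN mulrC ler_pdivrMr ?expR_gt0// mulrC.
Qed.

(** At the infimum c of the points where H <= 0, H is positive before c, hence at c by the last
    hypothesis, hence near c by continuity, although c is adherent to these points. *)
Lemma continuous_positive H t : 0 <= t -> {within `[0, t], continuous H} ->
  0 < H 0 ->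
  (forall x, 0 < x <= t -> (forall s, 0 <= s < x -> 0 < H s) -> 0 < H x) ->
  forall x, 0 <= x <= t -> 0 < H x.
Proof.
move=> t0 cH H0 step x x0t; rewrite ltNge; apply/negP => Hx.
pose K := [set s | 0 <= s <= t /\ H s <= 0].
have K0 : K !=set0 by exists x.
have iK : has_inf K by split => //; exists 0 => s [/andP[]].
set c := inf K.
have c0 : 0 <= c by apply: lb_le_inf => // s [/andP[]].
have ct : c <= t.
  have cx : c <= x by apply: ge_inf => //; case: iK.
  by apply: (le_trans cx); case/andP: x0t.
have below s : 0 <= s < c -> 0 < H s.
  move=> /andP[s0 sc]; rewrite ltNge; apply/negP => Hs.
  have : c <= s.
    apply: ge_inf; first by case: iK.
    by split => //; rewrite s0/= (le_trans (ltW sc)).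
  by rewrite leNgt sc.
have Hc : 0 < H c.
  have [c_eq0|c_neq0] := eqVneq c 0; first by rewrite c_eq0.
  by apply: step => //; rewrite lt_def c_neq0 c0 ct.
have : \forall s \near within `[0, t]%classic (nbhs c), 0 < H s.
  have /subspace_continuousP cH' := cH.
  have c0t : `[0, t]%classic c by rewrite /= in_itv/= c0.
  by apply: (cH' _ c0t [set y | 0 < y]); exact: lt_nbhsr.
rewrite /within/= => /nbhs_ballP[e /= e0 be].
have [s [s0t Hs] sc] := inf_adherent e0 iK.
suff : 0 < H s by rewrite ltNge Hs.
apply: be => /=; last by rewrite in_itv.
rewrite /ball/= distrC ger0_norm; first by rewrite ltrBlDl.
by rewrite subr_ge0; apply: ge_inf => //; case: iK.
Qed.

End ode.

(** * The velocity of a damped plane wave *)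

Section plane_wave_ode.
Context {R : realType}.
Local Notation lambda := (@lebesgue_measure R).
Variables (lam mu B t : R) (H G P A b : R -> R).
Hypotheses (t_gt0 : 0 < t) (lam_ge1 : 1 <= lam) (mu_ge0 : 0 <= mu).
Hypotheses (cH : {within `[0, t], continuous H})
  (cG : {within `[0, t], continuous G}) (cA : {within `[0, t], continuous A})
  (cb : {within `[0, t], continuous b}).
Hypotheses (P0 : P 0 = 0) (Pnd : forall x y, 0 <= x -> x <= y -> y <= t -> P x <= P y).
Hypotheses (dA : forall s, s \in `]0, t[%R -> is_derive s 1 A (b s))
  (A0 : A 0 = 0) (AB : forall s, 0 <= s <= t -> A s <= B)
  (b_ge0 : forall s, 0 <= s <= t -> 0 <= b s)
  (b_le : forall s, 0 <= s <= t -> b s <= mu).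
Hypothesis H_eq : forall s, 0 <= s <= t ->
  H s = H 0 - \int[lambda]_(r in `[0, s]) ((lam + b r) * H r - lam ^+ 2 * G r) + P s.
Hypothesis dG : forall s, s \in `]0, t[%R -> is_derive s 1 G (H s - lam * G s).
Hypotheses (H0_gt0 : 0 < H 0) (G0_ge0 : 0 <= G 0).

Let phi s := (lam + b s) * H s - lam ^+ 2 * G s.
Let D s := H 0 - \int[lambda]_(r in `[0, s]) phi r.

Let lam_gt0 : 0 < lam. Proof. exact: lt_le_trans lam_ge1. Qed.

Let cphi : {within `[0, t], continuous phi}.
Proof.
rewrite (_ : phi = fun s => (lam + b s) * H s + - lam ^+ 2 * G s); last first.
  by apply/funext => s; rewrite mulNr.
apply: within_continuousD; apply: within_continuousM => //; last exact: within_cst.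
by apply: within_continuousD => //; exact: within_cst.
Qed.

Let cD : {within `[0, t], continuous D}.
Proof.
have [c _] := ftc_segment t_gt0 cphi.
by apply: within_continuousB => //; exact: within_cst.
Qed.

Let dD s : s \in `]0, t[%R -> is_derive s 1 D (- phi s).
Proof.
move=> st; have [_ /(_ _ st) d] := ftc_segment t_gt0 cphi.
by rewrite -[- phi s]add0r; apply: is_deriveB.
Qed.

Let oo_cc s : s \in `]0, t[%R -> 0 <= s <= t.
Proof. by rewrite in_itv/= => /andP[/ltW -> /ltW ->]. Qed.

Let sub_cont (f : R -> R) x : x <= t ->
  {within `[0, t], continuous f} -> {within `[0, x], continuous f}.
Proof. by move=> xt; apply: continuous_subspaceW; exact: subset_itvl. Qed.

Let sub_oo s x : x <= t -> s \in `]0, x[%R -> s \in `]0, t[%R.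
Proof. by move=> xt; rewrite !in_itv/= => /andP[-> /lt_le_trans ->]. Qed.

Let P_ge0 x : 0 <= x -> x <= t -> 0 <= P x.
Proof. by move=> x0 xt; have := Pnd (lexx 0) x0 xt; rewrite P0. Qed.

(** The derivative of e^(lam s) G is e^(lam s) H. *)
Let G_ge0 x : 0 <= x <= t -> (forall s, 0 <= s < x -> 0 < H s) ->
  forall s, 0 <= s <= x -> 0 <= G s.
Proof.
move=> /andP[x0 xt] Hpos s /andP[s0 sx].
pose Z s := expR (lam * s) * G s.
have : Z 0 <= Z s.
  refine (@ge0_derive_le R Z (fun s => expR (lam * s) * H s) x 0 s _ _ _ (lexx 0) s0 sx).
  - apply: within_continuousM; last exact: sub_cont cG.
    apply: continuous_subspaceT => r.
    by apply: continuous_comp; [exact: mulrl_continuous|exact: continuous_expR].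
  - move=> r rx; have dGr := dG (sub_oo xt rx).
    have d1 : is_derive r 1 ( *%R lam) lam.
      by apply: is_derive_eq; rewrite /GRing.scale/= mulr1.
    have d2 := @is_derive1_comp _ expR ( *%R lam) r _ _ (is_derive_expR _) d1.
    have d3 := is_deriveM d2 dGr.
    by apply: is_derive_eq; rewrite /GRing.scale/=; ring.
  - move=> r; rewrite in_itv/= => /andP[r0 rx].
    by rewrite mulr_ge0 ?expR_ge0// ltW// Hpos// (ltW r0).
rewrite /Z mulr0 expR0 mul1r => h.
by have := le_trans G0_ge0 h; rewrite pmulr_rge0// expR_gt0.
Qed.

(** As long as H was positive, G >= 0, so the integral of lam^2 G is nondecreasing and can be
    counted with the source P. What remains is a decay at rate lam + b, which cannot bring H to
    0. *)
Let H_gt0 : forall x, 0 <= x <= t -> 0 < H x.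
Proof.
apply: (continuous_positive (ltW t_gt0) cH H0_gt0) => x /andP[x0 xt] Hpos.
have Gx := G_ge0 (x := x); rewrite (ltW x0) xt in Gx.
have {}Gx := Gx isT Hpos.
have cG' := sub_cont xt cG.
have cl2G : {within `[0, x], continuous (fun s => lam ^+ 2 * G s)}.
  by apply: within_continuousM => //; exact: within_cst.
have [c1 d1] := ftc_segment x0 cl2G.
pose I s := \int[lambda]_(r in `[0, s]) (lam ^+ 2 * G r).
have I0 : I 0 = 0 by exact: integral_segment0.
have Ind y z : 0 <= y -> y <= z -> z <= x -> I y <= I z.
  apply: integral_segment_nondecreasing => // s; rewrite in_itv/= => /andP[s0 sx].
  by rewrite mulr_ge0 ?sqr_ge0// Gx// (ltW s0) (ltW sx).
suff key : expR (- (lam * x + A x)) * (D 0 - I 0 + (P x + I x)) <= H x.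
  apply: lt_le_trans key.
  rewrite mulr_gt0 ?expR_gt0// /D I0 integral_segment0 !subr0 ltr_pwDl//.
  by rewrite addr_ge0// ?P_ge0 ?(ltW x0)// -I0 Ind// ltW.
refine (@gronwall_lower R H (fun s => D s - I s) (fun s => P s + I s)
  (fun s => lam * s + A s) (fun s => lam + b s) x (ltW x0) _ _ _ _ _ _ _ _).
- by move=> s /andP[s0 sx]; rewrite H_eq ?s0 ?(le_trans sx)// /D; ring.
- by apply: within_continuousB => //; exact: sub_cont cD.
- move=> s sx; have d2 := dD (sub_oo xt sx); have d3 := d1 _ sx.
  have d4 := is_deriveB d2 d3; apply: is_derive_eq.
  by rewrite /phi; ring.
- apply: within_continuousD; last exact: sub_cont cA.
  by apply: continuous_subspaceT => r; exact: mulrl_continuous.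
- move=> s sx; have dAs := dA (sub_oo xt sx).
  by apply: is_derive_eq; rewrite /GRing.scale/= mulr1.
- move=> s sx; rewrite addr_ge0 ?(ltW lam_gt0)// b_ge0//.
  exact: oo_cc (sub_oo xt sx).
- by rewrite mulr0 A0 addr0.
- move=> s /andP[s0 sx]; apply: lerD; first exact: Pnd.
  exact: Ind.
Qed.

Let G_ge0' s : 0 <= s <= t -> 0 <= G s.
Proof.
apply: G_ge0 => [|r /andP[r0 rt]]; first by rewrite lexx ltW.
by apply: H_gt0; rewrite r0 ltW.
Qed.

(** Formally H' = -(lam + b) H + lam^2 G + P' and G' = H - lam G. The coupling cancels in S = H +
    lam G, as S' = -b S + lam b G + P'; with G >= 0 and a primitive of b bounded by B this gives S
    >= e^(-B) H 0. Then H' = -(2 lam + b) H + lam S + P' keeps H above a fixed multiple of H 0. *)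
Lemma plane_wave_lower x : 0 <= x <= t -> expR (- B) / (2 + mu) * H 0 <= H x.
Proof.
have S_ge r : 0 <= r <= t -> expR (- B) * H 0 <= H r + lam * G r.
  move=> /andP[r0 rt].
  have [r_eq0|r_neq0] := eqVneq r 0.
    rewrite r_eq0; apply: (@le_trans _ _ (H 0)).
      rewrite ger_pMl// -expR0 ler_expR oppr_le0 -A0; apply: AB.
      by rewrite lexx ltW.
    by rewrite lerDl mulr_ge0// ltW.
  have {r_neq0}r_gt0 : 0 < r by rewrite lt_def r_neq0.
  have cbG : {within `[0, r], continuous (fun s => lam * (b s * G s))}.
    apply: within_continuousM; first exact: within_cst.
    by apply: within_continuousM; apply: (sub_cont rt).
  have [c1 d1] := ftc_segment r_gt0 cbG.
  pose I s := \int[lambda]_(r in `[0, s]) (lam * (b r * G r)).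
have I0 : I 0 = 0 by exact: integral_segment0.
  have Ind y z : 0 <= y -> y <= z -> z <= r -> I y <= I z.
    apply: integral_segment_nondecreasing => // s /(sub_oo rt)/oo_cc st.
    by rewrite mulr_ge0 ?(ltW lam_gt0)// mulr_ge0 ?b_ge0 ?G_ge0'.
  apply: (le_trans _ (@gronwall_lower R (fun s => H s + lam * G s)
    (fun s => D s + lam * G s - I s) (fun s => P s + I s) A b r r0 _ _ _ _ _ _ _ _)).
  - rewrite /D I0 integral_segment0 !subr0.
    apply: ler_pM; rewrite ?expR_ge0 ?(ltW H0_gt0)//.
      by rewrite ler_expR lerN2 AB// r0.
    rewrite -addrA lerDl addr_ge0// ?mulr_ge0// ?(ltW lam_gt0)// addr_ge0 ?P_ge0//.
    by rewrite -I0 Ind.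
  - by move=> s /andP[s0 sr]; rewrite H_eq ?s0 ?(le_trans sr)// /D; ring.
  - apply: within_continuousB => //; apply: within_continuousD; first exact: sub_cont cD.
    by apply: within_continuousM; [exact: within_cst|exact: sub_cont cG].
  - move=> s sr; have d2 := dD (sub_oo rt sr); have d3 := d1 _ sr.
    have d5 := dG (sub_oo rt sr).
    have d6 : is_derive s 1 (fun s => lam * G s) (lam * (H s - lam * G s)).
      exact: is_deriveZ.
    have d4 := is_deriveB (is_deriveD d2 d6) d3; apply: is_derive_eq.
    by rewrite /phi; ring.
  - exact: sub_cont cA.
  - by move=> s sr; exact: dA (sub_oo rt sr).
  - by move=> s sr; exact/b_ge0/oo_cc/(sub_oo rt sr).
  - exact: A0.
  - move=> s /andP[s0 sr]; apply: lerD; first exact: Pnd.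
    exact: Ind.
move=> /andP[x0 xt].
(* The barrier: lam e^(-B) / (2 lam + b) >= e^(-B) / (2 + mu), because b <= mu <= mu lam. This is
   where lam >= 1 makes the constant independent of lam. *)
set kap := expR (- B) / (2 + mu).
have mu2 : 0 < 2 + mu by rewrite ltr_pwDl.
have eB1 : expR (- B) <= 1.
  rewrite -expR0 ler_expR oppr_le0 -A0; apply: AB.
  by rewrite lexx ltW.
have kap0 : 0 <= kap by rewrite divr_ge0 ?expR_ge0// ltW.
have kap1 : kap <= 1.
  rewrite ler_pdivrMr// mul1r; apply: (le_trans eB1).
  by apply: (le_trans (ler1n _ 2)); rewrite lerDl.
have [x_eq0|x_neq0] := eqVneq x 0.
  by rewrite x_eq0 ger_pMl.
have {x_neq0}x_gt0 : 0 < x by rewrite lt_def x_neq0.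
(* The term that drives [H - kap * H 0] once the decay at rate 2 lam + b is set apart; it is
   nonnegative by [S_ge] and the choice of [kap]. *)
pose psi s := lam * (H s + lam * G s) - (2 * lam + b s) * (kap * H 0).
have cpsi : {within `[0, x], continuous psi}.
  rewrite (_ : psi = fun s => lam * (H s + lam * G s) + (- (kap * H 0)) * (2 * lam + b s)); last first.
    by apply/funext => s; rewrite /psi; ring.
  apply: within_continuousD; apply: within_continuousM; try exact: within_cst.
    apply: within_continuousD; first exact: sub_cont cH.
    by apply: within_continuousM; [exact: within_cst|exact: sub_cont cG].
  by apply: within_continuousD; [exact: within_cst|exact: sub_cont cb].
have [c1 d1] := ftc_segment x_gt0 cpsi.
pose I s := \int[lambda]_(r in `[0, s]) psi r.
have I0 : I 0 = 0 by exact: integral_segment0.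
have Ind y z : 0 <= y -> y <= z -> z <= x -> I y <= I z.
  apply: integral_segment_nondecreasing => // s /(sub_oo xt)/oo_cc st.
  rewrite subr_ge0 /kap; apply: (@le_trans _ _ (lam * (expR (- B) * H 0))); last first.
    by rewrite ler_pM2l// S_ge.
  rewrite !mulrA ler_pM2r// -mulrA mulrCA [leRHS]mulrC ler_pM2l ?expR_gt0//.
  rewrite ler_pdivrMr// mulrDr [lam * 2]mulrC lerD2l.
  apply: (le_trans (b_le st)); rewrite ler_peMl//.
rewrite -subr_ge0; apply: (le_trans _ (@gronwall_lower R (fun s => H s - kap * H 0)
  (fun s => D s - kap * H 0 - I s) (fun s => P s + I s) (fun s => 2 * lam * s + A s)
  (fun s => 2 * lam + b s) x x0 _ _ _ _ _ _ _ _)).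
- rewrite mulr_ge0 ?expR_ge0// /D I0 integral_segment0 !subr0 addr_ge0//.
    by rewrite subr_ge0 ger_pMl.
  by rewrite addr_ge0 ?P_ge0// -I0 Ind.
- by move=> s /andP[s0 sx]; rewrite H_eq ?s0 ?(le_trans sx)// /D; ring.
- apply: within_continuousB => //.
  by apply: within_continuousB; [exact: sub_cont cD|exact: within_cst].
- move=> s sx; have d2 := dD (sub_oo xt sx); have d3 := d1 _ sx.
  have d5 : is_derive s 1 (fun s => D s - kap * H 0) (- phi s - 0).
    exact: is_deriveB.
  have d4 := is_deriveB d5 d3; apply: is_derive_eq.
  by rewrite /phi /psi; ring.
- apply: within_continuousD; last exact: sub_cont cA.
  by apply: continuous_subspaceT => r; exact: mulrl_continuous.
- move=> s sx; have dAs := dA (sub_oo xt sx).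
  by apply: is_derive_eq; rewrite /GRing.scale/= mulr1.
- move=> s sx; rewrite addr_ge0 ?b_ge0 ?(oo_cc (sub_oo xt sx))// mulr_ge0//.
  exact: ltW.
- by rewrite mulr0 A0 addr0.
- move=> s /andP[s0 sx]; apply: lerD; first exact: Pnd.
  exact: Ind.
Qed.

End plane_wave_ode.

(** * Supports *)

(* [filterS], for measures on which the inference of its filter instance fails. *)
Lemma aeS d (T : measurableType d) (R : realType) (mu : {measure set T -> \bar R})
    (P Q : T -> Prop) : (forall x, P x -> Q x) ->
  (\forall x \ae mu, P x) -> \forall x \ae mu, Q x.
Proof. exact: filterS. Qed.

Lemma aeS2 d (T : measurableType d) (R : realType) (mu : {measure set T -> \bar R})
    (P Q S : T -> Prop) : (forall x, P x -> Q x -> S x) ->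
  (\forall x \ae mu, P x) -> (\forall x \ae mu, Q x) -> \forall x \ae mu, S x.
Proof. by move=> PQS aP aQ; exact: filterS2 PQS aP aQ. Qed.

Section euclidean_norm.
Context {R : realType}.

Lemma enorm_sqr n (x : 'rV[R]_n) : enorm x ^+ 2 = \sum_(i < n) x 0 i ^+ 2.
Proof. by rewrite sqr_sqrtr// sumr_ge0// => i _; rewrite sqr_ge0. Qed.

Lemma enorm_ge0 n (x : 'rV[R]_n) : 0 <= enorm x.
Proof. exact: sqrtr_ge0. Qed.

Lemma norm_coord_le_enorm n (x : 'rV[R]_n) i : `|x 0 i| <= enorm x.
Proof.
rewrite -sqrtr_sqr; apply: ler_wsqrtr; rewrite (bigD1 i)//= lerDl.
by apply: sumr_ge0 => j _; rewrite sqr_ge0.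
Qed.

Lemma measurable_enorm n : measurable_fun setT (@enorm R n).
Proof.
apply: (measurableT_comp (continuous_measurable_fun (@sqrt_continuous R))).
by apply: measurable_sum => i; apply: measurable_funX; exact: measurable_rV_coord.
Qed.

End euclidean_norm.

Section countable_base.
Context {R : realType} {n : nat}.

(** A base of open sets indexed by a countable type: the complement of [ess_supp] is an uncountable
    union, and almost-everywhere statements can only be collected over countably many sets. *)
Definition rat_box (c : 'rV[rat]_n * rat * rat) : set ('rV[R]_n * R) :=
  [set z : 'rV[R]_n * R | (forall i, `|z.1 0 i - ratr (c.1.1 0 i)| < ratr c.2) /\
           `|z.2 - ratr c.1.2| < ratr c.2].

Lemma rat_box_basis (U : set ('rV[R]_n * R)) z : open U -> U z ->
  exists2 c, rat_box c z & rat_box c `<=` U.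
Proof.
move=> oU Uz; have /nbhs_ballP[e /= e0 eU] := open_nbhs_nbhs (conj oU Uz).
have [r] := @rat_in_itvoo R 0 (e / 2) (divr_gt0 e0 (ltr0n _ 2)).
rewrite in_itv/= => /andP[r0 re].
have appr (y : R) : exists q : rat, `|y - ratr q| < ratr r.
  have [q] := @rat_in_itvoo R (y - ratr r) (y + ratr r) ltac:(lra).
  by rewrite in_itv/= => /andP[? ?]; exists q; rewrite ltr_norml; apply/andP; split; lra.
have [q2 q2P] := appr z.2.
have [qf qfP] : {qf : 'I_n -> rat & forall i, `|z.1 0 i - ratr (qf i)| < ratr r}.
  by have [f fP] := choice (fun i => appr (z.1 0 i)); exists f.
exists (\row_i qf i, q2, r).
  by split => //= i; rewrite mxE.
move=> w [/= w1 w2]; apply: eU; split => /=.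
  split=> // i j; rewrite ord1 /ball/=.
  have := w1 j; rewrite mxE => ?; have ? := qfP j.
  rewrite (_ : _ - _ = (z.1 0 j - ratr (qf j)) - (w.1 0 j - ratr (qf j))); last by ring.
  by apply: (le_lt_trans (ler_normB _ _)); lra.
rewrite /ball/= (_ : _ - _ = (z.2 - ratr q2) - (w.2 - ratr q2)); last by ring.
by apply: (le_lt_trans (ler_normB _ _)); lra.
Qed.

End countable_base.

Section support.
Context {R : realType} {n : nat}.
Local Notation leb := (lebesgue_rV n).
Local Notation lambda := (@lebesgue_measure R).

(** A Lindelof argument: each point outside the support lies in a rational box on which f vanishes
    almost everywhere, and the boxes are enumerated through [unpickle]. *)
Lemma ess_supp_ae0 (f : 'rV[R]_n * R -> R) (A : set ('rV[R]_n * R)) :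
  ess_supp (almost_everywhere (leb \x lambda)%E) f `<=` A ->
  \forall z \ae (leb \x lambda)%E, ~ A z -> f z = 0.
Proof.
move=> sA.
pose good c := \forall z \ae (leb \x lambda)%E, @rat_box R n c z -> f z = 0.
have : \forall z \ae (leb \x lambda)%E, forall m : nat,
    forall c, unpickle m = Some c -> good c -> rat_box c z -> f z = 0.
  apply: ae_foralln => m; case: (unpickle m) => [c|]; last by apply: aeW.
  have [gc|ngc] := pselect (good c); last by apply: aeW => z _ [<-].
  by apply: aeS gc => z h _ [<-].
apply: aeS => z h /(contra_not (@sA z)) /contrapT[U [oU fU] Uz].
have [c cz cU] := rat_box_basis oU Uz.
apply: (h (pickle c) c) => //; first exact: pickleK.
by apply: aeS fU => w hw /cU.
Qed.

(** Tonelli for the indicator of a null set that contains the exceptional points: almost all its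
    sections are null. *)
Lemma ae_prod_section (P : 'rV[R]_n -> R -> Prop) :
  (\forall z \ae (leb \x lambda)%E, P z.1 z.2) ->
  \forall t \ae lambda, \forall x \ae leb, P x t.
Proof.
move=> [A [mA A0 PA]].
have mf : measurable_fun setT (fun z => (\1_A z)%:E : \bar R).
  by apply/measurable_EFinP; exact: measurable_indic.
have f0 z : (0 <= (\1_A z)%:E :> \bar R)%E by rewrite lee_fin.
have := @fubini_tonelli2 _ _ _ _ R leb lambda _ mf f0.
rewrite integral_indic// setIT => E; have G0 := etrans (esym E) A0.
have mG : measurable_fun setT (fubini_G leb (fun z => (\1_A z)%:E : \bar R)).
  exact: measurable_fun_fubini_tonelli_G.
have G0' : (\int[lambda]_x `|fubini_G leb (fun z => (\1_A z)%:E : \bar R) x| = 0)%E.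
  rewrite -[RHS]G0; apply: eq_integral => t _; rewrite gee0_abs//.
  by apply: integral_ge0 => x _.
have := (ae_eq_integral_abs lambda measurableT mG).1 G0'.
apply: filterS => t /(_ I); rewrite /fubini_G/= => h.
exists (ysection A t); split.
- exact: measurable_ysection.
- rewrite -[RHS]h -[in LHS](setIT (ysection A t)) -integral_indic//.
    apply: eq_integral => x _; congr (_%:E).
    by rewrite !indicE mem_ysection.
  exact: measurable_ysection.
- by move=> x /= nP; rewrite /ysection/= inE; exact: PA.
Qed.

End support.

Section support_slices.
Context {R : realType} {n : nat}.
Local Notation leb := (lebesgue_rV n).
Local Notation lambda := (@lebesgue_measure R).
Implicit Types u ut : R -> 'rV[R]_n -> R.

Lemma ae_in_interval (P : R -> Prop) (a b : R) : a < b ->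
  (\forall t \ae lambda, P t) -> exists2 t, a < t < b & P t.
Proof.
move=> ab aeP; apply: contrapT => nP.
have : lambda `]a, b[%classic = 0%E.
  apply: measure_negligible; first exact: measurable_itv.
  apply: negligibleS aeP => t /=; rewrite in_itv/= => tab Pt.
  by apply: nP; exists t.
by rewrite lebesgue_measure_itv/= lte_fin ab -EFinB => -[]/eqP; rewrite subr_eq0 gt_eqF.
Qed.

Lemma measurable_enorm_gt (c : R) : measurable [set x : 'rV[R]_n | c < enorm x].
Proof.
have := @measurable_enorm R n measurableT `]c, +oo[%classic (measurable_itv _).
rewrite setTI; congr (measurable _); apply/seteqP.
by split => x /=; rewrite in_itv/= andbT.
Qed.

Variables (T rad : R) (u ut : R -> 'rV[R]_n -> R).
Hypothesis cu : C0_Lp 2 `[0, T[ u.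
Hypothesis su : spacetime_supp T u `<=`
  [set z | 0 <= z.2 /\ enorm z.1 <= z.2 + rad].

Let good t := \forall x \ae leb, t + rad < enorm x -> u t x = 0.

Lemma ae_slice_support : \forall t \ae lambda, 0 < t < T -> good t.
Proof.
have h := ess_supp_ae0 su.
pose P (x : 'rV[R]_n) t := 0 < t < T -> t + rad < enorm x -> u t x = 0.
have /(@ae_prod_section _ _ P) : \forall z \ae (leb \x lambda)%E, P z.1 z.2.
  apply: aeS h => -[x t] /= h0 /andP[t0 tT] tx.
  rewrite (ltW t0) tT in h0; apply: h0 => -[_]; apply/negP; by rewrite -ltNge.
by apply: aeS => t ht tT; apply: aeS ht => x; apply.
Qed.

(** Passes from almost every time to every time, 0 included, by L2 continuity along the good times.
    The margin 1/2 absorbs the distance from s to t, so that a single set serves for all s near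
    t. *)
Lemma slice_support t : 0 <= t < T ->
  \forall x \ae leb, t + rad + 2^-1 < enorm x -> u t x = 0.
Proof.
move=> /andP[t0 tT].
pose D := [set s | 0 < s < T /\ good s].
(* Good times have full measure, hence they accumulate at t from the right; this also covers t =
   0. *)
have PF : ProperFilter (within D (nbhs t)).
  apply: Build_ProperFilter_ex => P /nbhs_ballP[e /= e0 be].
  have [s /andP[ts]] : exists2 s, t < s < Num.min T (t + e) & 0 < s < T -> good s.
    by apply: ae_in_interval; [rewrite lt_min tT ltrDl|exact: ae_slice_support].
  rewrite lt_min => /andP[sT se] gs; exists s.
  have s0T : 0 < s < T by rewrite (le_lt_trans t0)//.
  apply: be; last by split => //; exact: gs.
  by rewrite /ball/= distrC gtr0_norm ?subr_gt0// ltrBlDl.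
have DI : D `<=` `[0, T[%classic by move=> s [/andP[s0 sT] _]; rewrite /= in_itv/= ltW.
have tI : `[0, T[%classic t by rewrite /= in_itv/= t0.
have [ut2 cut] := cu tI.
apply: (@Lfun2_lim_ae0 _ _ _ leb R (within D (nbhs t)) u (u t)
  [set x | t + rad + 2^-1 < enorm x]) => //.
- exact: measurable_enorm_gt.
- by apply: (@filterE _ (nbhs t)) => s /DI /cu[].
- apply: cvg_trans cut; apply: cvg_app => A; apply: (@filterS _ (nbhs t)) => s h /DI; exact: h.
- near=> s; have Ds : D s by near: s; exact: withinT.
  case: Ds => _; apply: aeS => x + /= h; apply; apply: lt_trans h.
  rewrite addrAC ltrD2r.
  suff : `|t - s| < 2^-1 by rewrite ltr_norml => /andP[]; lra.
  near: s; apply: cvg_within; apply/nbhs_ballP; exists 2^-1 => //=.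
Unshelve. all: by end_near. Qed.

Lemma within_dnbhs_proper (t : R) : 0 <= t < T ->
  ProperFilter (within `[0, T[%classic (dnbhs t)).
Proof.
move=> /andP[t0 tT]; apply: Build_ProperFilter_ex => P /nbhs_ballP[e /= e0 be].
have tm : t < Num.min T (t + e) by rewrite lt_min tT ltrDl.
exists ((t + Num.min T (t + e)) / 2).
have ts := midf_lt tm; have [t1 t2] := ts.
set s := (t + _) / 2 in t1 t2 *.
move: t2; rewrite lt_min => /andP[sT se].
apply: be => /=.
- by rewrite /ball/= distrC gtr0_norm ?subr_gt0// ltrBlDl.
- by rewrite gt_eqF.
- by rewrite in_itv/= sT (le_trans t0 (ltW t1)).
Qed.

Hypothesis c1u : forall t, `[0, T[%classic t ->
  Lnorm leb 2%:E (EFin \o (fun x => (s - t)^-1 * (u s x - u t x) - ut t x))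
    @[s --> within `[0, T[ (dnbhs t)] --> 0%E.
Hypothesis ut2 : forall t, `[0, T[%classic t -> ut t \in Lfun leb 2%:E.

Lemma Lfun2_quotient t s : `[0, T[%classic t -> `[0, T[%classic s ->
  (fun x => (s - t)^-1 * (u s x - u t x)) \in Lfun leb 2%:E.
Proof.
by move=> /cu[? _] /cu[? _]; apply: Lfun2Z; exact: Lfun2B.
Qed.

(** The velocity is an L2 limit of difference quotients, which vanish where both slices do. The
    slice at time s costs a further 1/2, whence the margin 1. *)
Lemma velocity_support t : 0 <= t < T ->
  \forall x \ae leb, t + rad + 1 < enorm x -> ut t x = 0.
Proof.
move=> t0T; have tI : `[0, T[%classic t by rewrite /= in_itv.
have PF := within_dnbhs_proper t0T.
apply: (@Lfun2_lim_ae0 _ _ _ leb R (within `[0, T[%classic (dnbhs t))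
  (fun s x => (s - t)^-1 * (u s x - u t x)) (ut t)
  [set x | t + rad + 1 < enorm x]) => //.
- exact: measurable_enorm_gt.
- by apply: (@filterE _ (dnbhs t)) => s sI; exact: Lfun2_quotient.
- exact: ut2.
- exact: c1u.
- near=> s.
  have sI : 0 <= s < T.
    suff : `[0, T[%classic s by rewrite /= in_itv.
    by near: s; exact: withinT.
  have st : `|t - s| < 2^-1.
    by near: s; do 2!apply: cvg_within; apply/nbhs_ballP; exists 2^-1 => //=.
  apply: filterS2 (slice_support t0T) (slice_support sI) => x /= ht hs h.
  rewrite ht; last by lra.
  by rewrite hs ?subrr ?mulr0//; move: st; rewrite ltr_norml => /andP[]; lra.
Unshelve. all: by end_near. Qed.

End support_slices.

(** * From the weak identity to ordinary differential equations *)

Section test_pairing.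
Context {R : realType} {n : nat}.
Local Notation leb := (lebesgue_rV n).
Local Notation lambda := (@lebesgue_measure R).

(** By induction on the construction: the sigma-algebra on row vectors is the one generated by the
    coordinates. *)
Lemma measurable_elem (X : 'rV[R]_n -> R) : elem (@xbase R n) X ->
  measurable_fun setT X.
Proof.
elim => {X} [c|_ [i _ <-]|h k _ mh _ mk|h k _ mh _ mk|h h0 _ mh|k h kC _ mh].
- exact: measurable_cst.
- exact: measurable_rV_coord.
- exact: measurable_funD.
- exact: measurable_funM.
(* The inverse is written h |h|^(-2), with |h|^(-1) a real power, which is a measurable function of
   |h|. *)
- rewrite (_ : (fun x => (h x)^-1) = fun x => h x * (`|h x| `^ (-1)) ^+ 2).
    apply: measurable_funM => //; apply: measurable_funX.
    apply: (measurableT_comp (measurable_powR _)) => //.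
    exact: measurableT_comp.
  apply/funext => x; rewrite powR_inv1 ?normr_ge0// exprVn real_normK ?num_real//.
  by have := h0 x => ?; field.
- apply: (measurableT_comp _ mh); apply: continuous_measurable_fun => x.
  apply: differentiable_continuous; apply/derivable1_diffP; exact: (kC 0%N).
Qed.

(** Keeps the certificate [elem] instead of [smooth]: it yields measurability, and it is stable
    under derivation with the same cube. *)
Definition space_testfun (M : R) (X : 'rV[R]_n -> R) :=
  elem (@xbase R n) X /\ forall x, X x != 0 -> cube M x.

Lemma space_testfun_derive M X v : space_testfun M X -> space_testfun M ('D_v X).
Proof.
move=> [eX XM]; split; first exact: (elem_diff (@affine_xbase R n) eX).2.
move=> x; apply: contra_neqP => nx.
have : \forall y \near x, cst 0 y = X y.
  have : open (~` (@cube R n M)) by apply: closed_openC; exact: closed_cube.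
  move=> oC; apply: filterS (open_nbhs_nbhs (conj oC nx)) => y yM.
  by apply/esym/eqP; apply: contraT => /XM.
by move=> /near_eq_derive <-; rewrite derive_cst.
Qed.

Lemma cube_box M : @cube R n M = [set x | forall i, `[- M, M]%classic (x 0 i)].
Proof.
by apply/seteqP; split => x /= h i; have := h i; rewrite in_itv/= ler_norml.
Qed.

Lemma measurable_cube M : measurable (@cube R n M).
Proof.
have -> : @cube R n M = \bigcap_(i in [set: 'I_n])
    ((fun x : 'rV[R]_n => x 0 i) @^-1` `[- M, M]%classic).
  by rewrite cube_box; apply/seteqP; split => x /= h i; [move=> _|]; exact: h.
apply: fin_bigcap_measurable => [|i _]; first exact: finite_finset.
rewrite -[X in measurable X]setTI.
exact: (measurable_rV_coord i measurableT (measurable_itv _)).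
Qed.

Lemma lebesgue_cube M : 0 <= M -> leb (@cube R n M) = ((2 * M) ^+ n)%:E.
Proof.
move=> M0; rewrite cube_box.
rewrite (@lebesgue_rV_box R n (fun=> `[- M, M]%classic)) => [|i]; last exact: measurable_itv.
under eq_bigr do rewrite lebesgue_measure_itv/=.
rewrite (eq_bigr (fun=> (2 * M)%:E)).
  by rewrite prodEFin prodr_const card_ord.
move=> i _; rewrite lte_fin; case: ltP => h; first by rewrite -EFinB; congr EFin; ring.
by have -> : M = 0; [lra|rewrite mulr0].
Qed.

Lemma space_testfun_bounded M X : space_testfun M X ->
  exists C, forall x, `|X x| <= C.
Proof.
move=> [eX XM].
have cX : continuous X by move=> x; exact/differentiable_continuous/(elem_diff (@affine_xbase R n) eX).1.
have cnX : {within @cube R n M, continuous (Num.norm \o X)}.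
  apply: continuous_subspaceT => x; apply: continuous_comp; first exact: cX.
  exact: norm_continuous.
have [[x0 Mx0]|M0] := pselect (@cube R n M !=set0).
  have [c _ cM] := compact_EVT_max (ex_intro _ x0 Mx0) (@compact_cube R n M) cnX.
  exists `|X c| => x; have [->|/XM xM] := eqVneq (X x) 0; first by rewrite normr0.
  by apply: cM; rewrite inE.
exists 0 => x; rewrite normr_le0; apply: contraT => /XM xM; exfalso.
by apply: M0; exists x.
Qed.

Lemma Lfun2_space_testfun M X : space_testfun M X -> X \in Lfun leb 2%:E.
Proof.
move=> tX; have [C XC] := space_testfun_bounded tX; case: tX => eX XM.
have [M0|M0] := leP 0 M.
  apply: (@Lfun2_bounded _ _ _ _ _ (@cube R n M) C) => //.
  - exact: measurable_elem.
  - exact: measurable_cube.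
  - by change (leb (@cube R n M) < +oo)%E; rewrite lebesgue_cube// ltry.
apply: (@Lfun2_bounded _ _ _ _ _ (@cube R n `|M|) C) => //.
- exact: measurable_elem.
- exact: measurable_cube.
- by change (leb (@cube R n `|M|) < +oo)%E; rewrite lebesgue_cube// ltry.
- by move=> x /XM xM i; rewrite (le_trans (xM i))// ler_norm.
Qed.

Lemma space_testfun_test_function M X : space_testfun M X -> test_function setT X.
Proof. by move=> [eX XM]; exact: test_function_space eX XM. Qed.

Lemma space_testfun_space_test M (k : 'rV[R]_n) : space_testfun (M + 1) (space_test M k).
Proof.
split; first exact: elem_space_test.
by move=> x; rewrite mulf_eq0 negb_or => /andP[/cutoff_neq0].
Qed.

Variables (T : R) (u ut : R -> 'rV[R]_n -> R) (X : 'rV[R]_n -> R) (M : R).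
Hypothesis tX : space_testfun M X.
Let X2 := Lfun2_space_testfun tX.

Lemma continuous_pairing t : C0_Lp 2 `[0, T[ u -> t < T ->
  {within `[0, t], continuous (fun s => pairing leb (u s) X)}.
Proof.
move=> cu tT; apply/subspace_continuousP => s st.
have sI r : `[0, t]%classic r -> `[0, T[%classic r.
  by rewrite /= !in_itv/= => /andP[-> rt]; rewrite (le_lt_trans rt).
have [us2 us] := cu s (sI _ st).
apply: (@cvg_pairing _ _ _ leb) => //.
  by apply: (@filterE _ (nbhs s)) => r /sI /cu[].
apply: cvg_trans us; apply: cvg_app => A.
by apply: (@filterS _ (nbhs s)) => r h /sI; exact: h.
Qed.

Lemma is_derive_pairing t : C1_Lp 2 `[0, T[ u ut -> 0 < t < T ->
  is_derive t 1 (fun s => pairing leb (u s) X) (pairing leb (ut t) X).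
Proof.
move=> [cu cut dut] /andP[t0 tT].
have tI : `[0, T[%classic t by rewrite /= in_itv/= (ltW t0).
have h : pairing leb (fun x => (s - t)^-1 * (u s x - u t x)) X
    @[s --> within `[0, T[%classic (dnbhs t)] --> pairing leb (ut t) X.
  apply: (@cvg_pairing _ _ _ leb) => //.
  - apply: (@filterE _ (dnbhs t)) => s sI; apply: Lfun2Z.
    by apply: Lfun2B; [have [] := cu _ sI|have [] := cu _ tI].
  - by have [] := cut _ tI.
  - exact: dut.
have lim0 : (fun h : R => h^-1 *: (((fun s => pairing leb (u s) X) \o shift t) (h *: (1:R))
    - pairing leb (u t) X)) @ 0^' --> pairing leb (ut t) X.
  apply/cvgrPdist_lt => e e0.
  have /cvgrPdist_lt/(_ e e0) := h => /nbhs_ballP[r /= r0 hr].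
  near=> d; rewrite /= /GRing.scale/= mulr1.
  have d0 : d != 0 by near: d; exact: nbhs_dnbhs_neq.
  have dI : `[0, T[%classic (d + t).
    rewrite /= in_itv/=; apply/andP; split; first last.
      rewrite -ltrBrDr; near: d; apply: cvg_within; apply: lt_nbhsl.
      by rewrite subr_gt0.
    rewrite -lerBlDr sub0r; apply: ltW; near: d; apply: cvg_within.
    by apply: lt_nbhsr; rewrite oppr_lt0.
  have dr : ball t r (d + t).
    rewrite /ball/= (_ : t - (d + t) = - d); last by ring.
    rewrite normrN; near: d.
    by apply: dnbhs0_lt.
  have dt : d + t != t by rewrite -subr_eq0 addrK.
  have := hr (d + t) dr dt dI.
  rewrite pairingZ//; last by apply: Lfun2B; [have [] := cu _ dI|have [] := cu _ tI].
  rewrite pairingB// ?addrK//; last 2 first.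
    by have [] := cu _ dI.
  by have [] := cu _ tI.
apply: DeriveDef; first by apply/cvg_ex; exists (pairing leb (ut t) X).
by apply/cvg_lim => //; exact: lim0.
Unshelve. all: by end_near. Qed.

End test_pairing.

Section test_derivatives.
Context {R : realType}.

Lemma derive_comp_real (V : normedModType R) (k : R -> R) (h : V -> R) x v :
  derivable k (h x) 1 -> differentiable h x ->
  'D_v (k \o h) x = derive1 k (h x) * 'D_v h x.
Proof.
move=> /derivable1_diffP dk dh; rewrite deriveE; last exact: differentiable_comp.
by rewrite diff_comp//= diff1E//= deriveE// /GRing.scale/= mulrC.
Qed.

Context {n : nat}.

Lemma dotp_linear (k : 'rV[R]_n) : linear (dotp k : _ -> R^o).
Proof.
move=> a x y; rewrite /dotp /GRing.scale/= mulr_sumr -big_split/=.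
by apply: eq_bigr => i _; rewrite !mxE; ring.
Qed.

Lemma elem_dotp (k : 'rV[R]_n) : elem (@xbase R n) (dotp k).
Proof.
apply: elem_sum => i; apply: (@elem_mul _ _ (@xbase R n) (cst (k 0 i)) (fun x => x 0 i)).
  exact: elem_cst.
by apply: elem_base; exists i.
Qed.

Lemma differentiable_dotp (k : 'rV[R]_n) x : differentiable (dotp k) x.
Proof. exact: (elem_diff (@affine_xbase R n) (elem_dotp k)).1. Qed.

Lemma derive_dotp (k x v : 'rV[R]_n) : 'D_v (dotp k) x = dotp k v.
Proof.
have H : affine_base [set dotp k].
  apply: affine_base_linear => _ ->; split; first exact: dotp_linear.
  by move=> y; exact/differentiable_continuous/differentiable_dotp.
rewrite deriveE; last exact: differentiable_dotp.
pose lM := GRing.isLinear.Build _ _ _ _ _ (dotp_linear k).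
pose f : {linear 'rV[R]_n -> R^o} := HB.pack (dotp k) lM.
rewrite (@diff_lin _ _ _ f)// => y.
exact/differentiable_continuous/differentiable_dotp.
Qed.

Lemma dotp_delta (k : 'rV[R]_n) i : dotp k (delta_mx 0 i) = k 0 i.
Proof.
rewrite /dotp (bigD1 i)//= big1 => [|j ji]; first by rewrite mxE !eqxx mulr1 addr0.
by rewrite mxE (negbTE ji) andbF mulr0.
Qed.

Lemma derive_exp_dotp (k x v : 'rV[R]_n) :
  'D_v (expR \o dotp k) x = expR (dotp k x) * dotp k v.
Proof.
rewrite derive_comp_real//; last exact: differentiable_dotp.
by rewrite derive_dotp derive1E; congr (_ * _); exact: derive_val.
Qed.

Lemma near_cube (e M : R) (x : 'rV[R]_n) : 0 < e -> cube (M - e) x ->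
  \forall y \near x, cube M y.
Proof.
move=> e0 xM; apply/nbhs_ballP; exists e => //= y [_ xy] i.
have := xy 0 i; rewrite /ball/= => h; have := xM i => h'.
rewrite (_ : y 0 i = x 0 i - (x 0 i - y 0 i)); last by ring.
by apply: (le_trans (ler_normB _ _)); lra.
Qed.

Lemma space_test_exp M (k x : 'rV[R]_n) : cube M x ->
  space_test M k x = expR (dotp k x).
Proof. by move=> xM; rewrite /space_test cutoff_eq1// mul1r. Qed.

(** A derivative needs the formula on a neighbourhood, so each order of derivation gives up a margin
    1/2 of the cube where the cutoff is 1. *)
Lemma derive_space_test M (k x v : 'rV[R]_n) : cube (M - 2^-1) x ->
  'D_v (space_test M k) x = expR (dotp k x) * dotp k v.
Proof.
move=> xM; rewrite -derive_exp_dotp; apply: near_eq_derive.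
have h : 0 < 2^-1 :> R by rewrite invr_gt0.
by apply: filterS (near_cube h xM) => y /space_test_exp ->.
Qed.

Lemma derive2_space_test M (k x v : 'rV[R]_n) : cube (M - 1) x ->
  'D_v ('D_v (space_test M k)) x = expR (dotp k x) * dotp k v ^+ 2.
Proof.
move=> xM; have h : 0 < 2^-1 :> R by rewrite invr_gt0.
transitivity ('D_v (fun y => dotp k v *: (expR \o dotp k) y) x).
  apply: near_eq_derive.
  have : cube (M - 2^-1 - 2^-1) x.
    by move=> i; have := xM i; lra.
  move=> /(near_cube h); apply: filterS => y /derive_space_test ->.
  by rewrite mulrC.
rewrite deriveZ; first by rewrite derive_exp_dotp /GRing.scale/=; ring.
apply: diff_derivable; apply: differentiable_comp; first exact: differentiable_dotp.
by apply/derivable1_diffP; exact: derivable_expR.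
Qed.

Lemma space_test_ge0 M (k x : 'rV[R]_n) : 0 <= space_test M k x.
Proof. by rewrite mulr_ge0// ?cutoff_ge0// expR_ge0. Qed.

Lemma laplacian_space_test M (k x : 'rV[R]_n) : cube (M - 1) x ->
  \sum_i 'D_(delta_mx 0 i) ('D_(delta_mx 0 i) (space_test M k)) x =
  enorm k ^+ 2 * space_test M k x.
Proof.
move=> xM; rewrite space_test_exp; last by move=> i; have := xM i; lra.
rewrite enorm_sqr mulr_suml; apply: eq_bigr => i _.
by rewrite derive2_space_test// dotp_delta mulrC.
Qed.

Lemma time_test_ge0 (a b d lam s : R) : 0 <= time_test a b d lam s.
Proof. by rewrite mulr_ge0// ?plateau_ge0// expR_ge0. Qed.

Lemma time_test_exp (a b d lam s : R) : 0 < d -> a <= s <= b ->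
  time_test a b d lam s = expR (- lam * s).
Proof. by move=> d0 sab; rewrite /time_test plateau_eq1// mul1r. Qed.

Lemma time_test_neq0 (a b d lam s : R) : 0 < d -> time_test a b d lam s != 0 ->
  a - d <= s <= b + d.
Proof. by move=> d0; rewrite mulf_eq0 negb_or => /andP[/(plateau_neq0 d0)]. Qed.

Lemma derive_time_test (a b d lam s : R) : 0 < d -> a < s < b ->
  'D_1 (time_test a b d lam) s = - lam * expR (- lam * s).
Proof.
move=> d0 /andP[as_ sb].
transitivity ('D_1 (fun s : R => expR (- lam * s)) s).
  apply: near_eq_derive; near=> r; rewrite time_test_exp//; apply/andP; split.
    by apply: ltW; near: r; exact: lt_nbhsr.
  by apply: ltW; near: r; exact: lt_nbhsl.
have d1 : is_derive s 1 ( *%R (- lam)) (- lam).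
  by apply: is_derive_eq; rewrite /GRing.scale/= mulr1.
have d2 := @is_derive1_comp _ expR ( *%R (- lam)) s _ _ (is_derive_expR _) d1.
by rewrite (@derive_val _ _ _ _ _ _ _ d2) mulrC.
Unshelve. all: by end_near. Qed.

Lemma derive_space_time (X : 'rV[R]_n -> R) (S : R -> R) w r x s :
  elem (@xbase R n) X -> elem (@idbase R) S ->
  'D_(w, r) (fun z : 'rV[R]_n * R => X z.1 * S z.2) (x, s) =
  X x * 'D_r S s + S s * 'D_w X x.
Proof.
move=> eX eS.
have dX : derivable X x w by exact/diff_derivable/(elem_diff (@affine_xbase R n) eX).1.
have dS : derivable S s r by exact/diff_derivable/(elem_diff (@affine_idbase R) eS).1.
have dX' : derivable (X \o fst) (x, s) (w, r) by exact: dX.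
have dS' : derivable (S \o snd) (x, s) (w, r) by exact: dS.
rewrite (_ : (fun z => _) = (X \o fst) * (S \o snd))//.
by rewrite deriveM.
Qed.

End test_derivatives.

(** * The damping coefficient and its bounded primitive *)

Section damping.
Context {R : realType}.
Variables (mu beta : R).
Hypotheses (mu_gt0 : 0 < mu) (beta_gt1 : 1 < beta).

Definition damp (s : R) := mu / (1 + s) `^ beta.

(** The primitive that vanishes at 0. For beta > 1 it stays below mu / (beta - 1), so that the
    damping costs no more than a constant factor at all times. *)
Definition damp_primitive (s : R) := mu / (beta - 1) * (1 - (1 + s) `^ (1 - beta)).

Lemma is_derive_shift_powR (r s : R) : 0 <= s ->
  is_derive s 1 (fun s : R => (1 + s) `^ r) (r * (1 + s) `^ (r - 1)).
Proof.
move=> s0; have s1 : 0 < 1 + s by lra.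
have d1 : is_derive s 1 (fun s : R => 1 + s) 1.
  rewrite (_ : (fun s : R => 1 + s) = shift 1); first exact: is_derive_shift.
  by apply/funext => x /=; rewrite addrC.
have d2 := @is_derive1_comp _ (fun x => x `^ r) (fun s : R => 1 + s) s _ _
  (is_derive1_powR r s1) d1.
by rewrite mulr1 in d2.
Qed.

Lemma continuous_shift_powR (r s : R) : 0 <= s ->
  {for s, continuous (fun s : R => (1 + s) `^ r)}.
Proof.
move=> s0; apply: differentiable_continuous; apply/derivable1_diffP.
by have [] := is_derive_shift_powR r s0.
Qed.

Lemma within_continuous_damp t : {within `[0, t], continuous damp}.
Proof.
rewrite (_ : damp = fun s => mu * (1 + s) `^ (- beta)); last first.
  by apply/funext => s; rewrite /damp powRN.
apply: within_continuousM; first exact: within_cst.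
apply: continuous_in_subspaceT => s; rewrite inE/= in_itv/= => /andP[s0 _].
exact: continuous_shift_powR.
Qed.

Lemma within_continuous_damp_primitive t : {within `[0, t], continuous damp_primitive}.
Proof.
apply: within_continuousM; first exact: within_cst.
apply: within_continuousB; first exact: within_cst.
apply: continuous_in_subspaceT => s; rewrite inE/= in_itv/= => /andP[s0 _].
exact: continuous_shift_powR.
Qed.

Lemma is_derive_damp_primitive (s : R) : 0 < s -> is_derive s 1 damp_primitive (damp s).
Proof.
move=> s0; have d1 := is_derive_shift_powR (1 - beta) (ltW s0).
have d2 : is_derive s 1 (fun s : R => mu / (beta - 1) * (1 - (1 + s) `^ (1 - beta)))
    (mu / (beta - 1) * (0 - (1 - beta) * (1 + s) `^ (1 - beta - 1))).
  by apply: is_deriveZ; exact: is_deriveB.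
rewrite /damp_primitive; apply: is_derive_eq.
have b1 : beta - 1 != 0 by rewrite gt_eqF// subr_gt0.
rewrite /damp -powRN (_ : 1 - beta - 1 = - beta); last by ring.
by field.
Qed.

Lemma damp_primitive0 : damp_primitive 0 = 0.
Proof. by rewrite /damp_primitive addr0 powR1 subrr mulr0. Qed.

Lemma damp_primitive_le s : damp_primitive s <= mu / (beta - 1).
Proof.
rewrite ger_pMr ?divr_gt0 ?subr_gt0//.
by rewrite lerBlDr lerDl powR_ge0.
Qed.

Lemma damp_ge0 s : 0 <= damp s.
Proof. by rewrite divr_ge0 ?powR_ge0// ltW. Qed.

Lemma damp_le s : 0 <= s -> damp s <= mu.
Proof.
move=> s0; rewrite ger_pMr// invf_le1 ?powR_gt0//; last by rewrite ltr_pwDl.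
rewrite -[leLHS](powRr0 (1 + s)); apply: ler_powR; first by rewrite lerDl.
by rewrite ltW// (lt_trans ltr01).
Qed.

End damping.

Section pairing_ae.
Context d (T : measurableType d) (R : realType).
Variable mu : {measure set T -> \bar R}.
Implicit Types f g X Y : T -> R.

Lemma ae_eq_Rintegral f g : measurable_fun setT f -> measurable_fun setT g ->
  (\forall x \ae mu, f x = g x) -> \int[mu]_x f x = \int[mu]_x g x.
Proof.
move=> mf mg fg; congr fine; apply: ae_eq_integral => //.
- exact/measurable_EFinP.
- exact/measurable_EFinP.
- by apply: filterS fg => x -> _.
Qed.

Lemma ae_ge0_Rintegral f : measurable_fun setT f -> (\forall x \ae mu, 0 <= f x) ->
  0 <= \int[mu]_x f x.
Proof.
move=> mf f0; rewrite (@ae_eq_Rintegral f (fun x => `|f x|))//.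
- exact: Rintegral_ge0.
- exact: measurableT_comp.
- by apply: filterS f0 => x fx; rewrite ger0_norm.
Qed.

Lemma pairing_ae f g X Y : f \in Lfun mu 2%:E -> g \in Lfun mu 2%:E ->
  X \in Lfun mu 2%:E -> Y \in Lfun mu 2%:E ->
  (\forall x \ae mu, f x * X x = g x * Y x) -> pairing mu f X = pairing mu g Y.
Proof.
move=> /Lfun_measurable mf /Lfun_measurable mg /Lfun_measurable mX
  /Lfun_measurable mY h.
by apply: ae_eq_Rintegral => //; exact: measurable_funM.
Qed.

Lemma Lfun2_sum (I : Type) (s : seq I) (X : I -> T -> R) :
  (forall i, X i \in Lfun mu 2%:E) -> (fun x => \sum_(i <- s) X i x) \in Lfun mu 2%:E.
Proof.
move=> X2; elim: s => [|j s ih].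
  rewrite (_ : (fun x => _) = cst 0); last by apply/funext => x; rewrite big_nil.
  by have [|H0 _] := @Lfun_submod_closed _ _ _ mu 2%:E; first by rewrite lee_fin ler1n.
rewrite (_ : (fun x => _) = fun x => 1 * X j x + \sum_(i <- s) X i x); first exact: Lfun2_lin.
by apply/funext => x; rewrite big_cons mul1r.
Qed.

Lemma pairing_sumr (I : Type) (s : seq I) f (X : I -> T -> R) :
  f \in Lfun mu 2%:E -> (forall i, X i \in Lfun mu 2%:E) ->
  \sum_(i <- s) pairing mu f (X i) = pairing mu f (fun x => \sum_(i <- s) X i x).
Proof.
move=> f2 X2; elim: s => [|i s ih].
  rewrite big_nil /pairing; under eq_Rintegral do rewrite big_nil mulr0.
  by rewrite Rintegral_cst ?mul0r.
have S2 := Lfun2_sum s X2.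
rewrite big_cons ih /pairing -RintegralD//; try exact: pairing_integrable.
by apply: eq_Rintegral => x _; rewrite big_cons mulrDr.
Qed.

Lemma integrable_EFin_fine (D : set T) (f : T -> \bar R) : measurable D ->
  mu.-integrable D f -> mu.-integrable D (EFin \o (fine \o f)).
Proof.
move=> mD fi; apply: (le_integrable mD _ _ fi).
  by apply/measurable_EFinP; apply: measurableT_comp => //; exact: measurable_int fi.
by move=> x _ /=; case: (f x) => [r| |] //=; rewrite normr0 leey.
Qed.

End pairing_ae.

Section pairing_sums.
Context d (T : measurableType d) (R : realType).
Variable mu : {measure set T -> \bar R}.

Lemma Rintegral_sum_pairing (I : Type) (s : seq I) (f X : I -> T -> R) :
  (forall i, f i \in Lfun mu 2%:E) -> (forall i, X i \in Lfun mu 2%:E) ->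
  mu.-integrable setT (EFin \o (fun x => \sum_(i <- s) f i x * X i x)) /\
  \int[mu]_x (\sum_(i <- s) f i x * X i x) = \sum_(i <- s) pairing mu (f i) (X i).
Proof.
move=> f2 X2; elim: s => [|i s [ii ih]].
  split.
    rewrite (_ : _ \o _ = cst 0%E); first exact: integrable0.
    by apply/funext => x /=; rewrite big_nil.
  under eq_Rintegral do rewrite big_nil.
  by rewrite big_nil Rintegral_cst ?mul0r.
have E : (fun x => \sum_(j <- i :: s) f j x * X j x) =
    (fun x => f i x * X i x + \sum_(j <- s) f j x * X j x).
  by apply/funext => x; rewrite big_cons.
rewrite E; split.
  rewrite (_ : _ \o _ = (fun x => (f i x * X i x)%:E + (\sum_(j <- s) f j x * X j x)%:E)%E)//.
  by apply: integrableD => //; exact: pairing_integrable.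
rewrite big_cons RintegralD ?ih//.
exact: pairing_integrable.
Qed.

Lemma pairing_scaler (c : R) f X : f \in Lfun mu 2%:E -> X \in Lfun mu 2%:E ->
  \int[mu]_x (f x * (X x * c)) = c * pairing mu f X.
Proof.
move=> f2 X2; rewrite /pairing -RintegralZl//; last exact: pairing_integrable.
by apply: eq_Rintegral => x _; ring.
Qed.

End pairing_sums.

Section weak_to_ode.
Context {R : realType} {n : nat}.
Local Notation leb := (lebesgue_rV n).
Local Notation lambda := (@lebesgue_measure R).
Variables (mu beta p q eps T rad : R) (g : 'rV[R]_n -> R).
Variables (u ut : R -> 'rV[R]_n -> R) (du : 'I_n -> R -> 'rV[R]_n -> R).
Hypotheses (mu_gt0 : 0 < mu) (beta_gt1 : 1 < beta).
Hypothesis reg : energy_regularity p q T u ut du.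
Hypothesis g2 : g \in Lfun leb 2%:E.
Hypothesis weak : forall phi, test_function [set z : 'rV[R]_n * R | z.2 < T] phi ->
  forall t, 0 <= t < T ->
  nonlinear_terms_integrable p q u ut phi t /\
  weak_identity mu beta p q g eps u ut du phi t.
Hypothesis su : spacetime_supp T u `<=`
  [set z | 0 <= z.2 /\ enorm z.1 <= z.2 + rad].
Variables (t1 M : R) (k : 'rV[R]_n).
Hypotheses (t1_gt0 : 0 < t1) (t1T : t1 < T) (M_ge : t1 + rad + 2 <= M).

Let lam := enorm k.
Let X := space_test M k.
(** The plateau contains [0, t1] in its interior, so the time derivative of the test function is
    exact at both endpoints; the transition width keeps the support below (t1 + 3 T) / 4 < T. *)
Let S := time_test (-1) ((t1 + T) / 2) ((T - t1) / 4) lam.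
Let phi (z : 'rV[R]_n * R) := X z.1 * S z.2.

Definition wave_pairing (v : R -> 'rV[R]_n -> R) (s : R) :=
  expR (- lam * s) * pairing leb (v s) X.

Definition source_int (r : R) (v : R -> 'rV[R]_n -> R) (s : R) :=
  \int[leb]_x (`|v s x| `^ r * phi (x, s)).

Definition source (t : R) :=
  \int[lambda]_(s in `[0, t]) source_int p ut s +
  \int[lambda]_(s in `[0, t]) source_int q u s.

Let H := wave_pairing ut.
Let G := wave_pairing u.

Let tX : space_testfun (M + 1) X. Proof. exact: space_testfun_space_test. Qed.
Let tDX i : space_testfun (M + 1) ('D_(delta_mx 0 i) X).
Proof. exact: space_testfun_derive. Qed.
Let X2 : X \in Lfun leb 2%:E. Proof. exact: Lfun2_space_testfun tX. Qed.
Let d_gt0 : 0 < (T - t1) / 4. Proof. by rewrite divr_gt0// subr_gt0. Qed.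

Let time_bounds s : 0 <= s <= t1 -> -1 < s < (t1 + T) / 2.
Proof. by have := t1T => t1T' /andP[s0 st]; apply/andP; split; lra. Qed.

Let SE s : 0 <= s <= t1 -> S s = expR (- lam * s).
Proof.
by move=> /time_bounds/andP[/ltW s0 /ltW s1]; rewrite /S time_test_exp// s0 s1.
Qed.

Let inT s : 0 <= s <= t1 -> `[0, T[%classic s.
Proof. by move=> /andP[s0 st]; rewrite /= in_itv/= s0 (le_lt_trans st). Qed.

Let u2 s : 0 <= s <= t1 -> u s \in Lfun leb 2%:E.
Proof. by move=> /inT sT; case: reg => -[cu _ _] _ _ _; have [] := cu s sT. Qed.

Let ut2 s : 0 <= s <= t1 -> ut s \in Lfun leb 2%:E.
Proof. by move=> /inT sT; case: reg => _ [_ cut _] _ _; have [] := cut s sT. Qed.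

Let du2 s i : 0 <= s <= t1 -> du i s \in Lfun leb 2%:E.
Proof. by move=> /inT sT; case: reg => -[_ cdu _] _ _ _; have [] := cdu i s sT. Qed.

Let tphi : test_function [set z : 'rV[R]_n * R | z.2 < T] phi.
Proof.
have := t1T => t1T'.
apply: (@test_function_space_time _ _ _ _ (M + 1) (-1 - (T - t1) / 4)
  ((t1 + T) / 2 + (T - t1) / 4)).
- exact: elem_space_test.
- by case: tX.
- exact: elem_time_test.
- by move=> s; exact: time_test_neq0.
- by lra.
Qed.

Let phi_ge0 z : 0 <= phi z.
Proof. by rewrite mulr_ge0// ?space_test_ge0// time_test_ge0. Qed.

Let T_gt0 : 0 < T. Proof. exact: lt_trans t1T. Qed.

(** The weak gradient moves the second derivative onto X. On the support of u, well inside the cube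
    of radius M - 1, the Laplacian of X is lam^2 X. *)
Let laplacian_pairing s : 0 <= s <= t1 ->
  \sum_i pairing leb (du i s) ('D_(delta_mx 0 i) X) = - lam ^+ 2 * pairing leb (u s) X.
Proof.
move=> st; have us2 := u2 st.
have tDDX i := space_testfun_derive (delta_mx 0 i) (tDX i).
have E i : pairing leb (du i s) ('D_(delta_mx 0 i) X) =
    - pairing leb (u s) ('D_(delta_mx 0 i) ('D_(delta_mx 0 i) X)).
  case: reg => -[_ _ wd] _ _ _; have := wd i s (inT st).
  by move=> /(_ _ (space_testfun_test_function (tDX i))) /esym; rewrite /pairing => <-; rewrite opprK.
rewrite (eq_bigr _ (fun i _ => E i)) sumrN mulNr; congr (- _).
rewrite pairing_sumr//; last by move=> i; exact: Lfun2_space_testfun (tDDX i).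
rewrite -pairingZ//; apply: pairing_ae => //.
- exact: Lfun2Z.
- by apply: Lfun2_sum => i; exact: Lfun2_space_testfun (tDDX i).
- have [[cu _ _] _ _ _] := reg.
  have sT : 0 <= s < T by have := inT st; rewrite /= in_itv.
  apply: filterS (slice_support cu su sT) => x h.
  have [xs|sx] := leP (enorm x) (s + rad + 2^-1); last by rewrite h// mulr0 !mul0r.
  rewrite laplacian_space_test; first by rewrite -/X /lam; ring.
  move=> i; apply: (le_trans (norm_coord_le_enorm x i)); apply: (le_trans xs).
  by have := M_ge; case/andP: st => _ st; lra.
Qed.

Let space_inner s : 0 <= s <= t1 ->
  \int[leb]_x (- (ut s x * 'D_((0 : 'rV[R]_n), 1) phi (x, s)) +
     \sum_(i < n) du i s x * 'D_(delta_mx 0 i, 0 : R) phi (x, s)) =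
  lam * H s - lam ^+ 2 * G s.
Proof.
move=> st; have eX := (space_testfun_space_test M k).1.
have eS := @elem_time_test R (-1) ((t1 + T) / 2) ((T - t1) / 4) lam.
set e := expR (- lam * s).
have Dt x : 'D_((0 : 'rV[R]_n), 1) phi (x, s) = X x * (- lam * e).
  rewrite (derive_space_time _ _ _ _ eX eS) derive0 mulr0 addr0.
  by rewrite derive_time_test// time_bounds.
have Di x i : 'D_(delta_mx 0 i, 0 : R) phi (x, s) = 'D_(delta_mx 0 i) X x * e.
  rewrite (derive_space_time _ _ _ _ eX eS) derive0 mulr0 add0r mulrC.
  by congr (_ * _); exact: SE.
have [sumi sumE] := @Rintegral_sum_pairing _ _ _ leb _ (index_enum 'I_n)
  (fun i => du i s) (fun i => 'D_(delta_mx 0 i) X)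
  (fun i => du2 i st) (fun i => Lfun2_space_testfun (tDX i)).
transitivity (\int[leb]_x ((lam * e) * (ut s x * X x) +
    e * (\sum_(i < n) du i s x * 'D_(delta_mx 0 i) X x))).
  apply: eq_Rintegral => x _; rewrite Dt mulr_sumr; congr (_ + _); first by ring.
  by apply: eq_bigr => i _; rewrite Di; ring.
have i1 := pairing_integrable (ut2 st) X2.
rewrite RintegralD//.
- rewrite !RintegralZl// sumE laplacian_pairing// -/(pairing leb (ut s) X).
  by rewrite /H /G /wave_pairing -/e; ring.
- by have := integrableZl measurableT (lam * e) i1.
- by have := integrableZl measurableT e sumi.
Qed.

Let damping_inner s : 0 <= s <= t1 ->
  \int[leb]_x (mu * ut s x / (1 + s) `^ beta * phi (x, s)) = damp mu beta s * H s.
Proof.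
move=> st; rewrite /H /wave_pairing mulrA -pairing_scaler//; last exact: ut2.
by apply: eq_Rintegral => x _; rewrite /phi /= SE// /damp; ring.
Qed.

Let continuous_wave v : C0_Lp 2 `[0, T[ v ->
  {within `[0, t1], continuous (wave_pairing v)}.
Proof.
move=> cv; apply: within_continuousM; last exact: (continuous_pairing tX cv t1T).
by apply: continuous_subspaceT => r; apply: continuous_comp;
  [exact: mulrl_continuous|exact: continuous_expR].
Qed.

Lemma continuous_wave_position : {within `[0, t1], continuous G}.
Proof. by have [[cu _ _] _ _ _] := reg; exact: continuous_wave. Qed.

Lemma continuous_wave_velocity : {within `[0, t1], continuous H}.
Proof. by have [_ [_ cut _] _ _] := reg; exact: continuous_wave. Qed.

(** The weak identity for the truncated plane wave: the time derivative of the test function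
    contributes lam H, the gradient term -lam^2 G. *)
Lemma wave_ode t : 0 <= t <= t1 ->
  H t = eps * pairing leb g X -
    \int[lambda]_(s in `[0, t]) ((lam + damp mu beta s) * H s - lam ^+ 2 * G s) +
    source t.
Proof.
move=> tt1; have [t0 tt] := andP tt1.
have tT : 0 <= t < T by rewrite t0 (le_lt_trans tt).
have st s : s \in `[0, t]%classic -> 0 <= s <= t1.
  by rewrite inE/= in_itv/= => /andP[-> h]; rewrite (le_trans h).
have [_ wi] := weak tphi tT; rewrite /weak_identity in wi.
cbv beta zeta in wi.
rewrite -/(source t) in wi.
have E1 : \int[leb]_x (ut t x * phi (x, t)) = H t.
  rewrite /H /wave_pairing -pairing_scaler//; last exact: ut2.
  by apply: eq_Rintegral => x _; rewrite /phi/= SE.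
have E2 : \int[leb]_x (eps * g x * phi (x, 0)) = eps * pairing leb g X.
  rewrite -pairing_scaler//; apply: eq_Rintegral => x _.
  by rewrite /phi/= SE ?lexx ?ltW// mulr0 expR0; ring.
rewrite E1 E2 in wi.
have E3 : \int[lambda]_(s in `[0, t]) (\int[leb]_x
      (- (ut s x * 'D_((0 : 'rV[R]_n), 1) phi (x, s)) +
     \sum_(i < n) du i s x * 'D_(delta_mx 0 i, 0 : R) phi (x, s))) =
    \int[lambda]_(s in `[0, t]) (lam * H s - lam ^+ 2 * G s).
  by apply: eq_Rintegral => s /st hs; exact: space_inner.
have E4 : \int[lambda]_(s in `[0, t]) (\int[leb]_x
      (mu * ut s x / (1 + s) `^ beta * phi (x, s))) =
    \int[lambda]_(s in `[0, t]) (damp mu beta s * H s).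
  by apply: eq_Rintegral => s /st hs; exact: damping_inner.
rewrite E3 E4 in wi.
have cH := continuous_wave_velocity; have cG := continuous_wave_position.
have sub (h : R -> R) : {within `[0, t1], continuous h} ->
    lambda.-integrable `[0, t] (EFin \o h).
  move=> ch; apply: continuous_compact_integrable; first exact: segment_compact.
  by apply: continuous_subspaceW ch; exact: subset_itvl.
rewrite [X in _ - X + _](_ : _ =
   \int[lambda]_(s in `[0, t]) (lam * H s - lam ^+ 2 * G s) +
   \int[lambda]_(s in `[0, t]) (damp mu beta s * H s)).
  by rewrite -wi; ring.
rewrite -RintegralD//.
- by apply: eq_Rintegral => s _; ring.
- apply: sub; apply: within_continuousB; apply: within_continuousM => //; exact: within_cst.
- by apply: sub; apply: within_continuousM => //; exact: within_continuous_damp.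
Qed.

Lemma source0 : source 0 = 0.
Proof. by rewrite /source !integral_segment0 addr0. Qed.

(** The regularity of u says nothing about the value of [ut] at time 0; the initial velocity is
    recovered from the weak identity at t = 0. *)
Lemma wave_velocity0 : H 0 = eps * pairing leb g X.
Proof.
by rewrite wave_ode ?lexx ?ltW// integral_segment0 source0 subr0 addr0.
Qed.

Lemma is_derive_wave_position s : s \in `]0, t1[%R ->
  is_derive s 1 G (H s - lam * G s).
Proof.
rewrite in_itv/= => /andP[s0 st].
have [_ c1 _ _] := reg.
have sT : 0 < s < T by rewrite s0 (lt_trans st).
have d1 := is_derive_pairing tX c1 sT.
have d2 : is_derive s 1 ( *%R (- lam)) (- lam).
  by apply: is_derive_eq; rewrite /GRing.scale/= mulr1.
have d3 := @is_derive1_comp _ expR ( *%R (- lam)) s _ _ (is_derive_expR _) d2.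
have d4 := is_deriveM d3 d1.
by apply: is_derive_eq; rewrite /H /G /wave_pairing /GRing.scale/=; ring.
Qed.

Lemma source_int_ge0 r v s : 0 <= source_int r v s.
Proof. by apply: Rintegral_ge0 => x _; rewrite mulr_ge0 ?powR_ge0. Qed.

Lemma source_int_integrable t : 0 <= t <= t1 ->
  lambda.-integrable `[0, t] (EFin \o source_int p ut) /\
  lambda.-integrable `[0, t] (EFin \o source_int q u).
Proof.
move=> /andP[t0 tt]; have tT : 0 <= t < T by rewrite t0 (le_lt_trans tt).
have [[i1 i2] _] := weak tphi tT.
have mt : measurable `[0, t]%classic by exact: measurable_itv.
split; first exact: (@integrable_EFin_fine _ _ _ lambda _ _ mt i1).
exact: (@integrable_EFin_fine _ _ _ lambda _ _ mt i2).
Qed.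

Let integrable_slice r v : 0 <= r -> (forall s, 0 <= s <= t1 -> v s \in Lfun leb 2%:E) ->
  lambda.-integrable `[0, t1]
    (fun s => \int[leb]_x (`|v s x| `^ r * phi (x, s))%:E)%E ->
  \forall s \ae lambda, 0 <= s <= t1 ->
    leb.-integrable setT (EFin \o (fun x => `|v s x| `^ r * phi (x, s))).
Proof.
move=> r0 v2 iv.
have mt : measurable (`[0, t1]%classic : set (measurableTypeR R)).
  exact: measurable_itv.
have := integrable_ae mt iv; apply: aeS => s h st.
have /h fin : `[0, t1]%classic s by rewrite /= in_itv.
have mv := Lfun_measurable (v2 s st).
have m1 : measurable_fun setT (fun x => `|v s x| `^ r * phi (x, s)).
  apply: measurable_funM.
    by apply: (measurableT_comp (measurable_powR _)); exact: measurableT_comp.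
  rewrite (_ : (fun x => phi (x, s)) = (fun x => X x * S s))//.
  by apply: measurable_funM => //; exact: measurable_elem (elem_space_test M k).
apply/integrableP; split; first exact/measurable_EFinP.
have -> : (\int[leb]_x `|(EFin \o (fun x => (`|v s x| `^ r * phi (x, s))%R)) x| =
    \int[leb]_x (`|v s x| `^ r * phi (x, s))%:E)%E.
  by apply: eq_integral => x _; rewrite gee0_abs// lee_fin mulr_ge0 ?powR_ge0.
by rewrite ltey_eq fin.
Qed.

Lemma source_slices_integrable : 0 <= p -> 0 <= q ->
  \forall s \ae lambda, 0 <= s <= t1 ->
    leb.-integrable setT (EFin \o (fun x => `|ut s x| `^ p * phi (x, s))) /\
    leb.-integrable setT (EFin \o (fun x => `|u s x| `^ q * phi (x, s))).
Proof.
move=> p0 q0; have tT : 0 <= t1 < T by rewrite t1T ltW.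
have [[i1 i2] _] := weak tphi tT.
have h1 := integrable_slice p0 ut2 i1; have h2 := integrable_slice q0 u2 i2.
by apply: aeS2 h1 h2 => s h1 h2 st; split; [exact: h1|exact: h2].
Qed.

End weak_to_ode.

(** * Plane waves on the light cone *)

Section ball_integral.
Context {R : realType}.
Local Notation lambda := (@lebesgue_measure R).

Lemma integral_rV_cons n (F : 'rV[R]_n.+1 -> \bar R) : measurable_fun setT F ->
  (forall x, 0 <= F x)%E ->
  (\int[lebesgue_rV n.+1]_x F x =
   \int[lebesgue_rV n]_x \int[lambda]_a F (rV_cons (a, x)))%E.
Proof.
move=> mF F0.
have mFc : measurable_fun setT (F \o @rV_cons R n).
  by apply: measurableT_comp => //; exact: measurable_rV_cons.
have -> : (\int[lebesgue_rV n.+1]_x F x =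
    \int[(lambda \x lebesgue_rV n)%E]_z (F \o @rV_cons R n) z)%E.
  rewrite /= /lebesgue_rVS.
  have := @ge0_integral_pushforward _ _ _ _ R _ (@measurable_rV_cons R n)
    (lambda \x lebesgue_rV n)%E setT F measurableT mF (fun x _ => F0 x).
  by rewrite preimage_setT => <-.
exact: (@fubini_tonelli2 _ _ _ _ R lambda (lebesgue_rV n) _ mFc (fun z => F0 _)).
Qed.

Lemma integral_normal_fun (m s : R) : s != 0 ->
  (\int[lambda]_x (normal_fun m s x)%:E = (Num.sqrt (s ^+ 2 * pi *+ 2))%:E)%E.
Proof.
move=> s0; have pk := normal_peak_gt0 s0.
have := integral_normal_pdf m s; rewrite normal_pdfE//.
under eq_integral do rewrite EFinM.
rewrite ge0_integralZl//; last 3 first.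
- by apply/measurable_EFinP; exact: measurable_normal_fun.
- by move=> x _; rewrite lee_fin normal_fun_ge0.
- by rewrite lee_fin ltW.
move=> h.
have : ((normal_peak s)^-1%:E * ((normal_peak s)%:E * \int[lambda]_x (normal_fun m s x)%:E)
   = (normal_peak s)^-1%:E * 1)%E by rewrite h.
by rewrite muleA -EFinM mulVf ?gt_eqF// mul1e mule1 /normal_peak invrK.
Qed.

Lemma integral_prod_normal n (m : 'I_n -> R) (s : R) : s != 0 ->
  (\int[lebesgue_rV n]_x (\prod_(i < n) normal_fun (m i) s (x 0 i))%:E =
   (Num.sqrt (s ^+ 2 * pi *+ 2) ^+ n)%:E)%E.
Proof.
move=> s0; elim: n m => [|n ih] m.
  rewrite (eq_integral (fun=> 1%:E)); last by move=> x _; rewrite big_ord0.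
  rewrite integral_cst// mul1e expr0.
  suff -> : [set: 'rV[R]_0] = [set x | forall i : 'I_0, setT (x 0 i)].
    by have := @lebesgue_rV_box R 0 (fun=> setT) (fun=> measurableT); rewrite big_ord0.
  by apply/seteqP; split.
have mp k (m' : 'I_k -> R) : measurable_fun setT
    (fun x : 'rV[R]_k => \prod_(i < k) normal_fun (m' i) s (x 0 i)).
  apply: measurable_prod => i _; apply: measurableT_comp (measurable_rV_coord i).
  exact: measurable_normal_fun.
rewrite integral_rV_cons; last 2 first.
- by apply/measurable_EFinP; exact: mp.
- by move=> x; rewrite lee_fin prodr_ge0// => i _; exact: normal_fun_ge0.
transitivity (\int[lebesgue_rV n]_x ((\prod_(i < n) normal_fun (m (lift ord0 i)) s (x 0 i))%:E
    * (Num.sqrt (s ^+ 2 * pi *+ 2))%:E))%E.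
  apply: eq_integral => x _; rewrite -(integral_normal_fun (m ord0) s0).
  rewrite -ge0_integralZl//.
  - apply: eq_integral => a _; rewrite big_ord_recl rV_cons0 mulrC EFinM.
    by congr (_%:E * _)%E; apply: eq_bigr => i _; rewrite rV_consS.
  - by apply/measurable_EFinP; exact: measurable_normal_fun.
  - by move=> a _; rewrite lee_fin normal_fun_ge0.
  - by rewrite lee_fin prodr_ge0// => i _; exact: normal_fun_ge0.
rewrite ge0_integralZr//.
- by rewrite ih -EFinM -exprSr.
- by apply/measurable_EFinP; exact: mp.
- by move=> x _; rewrite lee_fin prodr_ge0// => i _; exact: normal_fun_ge0.
Qed.

Lemma integral_expRN (A : R) : (\int[lambda]_(x in `[A, +oo[) (expR (- x))%:E = (expR (- A))%:E)%E.
Proof.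
rewrite (@ge0_continuous_FTC2y _ (fun x => expR (- x)) (fun x => - expR (- x)) A 0).
- by rewrite -EFinB sub0r opprK.
- by move=> x _; exact: expR_ge0.
- apply: continuous_subspaceT => x; apply: continuous_comp; first exact: opp_continuous.
  exact: continuous_expR.
- by rewrite -oppr0; apply: cvgN; exact: cvgr_expR.
- by move=> x _.
- by apply: cvg_at_right_filter; apply: cvgN; apply: continuous_comp;
    [exact: opp_continuous|exact: continuous_expR].
- move=> x _; rewrite derive1E; apply: derive_val; apply: is_derive_eq.
  by rewrite /GRing.scale/=; ring.
Qed.

(** The first coordinate -1 ensures |k| >= 1, and it makes the integral along the first axis that of
    e^(-a) over a half-line. *)
Definition dirvec n (y : 'I_n -> R) : 'rV[R]_n.+1 :=
  \row_i oapp y (-1) (unlift ord0 i).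

Lemma dirvec0 n (y : 'I_n -> R) : dirvec y 0 ord0 = -1.
Proof. by rewrite mxE unlift_none. Qed.

Lemma dirvecS n (y : 'I_n -> R) i : dirvec y 0 (lift ord0 i) = y i.
Proof. by rewrite mxE liftK. Qed.

Lemma enorm_dirvec n (y : 'I_n -> R) :
  enorm (dirvec y) ^+ 2 = 1 + \sum_(i < n) y i ^+ 2.
Proof.
rewrite enorm_sqr big_ord_recl dirvec0 sqrrN expr1n; congr (_ + _).
by apply: eq_bigr => i _; rewrite dirvecS.
Qed.

Lemma enorm_dirvec_ge1 n (y : 'I_n -> R) : 1 <= enorm (dirvec y).
Proof.
rewrite -(@ler_pXn2r _ 2) ?nnegrE ?enorm_ge0 ?ler01//.
by rewrite expr1n enorm_dirvec lerDl sumr_ge0// => i _; rewrite sqr_ge0.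
Qed.

(* With [X = (-A, x)] on the sphere of radius [rho] and [omega] the unit vector
   of [dirvec y], this is [|X - rho omega|^2 = 2 rho (rho - X.omega)]. *)
Lemma sphere_exponent n (y x : 'I_n -> R) (lam rho A : R) : 0 < rho -> 1 <= lam ->
  lam ^+ 2 = 1 + \sum_i y i ^+ 2 -> A ^+ 2 + \sum_i x i ^+ 2 = rho ^+ 2 ->
  A + \sum_i y i * x i - lam * rho <=
  - (\sum_i (x i - rho * y i / lam) ^+ 2) / (rho *+ 2).
Proof.
move=> rho0 lam1 lamE AE.
have lam0 : lam != 0 by rewrite gt_eqF// (lt_le_trans ltr01).
set Q := \sum_i x i ^+ 2 in AE *; set Y := \sum_i y i ^+ 2 in lamE *.
set P := \sum_i y i * x i.
have SE : \sum_i (x i - rho * y i / lam) ^+ 2 = Q - 2 * (rho / lam) * P + (rho / lam) ^+ 2 * Y.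
  rewrite /Q /P /Y !mulr_sumr -sumrB -big_split/=.
  by apply: eq_bigr => i _; field.
have S0 : 0 <= \sum_i (x i - rho * y i / lam) ^+ 2.
  by apply: sumr_ge0 => i _; exact: sqr_ge0.
set Sq := \sum_i _ in S0 SE *.
have E : (A + P) / lam - rho = - ((A - rho / lam) ^+ 2 + Sq) / (rho *+ 2).
  have QE : Q = rho ^+ 2 - A ^+ 2 by rewrite -AE; ring.
  have YE : Y = lam ^+ 2 - 1 by rewrite lamE; ring.
  have r0 : rho != 0 by rewrite gt_eqF.
  by rewrite SE QE YE -[rho *+ 2]mulr_natl; field; rewrite lam0 r0.
have E0 : (A + P) / lam - rho <= 0.
  rewrite E mulNr oppr_le0 divr_ge0 ?mulrn_wge0 ?(ltW rho0)//.
  by rewrite addr_ge0 ?sqr_ge0.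
apply: (@le_trans _ _ ((A + P) / lam - rho)).
  rewrite (_ : A + P - lam * rho = lam * ((A + P) / lam - rho)); last by field.
  rewrite -subr_ge0 -[X in X - _]mul1r -mulrBl mulr_le0// subr_le0//.
rewrite E ler_pM2r ?invr_gt0 ?mulrn_wgt0//.
by rewrite lerN2 lerDr sqr_ge0.
Qed.

(** For fixed last coordinates x, the chord of the ball along the first axis starts at a = -A, a
    point of the sphere. Integrating e^(-a) from there leaves the wave at that point, which
    [sphere_exponent] bounds by a Gaussian in x of variance rho. Its integral has the order of the
    volume of a parabolic cap. *)
Lemma ball_wave_integral n (y : 'I_n -> R) (rho : R) : 0 < rho ->
  (\int[lebesgue_rV n.+1]_x (\1_[set x : 'rV[R]_n.+1 | enorm x <= rho] x *
     expR (dotp (dirvec y) x - enorm (dirvec y) * rho))%:E <=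
   (Num.sqrt (rho * pi *+ 2) ^+ n)%:E)%E.
Proof.
move=> rho0; set k := dirvec y; set lam := enorm k.
have lam1 : 1 <= lam by exact: enorm_dirvec_ge1.
pose B := [set x : 'rV[R]_n.+1 | enorm x <= rho].
have mB : measurable B.
  have := @measurable_enorm R n.+1 measurableT `]-oo, rho]%classic (measurable_itv _).
  by rewrite setTI; congr (measurable _); apply/seteqP; split => x /=; rewrite in_itv/=.
pose F x := \1_B x * expR (dotp k x - lam * rho).
have F0 x : 0 <= F x by rewrite mulr_ge0 ?expR_ge0.
have mdot m (v : 'rV[R]_m) : measurable_fun setT (dotp v).
  apply: measurable_sum => i; apply: measurable_funM => //.
  exact: measurable_rV_coord.
have mF : measurable_fun setT F.
  apply: measurable_funM; first exact: measurable_indic.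
  apply: measurableT_comp => //; apply: measurable_funB => //; exact: mdot.
rewrite integral_rV_cons; last 2 first.
- by apply/measurable_EFinP.
- by move=> x; rewrite lee_fin.
have srho : Num.sqrt rho != 0 by rewrite gt_eqF// sqrtr_gt0.
have srho2 : Num.sqrt rho ^+ 2 = rho by rewrite sqr_sqrtr// ltW.
pose m i := rho * y i / lam.
have := integral_prod_normal m srho; rewrite srho2 => <-.
have mN : measurable_fun setT
    (fun x : 'rV[R]_n => \prod_(i < n) normal_fun (m i) (Num.sqrt rho) (x 0 i)).
  apply: measurable_prod => i _; apply: measurableT_comp (measurable_rV_coord i).
  exact: measurable_normal_fun.
have mFc : measurable_fun setT ((EFin \o F) \o @rV_cons R n).
  apply: measurableT_comp; last exact: measurable_rV_cons.
  exact/measurable_EFinP.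
apply: ge0_le_integral => //.
- by move=> x _; apply: integral_ge0 => a _; rewrite lee_fin.
- have Fc0 z : (0 <= ((EFin \o F) \o @rV_cons R n) z)%E by rewrite lee_fin.
  exact: (@measurable_fun_fubini_tonelli_G _ _ _ _ R lambda _ mFc Fc0).
- exact/measurable_EFinP.
move=> x _.
have enE a : enorm (rV_cons (a, x)) ^+ 2 = a ^+ 2 + \sum_i x 0 i ^+ 2.
  rewrite enorm_sqr big_ord_recl rV_cons0; congr (_ + _).
  by apply: eq_bigr => i _; rewrite rV_consS.
have notB a : rho ^+ 2 < a ^+ 2 + \sum_i x 0 i ^+ 2 -> \1_B (rV_cons (a, x)) = 0 :> R.
  move=> h; rewrite indicE memNset// /B/= => h'.
  have : enorm (rV_cons (a, x)) ^+ 2 <= rho ^+ 2.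
    by rewrite lerXn2r ?nnegrE ?enorm_ge0// ltW.
  by rewrite enE leNgt h.
have [xrho|xrho] := ltP (rho ^+ 2) (\sum_i x 0 i ^+ 2).
  rewrite (eq_integral (fun=> 0%E)).
    by rewrite integral0 lee_fin prodr_ge0// => i _; exact: normal_fun_ge0.
  move=> a _; rewrite notB ?mul0r//; apply: (lt_le_trans xrho).
  by rewrite lerDr sqr_ge0.
pose A := Num.sqrt (rho ^+ 2 - \sum_i x 0 i ^+ 2).
have AE : A ^+ 2 = rho ^+ 2 - \sum_i x 0 i ^+ 2 by rewrite sqr_sqrtr// subr_ge0.
pose c := expR (\sum_i y i * x 0 i - lam * rho).
(* The chord [-A, A] is enlarged to the half-line from -A: the integrand decays in a, so its mass
   sits at the lower end. *)
have h : (\int[lambda]_a (F (rV_cons (a, x)))%:E <=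
    \int[lambda]_(a in `[(- A)%R, +oo[) (c%:E * (expR (- a)%R)%:E))%E.
  rewrite [leRHS]integral_mkcond; apply: ge0_le_integral => //.
  - by move=> a _; rewrite lee_fin.
  - apply/measurable_EFinP; apply: (measurableT_comp mF).
    apply: (measurableT_comp (@measurable_rV_cons R n)).
    exact: measurable_pair2.
  - apply/(measurable_restrictT _ (measurable_itv _)).
    apply: measurable_funTS; apply/measurable_EFinP.
    apply: measurable_funM => //; apply: measurableT_comp => //.
  - move=> a _; rewrite patchE; case: ifPn => aA.
      rewrite -EFinM lee_fin /F /c -expRD.
      rewrite (_ : dotp k _ - _ = \sum_i y i * x 0 i - lam * rho + - a).
        by rewrite ler_piMl ?expR_ge0// indicE lern1 leq_b1.
      rewrite /dotp big_ord_recl dirvec0 rV_cons0 mulN1r.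
      under eq_bigr do rewrite dirvecS rV_consS.
      by rewrite -addrA [RHS]addrC.
    rewrite lee_fin /F notB ?mul0r// -subr_gt0.
    have : a < - A.
      by rewrite ltNge; apply: contraNN aA => aA; rewrite inE/= in_itv/= aA.
    move=> aA'; have A0 : 0 <= A by exact: sqrtr_ge0.
    have : (- a) ^+ 2 > A ^+ 2 by rewrite ltrXn2r// ?nnegrE; lra.
    by rewrite AE sqrrN; lra.
apply: (le_trans h); rewrite ge0_integralZl//; last 2 first.
- apply: measurable_funTS; apply/measurable_EFinP.
  by apply: measurableT_comp => //.
- by rewrite lee_fin expR_ge0.
rewrite integral_expRN opprK -EFinM lee_fin -expRD.
apply: (@le_trans _ _ (expR (- (\sum_i (x 0 i - rho * y i / lam) ^+ 2) / (rho *+ 2)))).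
  rewrite ler_expR addrC addrA; apply: sphere_exponent => //.
    exact: enorm_dirvec.
  by rewrite AE subrK.
rewrite -sumrN mulr_suml expR_sum le_eqVlt; apply/orP; left; apply/eqP.
by apply: eq_bigr => i _; rewrite /normal_fun srho2.
Qed.

End ball_integral.

(** * Sums of waves over a grid of directions *)

Section grid.
Context {R : realType}.

Lemma sum_sqr_lin n (a b : 'I_n -> R) (x y : R) :
  \sum_i (x * a i - y * b i) ^+ 2 = x ^+ 2 * (\sum_i a i ^+ 2) -
    (2 * x * y) * (\sum_i a i * b i) + y ^+ 2 * (\sum_i b i ^+ 2).
Proof.
rewrite !mulr_sumr -sumrB -big_split/=.
by apply: eq_bigr => i _; ring.
Qed.

Lemma cauchy_schwarz n (a b : 'I_n -> R) :
  (\sum_i a i * b i) ^+ 2 <= (\sum_i a i ^+ 2) * (\sum_i b i ^+ 2).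
Proof.
set A := \sum_i a i ^+ 2; set B := \sum_i b i ^+ 2; set D := \sum_i a i * b i.
have B0 : 0 <= B by apply: sumr_ge0 => i _; exact: sqr_ge0.
have h : 0 <= \sum_i (B * a i - D * b i) ^+ 2.
  by apply: sumr_ge0 => i _; exact: sqr_ge0.
have hE : \sum_i (B * a i - D * b i) ^+ 2 = B * (A * B - D ^+ 2).
  by rewrite sum_sqr_lin -/A -/B -/D; ring.
have [B_eq0|B_neq0] := eqVneq B 0; last first.
  move: h; rewrite hE pmulr_rge0 ?subr_ge0//.
  by rewrite lt_def B_neq0.
have b0 i : b i = 0.
  have := B_eq0; rewrite /B => /eqP; rewrite psumr_eq0 => [|j _]; last exact: sqr_ge0.
  by move=> /allP /(_ i (mem_index_enum i)); rewrite /= sqrf_eq0 => /eqP.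
rewrite B_eq0 mulr0 /D big1 ?expr0n// => i _.
by rewrite b0 mulr0.
Qed.

Lemma dotp_le n (k x : 'rV[R]_n) : dotp k x <= enorm k * enorm x.
Proof.
apply: (le_trans (ler_norm _)).
rewrite -(@ler_pXn2r _ 2) ?nnegrE ?mulr_ge0 ?enorm_ge0//.
by rewrite real_normK ?num_real// exprMn !enorm_sqr; exact: cauchy_schwarz.
Qed.

(** Uniform midpoint convexity of y |-> sqrt(1 + |y|^2) on the unit cube. With a, b, c the norms at
    y, z and the midpoint, and d = y.z, one has (a + b)^2 - (2 c)^2 = 2 (a b - (1 + d)), while
    Cauchy-Schwarz gives |y - z|^2 <= (a b)^2 - (1 + d)^2. Dividing by a b + 1 + d <= 2 N and by a +
    b + 2 c <= 4 N produces the modulus. *)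
Lemma enorm_dirvec_convex n (y z : 'I_n -> R) (N : R) :
  N = n.+1%:R ->
  (forall i, 0 <= y i <= 1) -> (forall i, 0 <= z i <= 1) ->
  2 * enorm (dirvec (fun i => (y i + z i) / 2)) +
    (\sum_i (y i - z i) ^+ 2) / (4 * N ^+ 2) <=
  enorm (dirvec y) + enorm (dirvec z).
Proof.
move=> NE y01 z01.
have N1 : 1 <= N by rewrite NE ler1n.
have N0 : 0 < N by exact: lt_le_trans N1.
set w := fun i => _.
have w01 i : 0 <= w i <= 1.
  by move: (y01 i) (z01 i) => /andP[? ?] /andP[? ?]; apply/andP; split; rewrite /w; lra.
have leN (v : 'I_n -> R) : (forall i, 0 <= v i <= 1) -> enorm (dirvec v) ^+ 2 <= N.
  move=> v01; rewrite enorm_dirvec NE -[n.+1]add1n natrD lerD2l.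
  apply: (@le_trans _ _ (\sum_(i < n) (1 : R))); last by rewrite sumr_const card_ord.
  by apply: ler_sum => i _; case/andP: (v01 i) => v0 v1; rewrite exprn_ile1.
have leN' (v : 'I_n -> R) : (forall i, 0 <= v i <= 1) -> enorm (dirvec v) <= N.
  move=> /leN h; apply: le_trans h; rewrite expr2 ler_peMr ?enorm_ge0//.
  exact: enorm_dirvec_ge1.
set a := enorm (dirvec y); set b := enorm (dirvec z); set c := enorm (dirvec w).
have a1 : 1 <= a by exact: enorm_dirvec_ge1.
have b1 : 1 <= b by exact: enorm_dirvec_ge1.
have c1 : 1 <= c by exact: enorm_dirvec_ge1.
have aN : a <= N by exact: leN'.
have bN : b <= N by exact: leN'.
have cN : c <= N by exact: leN'.
have a2N : a ^+ 2 <= N by exact: leN.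
have b2N : b ^+ 2 <= N by exact: leN.
pose d := \sum_i y i * z i.
pose Q := \sum_i (y i - z i) ^+ 2.
have Q0 : 0 <= Q by apply: sumr_ge0 => i _; exact: sqr_ge0.
have d0 : 0 <= d.
  by apply: sumr_ge0 => i _; rewrite mulr_ge0//; [case/andP: (y01 i)|case/andP: (z01 i)].
have QE : Q = a ^+ 2 + b ^+ 2 - 2 - 2 * d.
  rewrite /a /b !enorm_dirvec /Q /d.
  transitivity (\sum_i y i ^+ 2 + \sum_i z i ^+ 2 - 2 * \sum_i y i * z i); last by ring.
  by rewrite mulr_sumr -big_split/= -sumrB; apply: eq_bigr => i _; ring.
have cE : 4 * c ^+ 2 = a ^+ 2 + b ^+ 2 + 2 + 2 * d.
  rewrite /c enorm_dirvec /a /b !enorm_dirvec /d.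
  transitivity (4 + (\sum_i y i ^+ 2 + \sum_i z i ^+ 2 + 2 * \sum_i y i * z i)); last by ring.
  rewrite mulrDr mulr1; congr (_ + _).
  by rewrite !mulr_sumr -!big_split/=; apply: eq_bigr => i _; rewrite /w; field.
have cs : d ^+ 2 <= (a ^+ 2 - 1) * (b ^+ 2 - 1).
  rewrite /a /b !enorm_dirvec ![1 + _ - 1]addrC !addKr.
  exact: cauchy_schwarz.
have key : Q <= (a * b) ^+ 2 - (1 + d) ^+ 2.
  rewrite QE; nra.
have abd : 1 + d <= a * b.
  rewrite -(@ler_pXn2r _ 2) ?nnegrE ?addr_ge0// ?mulr_ge0 ?enorm_ge0//.
  by rewrite -subr_ge0 (le_trans Q0).
have abN : a * b <= N by nra.
have step1 : Q / (2 * N) <= a * b - (1 + d).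
  rewrite ler_pdivrMr ?mulr_gt0//.
  apply: (le_trans key); rewrite subr_sqr ler_wpM2l ?subr_ge0//; lra.
have E : (a + b) ^+ 2 - (2 * c) ^+ 2 = 2 * (a * b - (1 + d)).
  by transitivity ((a + b) ^+ 2 - 4 * c ^+ 2); [ring|rewrite cE; ring].
have h1 : Q / N <= (a + b - 2 * c) * (a + b + 2 * c).
  rewrite -subr_sqr E; have : Q / N = 2 * (Q / (2 * N)).
    by field; rewrite gt_eqF.
  by move=> ->; rewrite ler_pM2l//; exact: step1.
have QN0 : 0 <= Q / N by rewrite divr_ge0// ltW.
have pos : 0 <= a + b - 2 * c.
  have := le_trans QN0 h1; rewrite pmulr_lge0//; lra.
have h2 : Q / N <= (a + b - 2 * c) * (4 * N).
  by apply: (le_trans h1); rewrite ler_wpM2l//; lra.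
rewrite -lerBrDl -/Q (_ : Q / (4 * N ^+ 2) = Q / N / (4 * N)); last first.
  by field; rewrite gt_eqF.
by rewrite ler_pdivrMr// mulr_gt0.
Qed.

Lemma sum_dist_geometric (r : R) (a m : nat) : 0 <= r < 1 ->
  \sum_(l < m) r ^+ `|l - a|%N <= 2 / (1 - r).
Proof.
move=> /andP[r0 r1]; have r1' : 0 < 1 - r by rewrite subr_gt0.
(* A potential with values in [0, 2] whose increment from l to l + 1 is at least (1 - r) r^|l - a|,
   so that the sum telescopes. *)
pose h l := if (l <= a)%N then r ^+ (a - l) else 2 - r ^+ (l - a).
apply: (@le_trans _ _ (h m / (1 - r))); last first.
  rewrite ler_pM2r ?invr_gt0// /h; case: ifP => _.
    by apply: (@le_trans _ _ 1); [rewrite exprn_ile1// ltW|rewrite ler1n].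
  by rewrite lerBlDr lerDl exprn_ge0.
elim: m => [|m ih].
  by rewrite big_ord0 divr_ge0 ?(ltW r1')// /h leq0n exprn_ge0.
rewrite big_ord_recr/=; apply: (le_trans (lerD ih (lexx _))).
rewrite -lerBrDl -mulrBl ler_pdivlMr// /h.
have [ma|am] := leqP m a.
  have [ma'|am'] := leqP m.+1 a.
    rewrite (_ : `|m - a|%N = (a - m)%N); last by rewrite distnEr.
    rewrite -(subnSK ma') exprS; set t := r ^+ _.
    have t0 : 0 <= t by rewrite exprn_ge0.
    rewrite (_ : t - r * t = t * (1 - r)); last by ring.
    by rewrite ler_wpM2r ?(ltW r1')// ler_piMl// ltW.
  have -> : m = a by apply/eqP; rewrite eqn_leq ma -ltnS.
  by rewrite distnn subnn expr0 subSnn expr1 mul1r; lra.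
rewrite ltnNge (ltnW am)/= (_ : `|m - a|%N = (m - a)%N); last by rewrite distnEl// ltnW.
by rewrite subSn ?(ltnW am)// exprS; set t := r ^+ _; lra.
Qed.

Definition grid_point n m (j : {ffun 'I_n -> 'I_m}) (i : 'I_n) : R :=
  (j i)%:R / m%:R.

Lemma grid_point01 n m (j : {ffun 'I_n -> 'I_m}) i : 0 <= grid_point j i <= 1.
Proof.
apply/andP; split; first by rewrite divr_ge0.
rewrite /grid_point; have := ltn_ord (j i); case: m j => [j|m j]; first by [].
by move=> h; rewrite ler_pdivrMr ?ltr0n// mul1r ler_nat ltnW.
Qed.

Definition wave_phase n (y : 'I_n -> R) (s : R) (x : 'rV[R]_n.+1) : R :=
  dotp (dirvec y) x - enorm (dirvec y) * s.

(** Half the convexity modulus 1 / (4 N^2) of [enorm_dirvec_convex]: the half comes from comparing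
    each phase with its average with the maximal one. *)
Definition grid_ratio n : R := expR (- (8 * n.+1%:R ^+ 2)^-1).

Lemma grid_ratio01 n : 0 <= grid_ratio n < 1.
Proof.
by rewrite expR_ge0/= -expR0 ltr_expR oppr_lt0 invr_gt0 mulr_gt0.
Qed.

(** Valid for integers only; it weakens the Gaussian decay on the grid to a geometric one, whose sum
    is explicit. *)
Lemma dist_sqr (a b : nat) : (`|a - b|%N%:R : R) <= (a%:R - b%:R) ^+ 2.
Proof.
wlog ab : a b / (b <= a)%N.
  by move=> h; case: (leqP b a) => [/h //|/ltnW/h]; rewrite distnC -sqrrN opprB.
rewrite distnEl// -natrB// -natrX ler_nat.
by case: (a - b)%N => // k; rewrite expnS leq_pmulr// expn_gt0.
Qed.

(* [wave_phase] is [s]-uniformly concave in the direction and at most [N r'] at every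
   direction, so it decays away from the grid point where it is maximal. *)
Lemma grid_sum n m (s r' : R) (x : 'rV[R]_n.+1) : (0 < m)%N -> m%:R ^+ 2 <= s ->
  0 <= r' -> enorm x <= s + r' ->
  \sum_(j : {ffun 'I_n -> 'I_m}) expR (wave_phase (grid_point j) s x) <=
  expR (n.+1%:R * r') * (2 / (1 - grid_ratio n)) ^+ n.
Proof.
move=> m0 ms r0 xs; set N : R := n.+1%:R.
have N0 : 0 < N by rewrite ltr0n.
have mR : (0 : R) < m%:R by rewrite ltr0n.
have s0 : 0 <= s by apply: le_trans ms; rewrite exprn_ge0// ltW.
pose j0 : {ffun 'I_n -> 'I_m} := [ffun=> Ordinal m0].
pose E (j : {ffun 'I_n -> 'I_m}) := wave_phase (grid_point j) s x.
case: (@arg_maxP _ R _ j0 xpredT E isT) => b _ bmax.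
have phase j : E j <= N * r' - (8 * N ^+ 2)^-1 * \sum_i (`|j i - b i|%N)%:R.
  have Ejb : E j <= E b by exact: bmax.
  pose mid i := (grid_point j i + grid_point b i) / 2.
  have mid01 i : 0 <= mid i <= 1.
    by have := grid_point01 j i; have := grid_point01 b i; rewrite /mid => /andP[? ?] /andP[? ?]; apply/andP; split; lra.
  have dmid : dotp (dirvec (grid_point j)) x + dotp (dirvec (grid_point b)) x =
      2 * dotp (dirvec mid) x.
    rewrite /dotp !big_ord_recl !dirvec0.
    under eq_bigr do rewrite dirvecS.
    under [X in _ + (_ + X)]eq_bigr do rewrite dirvecS.
    under [in RHS]eq_bigr do rewrite dirvecS.
    rewrite mulrDr mulr_sumr addrACA -big_split/=; congr (_ + _); first by ring.
    by apply: eq_bigr => i _; rewrite /mid; field.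
  have conv := enorm_dirvec_convex (erefl N) (grid_point01 j) (grid_point01 b).
  rewrite -/mid in conv.
  set Q := \sum_i (grid_point j i - grid_point b i) ^+ 2 in conv.
  set lm := enorm (dirvec mid) in conv.
  have lm0 : 0 <= lm by exact: enorm_ge0.
  have lmN : lm <= N.
    have : lm ^+ 2 <= N.
      rewrite enorm_dirvec /N -[n.+1]add1n natrD lerD2l.
      apply: (@le_trans _ _ (\sum_(i < n) (1 : R))); last by rewrite sumr_const card_ord.
      by apply: ler_sum => i _; case/andP: (mid01 i) => v0 v1; rewrite exprn_ile1.
    by apply: le_trans; rewrite expr2 ler_peMr// enorm_dirvec_ge1.
  have dx : dotp (dirvec mid) x <= lm * s + N * r'.
    apply: (le_trans (dotp_le _ _)); apply: (@le_trans _ _ (lm * (s + r'))).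
      by rewrite ler_wpM2l.
    by rewrite mulrDr lerD2l ler_wpM2r.
  (* Grid coordinates are integers divided by m, and m^2 <= s trades the mesh for the time: the
     decay per grid step does not depend on s. *)
  have sQ : \sum_i (`|j i - b i|%N)%:R <= s * Q.
    rewrite /Q mulr_sumr; apply: ler_sum => i _; apply: (le_trans (dist_sqr _ _)).
    rewrite /grid_point -mulrBl exprMn mulrCA -[leLHS]mulr1 ler_wpM2l ?sqr_ge0//.
    by rewrite exprVn ler_pdivlMr ?exprn_gt0// mul1r.
  have sconv : s * (2 * lm + Q / (4 * N ^+ 2)) <=
      s * (enorm (dirvec (grid_point j)) + enorm (dirvec (grid_point b))).
    by rewrite ler_wpM2l.
  have EE : E j + E b = 2 * dotp (dirvec mid) x -
      s * (enorm (dirvec (grid_point j)) + enorm (dirvec (grid_point b))).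
    by rewrite -dmid /E /wave_phase; ring.
  have key : 2 * E j <= 2 * (N * r') - s * Q / (4 * N ^+ 2).
    apply: (@le_trans _ _ (E j + E b)); first by lra.
    rewrite EE; move: sconv; rewrite mulrDr [s * (Q / _)]mulrA.
    set K := s * Q / _; set L := s * (_ + _); move: dx.
    by rewrite (_ : s * (2 * lm) = 2 * (lm * s)); [lra|ring].
  have sQ' : (4 * N ^+ 2)^-1 * \sum_i (`|j i - b i|%N)%:R <= s * Q / (4 * N ^+ 2).
    by rewrite [leRHS]mulrC ler_wpM2l// invr_ge0 mulr_ge0// exprn_ge0// ltW.
  have -> : (8 * N ^+ 2)^-1 = (4 * N ^+ 2)^-1 / 2.
    by field; rewrite gt_eqF.
  set K := s * Q / _ in key sQ'.
  set Z := \sum_i _ in sQ' *; set c := (4 * N ^+ 2)^-1 in sQ' *.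
  rewrite (_ : c / 2 * Z = c * Z / 2); last by ring.
  by set cZ := c * Z in sQ' *; set Nr := N * r' in key *; lra.
apply: (@le_trans _ _ (\sum_(j : {ffun 'I_n -> 'I_m}) expR (N * r') *
    \prod_(i < n) grid_ratio n ^+ `|j i - b i|%N)).
  apply: ler_sum => j _; apply: (@le_trans _ _ (expR (N * r' - (8 * N ^+ 2)^-1 * \sum_i (`|j i - b i|%N)%:R))).
    by rewrite ler_expR; exact: phase.
  rewrite expRD ler_pM2l ?expR_gt0// -mulNr mulr_sumr expR_sum.
  apply: ler_prod => i _; rewrite expR_ge0/= /grid_ratio -expRM_natr.
  by rewrite /N.
rewrite -mulr_sumr ler_pM2l ?expR_gt0//.
(* The sum over all grid points of a product over the coordinates factors into one-dimensional
   sums. *)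
rewrite -(bigA_distr_bigA (fun i (l : 'I_m) => grid_ratio n ^+ `|l - b i|%N)).
rewrite -[X in _ <= _ ^+ X]card_ord -prodr_const.
apply: ler_prod => i _; apply/andP; split.
  by apply: sumr_ge0 => l _; rewrite exprn_ge0// expR_ge0.
exact: sum_dist_geometric (grid_ratio01 n).
Qed.

End grid.

(** * Bounds on the sources *)

Section power_mean.
Context {R : realType}.

(** The tangent to the convex function a^p at m. It is Young's inequality for a and m^(p-1), with
    conjugate exponents p and p / (p - 1). *)
Lemma young_tangent (p a m : R) : 1 < p -> 0 <= a -> 0 <= m ->
  p * m `^ (p - 1) * a <= a `^ p + (p - 1) * m `^ p.
Proof.
move=> p1 a0 m0; have p0 : 0 < p by exact: lt_trans p1.
have p10 : 0 < p - 1 by rewrite subr_gt0.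
have q0 : 0 < p / (p - 1) by rewrite divr_gt0.
have pq : p^-1 + (p / (p - 1))^-1 = 1.
  by rewrite invf_div; field; rewrite gt_eqF.
have := conjugate_powR a0 (powR_ge0 m (p - 1)) p0 q0 pq.
rewrite -powRrM (_ : (p - 1) * (p / (p - 1)) = p); last by field; rewrite gt_eqF.
rewrite -(ler_pM2l p0) mulrDr.
rewrite (_ : p * (a `^ p / p) = a `^ p); last by field; rewrite gt_eqF.
rewrite (_ : p * (m `^ p / (p / (p - 1))) = (p - 1) * m `^ p); last first.
  by rewrite invf_div; field; rewrite gt_eqF.
by rewrite mulrA mulrAC.
Qed.

Context d (T : measurableType d).
Variable mu : {measure set T -> \bar R}.

(* Integrates the tangent inequality [young_tangent] at [m = J / Vol]. *)
Lemma power_mean_lower (p J Vol C : R) (v W chi : T -> R) : 1 < p ->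
  mu.-integrable setT (EFin \o (fun x => `|v x| * W x)) ->
  mu.-integrable setT (EFin \o W) ->
  mu.-integrable setT (EFin \o (fun x => `|v x| `^ p * chi x)) ->
  (forall x, 0 <= W x <= C * chi x) ->
  0 < J -> 0 < Vol -> J <= \int[mu]_x (`|v x| * W x) -> \int[mu]_x W x <= Vol ->
  J * (J / Vol) `^ (p - 1) <= C * \int[mu]_x (`|v x| `^ p * chi x).
Proof.
move=> p1 ivW iW ivp WC J0 Vol0 JW WVol.
set m := J / Vol; have m0 : 0 < m by rewrite divr_gt0.
have pw x : p * m `^ (p - 1) * (`|v x| * W x) - (p - 1) * m `^ p * W x <=
    C * (`|v x| `^ p * chi x).
  have /andP[W0 WCx] := WC x.
  have := young_tangent p1 (normr_ge0 (v x)) (ltW m0).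
  rewrite -lerBlDr => h; apply: (@le_trans _ _ (`|v x| `^ p * W x)).
    by have := ler_wpM2r W0 h; rewrite mulrBl !mulrA.
  by rewrite mulrCA ler_wpM2l// powR_ge0.
have i1 : mu.-integrable setT (EFin \o (fun x => p * m `^ (p - 1) * (`|v x| * W x))).
  by have := integrableZl measurableT (p * m `^ (p - 1)) ivW.
have i2 : mu.-integrable setT (EFin \o (fun x => (p - 1) * m `^ p * W x)).
  by have := integrableZl measurableT ((p - 1) * m `^ p) iW.
have : \int[mu]_x (p * m `^ (p - 1) * (`|v x| * W x) - (p - 1) * m `^ p * W x) <=
    \int[mu]_x (C * (`|v x| `^ p * chi x)).
  apply: le_Rintegral => //.
  - by have := integrableB measurableT i1 i2.
  - by have := integrableZl measurableT C ivp.
rewrite RintegralB// !RintegralZl//; apply: le_trans.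
have mp : m `^ p = m `^ (p - 1) * m.
  rewrite -[X in _ * X](powRr1 (ltW m0)) -powRD ?subrK//.
  by apply/implyP => _; rewrite gt_eqF.
have p10 : 0 <= p - 1 by rewrite subr_ge0 ltW.
apply: (@le_trans _ _ (p * m `^ (p - 1) * J - (p - 1) * m `^ p * Vol)); last first.
  apply: lerB; rewrite ler_wpM2l// mulr_ge0 ?powR_ge0//.
  by rewrite ltW// (lt_trans ltr01).
rewrite mp (_ : (p - 1) * (m `^ (p - 1) * m) * Vol = (p - 1) * m `^ (p - 1) * J).
  by set t := m `^ _; rewrite (_ : p * t * J - _ = J * t)//; ring.
by rewrite /m; field; rewrite gt_eqF.
Qed.

End power_mean.

Section initial_data.
Context {R : realType} {n : nat}.
Local Notation leb := (lebesgue_rV n).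

(** Otherwise the nonnegative products of g with the cutoffs of integer radius would all vanish
    almost everywhere; these cubes exhaust the space, so g would vanish almost everywhere. *)
Lemma cutoff_mass (g : 'rV[R]_n -> R) : g \in Lfun leb 2%:E ->
  (\forall x \ae leb, 0 <= g x) -> ~ (\forall x \ae leb, g x = 0) ->
  exists2 M0 : R, 0 <= M0 & 0 < pairing leb g (cutoff M0).
Proof.
move=> g2 g0 gn0; apply: contrapT => h; apply: gn0.
have mg := Lfun_measurable g2.
have tc M : space_testfun (M + 1) (@cutoff R n M).
  have := @space_testfun_space_test R n M 0; congr (space_testfun _ _).
  apply/funext => x; rewrite /space_test (_ : dotp 0 x = 0) ?expR0 ?mulr1//.
  by rewrite /dotp big1// => i _; rewrite mxE mul0r.
have z (M : nat) : \forall x \ae leb, g x * cutoff M%:R x = 0.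
  have c2 := Lfun2_space_testfun (tc M%:R).
  have mc := Lfun_measurable c2.
  have i := pairing_integrable g2 c2.
  have : pairing leb g (cutoff M%:R) = 0.
    apply/eqP; rewrite eq_le; apply/andP; split.
      by rewrite leNgt; apply/negP => hM; apply: h; exists M%:R.
    apply: ae_ge0_Rintegral; first exact: measurable_funM.
    by apply: filterS g0 => x gx; rewrite mulr_ge0// cutoff_ge0.
  rewrite /pairing /Rintegral => /eqP.
  have fi : (\int[leb]_x (g x * cutoff M%:R x)%:E)%E \is a fin_num.
    exact: integrable_fin_num i.
  rewrite fine_eq0// => /eqP i0.
  have mgc : measurable_fun setT (fun x => (g x * cutoff M%:R x)%:E).
    by apply/measurable_EFinP; exact: measurable_funM.
  have := (ae_eq_integral_abs leb measurableT mgc).1.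
  have -> : (\int[leb]_x `|(g x * cutoff M%:R x)%:E| = 0)%E.
    rewrite -i0; apply: ae_eq_integral => //.
      exact: measurableT_comp.
    apply: filterS g0 => x gx _; rewrite gee0_abs// lee_fin mulr_ge0//.
    exact: cutoff_ge0.
  by move=> /(_ erefl); apply: filterS => x /(_ I) [].
have : \forall x \ae leb, forall M : nat, g x * cutoff M%:R x = 0.
  exact: ae_foralln.
apply: filterS => x hx.
have [M xM] : exists M : nat, forall i, `|x 0 i| <= M%:R.
  exists (Num.trunc (enorm x)).+1 => i; apply: (le_trans (norm_coord_le_enorm x i)).
  by rewrite ltW// truncnS_gt.
by have := hx M; rewrite cutoff_eq1// mulr1.
Qed.

End initial_data.

Section increments.
Context {R : realType}.
Local Notation lambda := (@lebesgue_measure R).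

Lemma integral_increment (h : R -> R) (kap t a b : R) :
  lambda.-integrable `[0, t] (EFin \o h) -> (forall s, 0 <= h s) ->
  0 <= a -> a <= b -> b <= t -> 0 <= kap ->
  (\forall s \ae lambda, a < s <= b -> kap <= h s) ->
  kap * (b - a) <= \int[lambda]_(s in `[0, b]) h s - \int[lambda]_(s in `[0, a]) h s.
Proof.
move=> ih h0 a0 ab bt kap0 aeh.
have ihb : lambda.-integrable `[0, b] (EFin \o h).
  by apply: integrableS ih => //; exact: subset_itvl.
rewrite Rintegral_itvB ?bnd_simp//.
have mI : measurable (`]a, b]%classic : set (measurableTypeR R)) by exact: measurable_itv.
have ihI : lambda.-integrable `]a, b] (EFin \o h).
  by apply: integrableS ihb => //; apply: subset_itvr; rewrite bnd_simp.
rewrite /Rintegral -lee_fin fineK; last exact: integrable_fin_num ihI.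
have -> : (kap * (b - a))%:E = (\int[lambda]_(s in `]a, b]) kap%:E)%E.
  rewrite integral_cst//=.
  rewrite [X in (_ * X)%E](_ : _ = (b - a)%:E) ?EFinM//.
  have := @lebesgue_measure_itv R `]a, b]; rewrite /= lte_fin => ->.
  case: ltP => [_|ba]; first by rewrite -EFinB.
  by rewrite (_ : b - a = 0)//; lra.
apply: ae_ge0_le_integral => //.
- by move=> s _; rewrite lee_fin.
- exact: measurable_int ihI.
Qed.

End increments.

Section energy_bounds.
Context {R : realType} {n : nat}.
Local Notation leb := (lebesgue_rV n).
Local Notation lambda := (@lebesgue_measure R).
Variables (mu beta p q eps T rad : R) (f g : 'rV[R]_n -> R).
Variables (u ut : R -> 'rV[R]_n -> R) (du : 'I_n -> R -> 'rV[R]_n -> R).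
Hypotheses (mu_gt0 : 0 < mu) (beta_gt1 : 1 < beta) (eps_gt0 : 0 < eps).
Hypothesis reg : energy_regularity p q T u ut du.
Hypothesis g2 : g \in Lfun leb 2%:E.
Hypothesis f_ge0 : \forall x \ae leb, 0 <= f x.
Hypothesis init : \forall x \ae leb, u 0 x = eps * f x.
Hypothesis weak : forall phi, test_function [set z : 'rV[R]_n * R | z.2 < T] phi ->
  forall t, 0 <= t < T ->
  nonlinear_terms_integrable p q u ut phi t /\
  weak_identity mu beta p q g eps u ut du phi t.
Hypothesis su : spacetime_supp T u `<=`
  [set z | 0 <= z.2 /\ enorm z.1 <= z.2 + rad].
Variables (t1 M : R).
Hypotheses (t1_gt0 : 0 < t1) (t1T : t1 < T) (M_ge : t1 + rad + 2 <= M).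

Lemma source_nondecreasing k x y : 0 <= x -> x <= y -> y <= t1 ->
  source p q T u ut t1 M k x <= source p q T u ut t1 M k y.
Proof.
move=> x0 xy yt; have t11 : 0 <= t1 <= t1 by rewrite lexx ltW.
have [i1 i2] := source_int_integrable weak M k t1T t11.
have h (h : R -> R) : lambda.-integrable `[0, t1] (EFin \o h) -> (forall s, 0 <= h s) ->
    \int[lambda]_(s in `[0, x]) h s <= \int[lambda]_(s in `[0, y]) h s.
  move=> ih h0.
  have ae0 : \forall s \ae lambda, x < s <= y -> 0 <= h s by apply: aeW => s _; exact: h0.
  by have := integral_increment ih h0 x0 xy yt (lexx 0) ae0; rewrite mul0r subr_ge0.
by apply: lerD; apply: h => // s; exact: source_int_ge0.
Qed.

Lemma wave_position0_ge0 k : 0 <= wave_pairing M k u 0.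
Proof.
rewrite /wave_pairing mulr_ge0 ?expR_ge0//.
have X2 := Lfun2_space_testfun (space_testfun_space_test M k).
have T0 : `[0, T[%classic (0 : R) by rewrite /= in_itv/= lexx (lt_trans t1_gt0).
have u02 : u 0 \in Lfun leb 2%:E by case: reg => -[cu _ _] _ _ _; have [] := cu 0 T0.
apply: ae_ge0_Rintegral.
  by apply: measurable_funM; [exact: Lfun_measurable u02|exact: Lfun_measurable X2].
apply: filterS2 init f_ge0 => x -> fx.
by rewrite mulr_ge0 ?space_test_ge0// mulr_ge0// ltW.
Qed.

Lemma plane_wave_velocity k s : 1 <= enorm k ->
  0 < pairing leb g (space_test M k) -> 0 <= s <= t1 ->
  expR (- (mu / (beta - 1))) / (2 + mu) * (eps * pairing leb g (space_test M k)) <=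
  wave_pairing M k ut s.
Proof.
move=> k1 gX st.
have H0 := wave_velocity0 reg g2 weak su k t1_gt0 t1T M_ge.
rewrite -H0; apply: (@plane_wave_lower R (enorm k) mu (mu / (beta - 1)) t1
  (wave_pairing M k ut) (wave_pairing M k u) (source p q T u ut t1 M k)
  (damp_primitive mu beta) (damp mu beta)) => //.
- exact: ltW.
- exact: (continuous_wave_velocity reg t1T).
- exact: (continuous_wave_position reg t1T).
- exact: within_continuous_damp_primitive.
- exact: within_continuous_damp.
- exact: source0.
- exact: source_nondecreasing.
- by move=> r; rewrite in_itv/= => /andP[r0 _]; exact: is_derive_damp_primitive.
- exact: damp_primitive0.
- by move=> r _; exact: damp_primitive_le.
- by move=> r _; exact: damp_ge0.
- by move=> r /andP[r0 _]; apply: damp_le => //; exact: lt_trans beta_gt1.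
- by move=> r rt; rewrite (wave_ode reg g2 weak su k t1_gt0 t1T M_ge rt) H0.
- by move=> r rt; exact: (is_derive_wave_position reg M k t1T rt).
- by rewrite H0 mulr_gt0.
- exact: wave_position0_ge0.
Qed.

Lemma enorm0 : enorm (0 : 'rV[R]_n) = 0.
Proof.
by rewrite /enorm big1 ?sqrtr0// => i _; rewrite mxE expr0n.
Qed.

(** At k = 0 the position drops out, and one use of [gronwall_lower] suffices. The source is kept in
    the bound because it is what makes the spatial mean grow. *)
Lemma zero_mode_velocity s : 0 <= pairing leb g (space_test M 0) -> 0 <= s <= t1 ->
  expR (- (mu / (beta - 1))) *
    (eps * pairing leb g (space_test M 0) + source p q T u ut t1 M 0 s) <=
  wave_pairing M 0 ut s.
Proof.
move=> gX /andP[s0 st]; set H0 := eps * _; set P := source _ _ _ _ _ _ _ _.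
have H0_ge0 : 0 <= H0 by rewrite mulr_ge0// ltW.
set V := wave_pairing M 0 ut.
have cV : {within `[0, s], continuous V}.
  apply: continuous_subspaceW (continuous_wave_velocity reg t1T).
  exact: subset_itvl.
pose D r := H0 - \int[lambda]_(x in `[0, r]) (damp mu beta x * V x).
have V_eq r : 0 <= r <= s -> V r = D r + P r.
  move=> /andP[r0 rs]; have rt : 0 <= r <= t1 by rewrite r0 (le_trans rs).
  rewrite /V (wave_ode reg g2 weak su 0 t1_gt0 t1T M_ge rt); congr (_ - _ + _).
  by apply: eq_Rintegral => x _; rewrite enorm0 add0r expr0n mul0r subr0.
have [s_eq0|s_neq0] := eqVneq s 0.
  rewrite s_eq0 V_eq ?lexx//= /D integral_segment0 subr0 /P source0 !addr0.
  by rewrite ler_piMl// -[leRHS]expR0 ler_expR oppr_le0 divr_ge0 ?ltW// subr_gt0.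
have s_gt0 : 0 < s by rewrite lt_def s_neq0.
have cbV : {within `[0, s], continuous (fun x => damp mu beta x * V x)}.
  by apply: within_continuousM => //; exact: within_continuous_damp.
have [cI dI] := ftc_segment s_gt0 cbV.
have key : expR (- damp_primitive mu beta s) * (D 0 + P s) <= V s.
  refine (@gronwall_lower R V D P (damp_primitive mu beta) (damp mu beta) s s0 _ _ _ _ _ _ _ _).
  - exact: V_eq.
  - by apply: within_continuousB => //; exact: within_cst.
  - move=> r rs; have d1 := dI r rs.
    by rewrite -[- _]add0r; apply: is_deriveB.
  - exact: within_continuous_damp_primitive.
  - by move=> r; rewrite in_itv/= => /andP[r0 _]; exact: is_derive_damp_primitive.
  - by move=> r _; exact: damp_ge0.
  - exact: damp_primitive0.
  - by move=> r /andP[r0 rs]; exact: source_nondecreasing.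
rewrite /D integral_segment0 subr0 in key; apply: le_trans key.
rewrite ler_wpM2r ?ler_expR ?lerN2 ?damp_primitive_le//.
rewrite addr_ge0// -(source0 p q T u ut t1 M 0).
exact: source_nondecreasing.
Qed.

End energy_bounds.

Section source_bounds.
Context {R : realType} {n : nat}.
Local Notation leb := (lebesgue_rV n).
Local Notation lambda := (@lebesgue_measure R).
Variables (mu beta p q eps T : R) (g : 'rV[R]_n -> R).
Variables (u ut : R -> 'rV[R]_n -> R) (du : 'I_n -> R -> 'rV[R]_n -> R).
Hypotheses (p_gt1 : 1 < p) (q_gt1 : 1 < q).
Hypothesis reg : energy_regularity p q T u ut du.
Hypothesis weak : forall phi, test_function [set z : 'rV[R]_n * R | z.2 < T] phi ->
  forall t, 0 <= t < T ->
  nonlinear_terms_integrable p q u ut phi t /\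
  weak_identity mu beta p q g eps u ut du phi t.
Variables (t1 M : R).
Hypotheses (t1_gt0 : 0 < t1) (t1T : t1 < T) (M_ge0 : 0 <= M).

Lemma dotp0 (x : 'rV[R]_n) : dotp 0 x = 0.
Proof. by rewrite /dotp big1// => i _; rewrite mxE mul0r. Qed.

Lemma space_test0 (x : 'rV[R]_n) : space_test M 0 x = cutoff M x.
Proof. by rewrite /space_test dotp0 expR0 mulr1. Qed.

Lemma wave_test0 (x : 'rV[R]_n) (s : R) : 0 <= s <= t1 -> space_test M 0 x *
  time_test (-1) ((t1 + T) / 2) ((T - t1) / 4) (enorm (0 : 'rV[R]_n)) s = cutoff M x.
Proof.
move=> /andP[s0 st]; have t1T' := t1T; rewrite space_test0 time_test_exp.
- by rewrite enorm0 oppr0 mul0r expR0 mulr1.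
- by rewrite divr_gt0// subr_gt0.
- by apply/andP; split; lra.
Qed.

Lemma source_int0E r v s : 0 <= s <= t1 ->
  source_int T t1 M 0 r v s = \int[leb]_x (`|v s x| `^ r * cutoff M x).
Proof. by move=> st; apply: eq_Rintegral => x _; rewrite wave_test0. Qed.

Lemma source_slices0_integrable : \forall s \ae lambda, 0 <= s <= t1 ->
    leb.-integrable setT (EFin \o (fun x => `|ut s x| `^ p * cutoff M x)) /\
    leb.-integrable setT (EFin \o (fun x => `|u s x| `^ q * cutoff M x)).
Proof.
have p0 : 0 <= p by rewrite ltW// (lt_trans ltr01).
have q0 : 0 <= q by rewrite ltW// (lt_trans ltr01).
have := source_slices_integrable reg weak M 0 t1_gt0 t1T p0 q0.
apply: aeS => s h st; have [h1 h2] := h st; split.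
- by apply: eq_integrable h1 => // x _; rewrite /= wave_test0.
- by apply: eq_integrable h2 => // x _; rewrite /= wave_test0.
Qed.

Lemma space_testfun_cutoff : space_testfun (M + 1) (@cutoff R n M).
Proof.
have := @space_testfun_space_test R n M 0; congr (space_testfun _ _).
by apply/funext => x; exact: space_test0.
Qed.

Lemma integrable_bounded (W : 'rV[R]_n -> R) (A C : R) : 0 <= A ->
  measurable_fun setT W -> (forall x, `|W x| <= C) ->
  (forall x, W x != 0 -> cube A x) -> leb.-integrable setT (EFin \o W).
Proof.
move=> A0 mW WC WA; apply/integrableP; split; first exact/measurable_EFinP.
apply: (@le_lt_trans _ _ (\int[leb]_(x in @cube R n A) C%:E)%E).
  rewrite [leRHS]integral_mkcond; apply: ge0_le_integral => //.
  - by apply: measurableT_comp => //; exact/measurable_EFinP.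
  - by apply/(measurable_restrictT _ (measurable_cube _)); exact: measurable_cst.
  - move=> x _; rewrite patchE; case: ifPn => xA; first by rewrite lee_fin.
    have W0 : W x = 0 by apply/eqP; apply: contraNT xA => /WA; rewrite inE.
    by rewrite /= W0 normr0.
rewrite integral_cst; last exact: measurable_cube.
by rewrite [X in (_ * X)%E](lebesgue_cube A0) -EFinM ltry.
Qed.

Lemma integral_cutoff_le : \int[leb]_x cutoff M x <= (2 * (M + 1)) ^+ n.
Proof.
have M1 : 0 <= M + 1 by rewrite addr_ge0.
have [eX XM] := space_testfun_cutoff.
have mc := measurable_elem eX.
have ic : leb.-integrable setT (EFin \o @cutoff R n M).
  apply: (integrable_bounded M1 mc _ XM) => x.
  by rewrite ger0_norm ?cutoff_ge0//; exact: cutoff_le1.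
rewrite -lee_fin /Rintegral fineK; last exact: integrable_fin_num ic.
apply: (@le_trans _ _ (\int[leb]_(x in @cube R n (M + 1)) 1%:E)%E).
  rewrite [leRHS]integral_mkcond; apply: ge0_le_integral => //.
  - by move=> x _; rewrite lee_fin cutoff_ge0.
  - exact/measurable_EFinP.
  - by apply/(measurable_restrictT _ (measurable_cube _)); exact: measurable_cst.
  - move=> x _; rewrite patchE; case: ifPn => xA; first by rewrite lee_fin cutoff_le1.
    suff -> : cutoff M x = 0 by [].
    by apply/eqP; apply: contraNT xA => /XM; rewrite inE.
rewrite integral_cst; last exact: measurable_cube.
by rewrite [X in (_ * X)%E](lebesgue_cube M1) -EFinM mul1r.
Qed.

(** The spatial mean is at most the integral of |u| against the cutoff, whose own integral is at
    most the volume of a cube of side 2 (M + 1). *)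
Lemma displacement_source : \forall s \ae lambda, 0 <= s <= t1 ->
  0 < wave_pairing M 0 u s ->
  wave_pairing M 0 u s * (wave_pairing M 0 u s / (2 * (M + 1)) ^+ n) `^ (q - 1) <=
  source_int T t1 M 0 q u s.
Proof.
have M1 : 0 < M + 1 by rewrite ltr_wpDl.
have [eX XM] := space_testfun_cutoff; have mc := measurable_elem eX.
have ic : leb.-integrable setT (EFin \o @cutoff R n M).
  apply: (integrable_bounded (ltW M1) mc _ XM) => x.
  by rewrite ger0_norm ?cutoff_ge0//; exact: cutoff_le1.
have c2 : @cutoff R n M \in Lfun leb 2%:E := Lfun2_space_testfun space_testfun_cutoff.
apply: aeS source_slices0_integrable => s h st Fpos; have [_ iq] := h st.
have us2 : u s \in Lfun leb 2%:E.
  have sT : `[0, T[%classic s.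
    by case/andP: st => s0 st; rewrite /= in_itv/= s0 (le_lt_trans st).
  by case: reg => -[cu _ _] _ _ _; have [] := cu s sT.
have FE : wave_pairing M 0 u s = pairing leb (u s) (cutoff M).
  rewrite /wave_pairing enorm0 oppr0 mul0r expR0 mul1r; congr (pairing _ _ _).
  by apply/funext => x; exact: space_test0.
have iuc := pairing_integrable us2 c2.
have iauc : leb.-integrable setT (EFin \o (fun x => `|u s x| * cutoff M x)).
  have := integrable_abse iuc; apply: eq_integrable => // x _ /=.
  by rewrite normrM (ger0_norm (cutoff_ge0 M x)).
rewrite source_int0E// -[leRHS]mul1r.
apply: (power_mean_lower q_gt1 iauc ic iq) => //.
- by move=> x; rewrite mul1r lexx cutoff_ge0.
- by rewrite exprn_gt0// mulr_gt0.
- rewrite FE; apply: (le_trans (ler_norm _)).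
  apply: (le_trans (le_normr_Rintegral _ iuc)) => //.
  rewrite le_eqVlt; apply/orP; left; apply/eqP; apply: eq_Rintegral => x _.
  by rewrite normrM (ger0_norm (cutoff_ge0 M x)).
- exact: integral_cutoff_le.
Qed.

End source_bounds.

(** * The source produced by the velocity *)

Section velocity_source.
Context {R : realType} {n' : nat}.
Local Notation n := n'.+1.
Local Notation leb := (lebesgue_rV n).
Local Notation lambda := (@lebesgue_measure R).
Variables (mu beta p q eps T rad : R) (g : 'rV[R]_n -> R).
Variables (u ut : R -> 'rV[R]_n -> R) (du : 'I_n -> R -> 'rV[R]_n -> R).
Hypotheses (p_gt1 : 1 < p) (q_gt1 : 1 < q) (rad_ge0 : 0 <= rad).
Hypothesis reg : energy_regularity p q T u ut du.
Hypothesis weak : forall phi, test_function [set z : 'rV[R]_n * R | z.2 < T] phi ->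
  forall t, 0 <= t < T ->
  nonlinear_terms_integrable p q u ut phi t /\
  weak_identity mu beta p q g eps u ut du phi t.
Hypothesis su : spacetime_supp T u `<=`
  [set z | 0 <= z.2 /\ enorm z.1 <= z.2 + rad].
Variables (t1 M J0 : R).
Hypotheses (t1_gt0 : 0 < t1) (t1T : t1 < T) (M_ge : t1 + rad + 2 <= M) (J0_gt0 : 0 < J0).
Hypothesis wave_lower : forall (y : 'I_n' -> R), (forall i, 0 <= y i <= 1) ->
  forall s, 0 <= s <= t1 -> J0 <= wave_pairing M (dirvec y) ut s.

Let r' := rad + 1.
Let r'_gt0 : 0 < r'. Proof. by rewrite ltr_wpDl. Qed.
Let M_gt0 : 0 < M.
Proof. by apply: lt_le_trans M_ge; rewrite ltr_pwDr// addr_ge0// ltW. Qed.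

Let Bs s : set 'rV[R]_n := [set x | enorm x <= s + r'].

Let mB s : measurable (Bs s).
Proof.
have := @measurable_enorm R n measurableT `]-oo, s + r']%classic (measurable_itv _).
by rewrite setTI; congr (measurable _); apply/seteqP; split => x /=; rewrite in_itv.
Qed.

Let B_cube s x : 0 <= s <= t1 -> Bs s x -> cube M x.
Proof.
move=> /andP[_ st] xB i; apply: (le_trans (norm_coord_le_enorm x i)).
by have := M_ge; move: xB; rewrite /Bs/= /r'; lra.
Qed.

(** A sharp truncation to the ball that carries the velocity at time s. Its mass is of cap size,
    while the smooth test function lives on a cube of radius M + 1 that does not follow s. *)
Definition ball_wave (y : 'I_n' -> R) s (x : 'rV[R]_n) : R :=
  \1_(Bs s) x * expR (wave_phase y s x).

Lemma ball_wave_ge0 y s x : 0 <= ball_wave y s x.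
Proof. by rewrite mulr_ge0 ?expR_ge0. Qed.

Lemma measurable_ball_wave y s : measurable_fun setT (ball_wave y s).
Proof.
apply: measurable_funM; first exact: measurable_indic.
apply: measurableT_comp => //; apply: measurable_funB => //.
exact: measurable_elem (elem_dotp (dirvec y)).
Qed.

Lemma enorm_dirvec_le (y : 'I_n' -> R) : (forall i, 0 <= y i <= 1) ->
  enorm (dirvec y) <= n%:R.
Proof.
move=> y01; have : enorm (dirvec y) ^+ 2 <= n%:R.
  rewrite enorm_dirvec -[n]add1n natrD lerD2l.
  apply: (@le_trans _ _ (\sum_(i < n') (1 : R))); last by rewrite sumr_const card_ord.
  by apply: ler_sum => i _; case/andP: (y01 i) => v0 v1; rewrite exprn_ile1.
by apply: le_trans; rewrite expr2 ler_peMr ?enorm_ge0// enorm_dirvec_ge1.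
Qed.

Lemma ball_wave_le (y : 'I_n' -> R) s x : (forall i, 0 <= y i <= 1) -> 0 <= s ->
  `|ball_wave y s x| <= expR (n%:R * r').
Proof.
move=> y01 s0; rewrite ger0_norm ?ball_wave_ge0// /ball_wave indicE.
case: (boolP (x \in Bs s)) => [xB|_]; last by rewrite mul0r expR_ge0.
rewrite mul1r ler_expR; apply: (@le_trans _ _ (enorm (dirvec y) * r')).
  rewrite lerBlDr -mulrDr [r' + s]addrC; apply: (le_trans (dotp_le _ _)).
  by rewrite ler_wpM2l ?enorm_ge0//; move: xB; rewrite inE.
by rewrite ler_wpM2r ?(ltW r'_gt0)// enorm_dirvec_le.
Qed.

Lemma ball_wave_cube y s x : 0 <= s <= t1 -> ball_wave y s x != 0 -> cube M x.
Proof.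
move=> st; rewrite /ball_wave indicE; case: (boolP (x \in Bs s)) => [|_].
  by rewrite inE => /(B_cube st).
by rewrite mul0r eqxx.
Qed.

Lemma integrable_ball_wave (y : 'I_n' -> R) s : (forall i, 0 <= y i <= 1) ->
  0 <= s <= t1 -> leb.-integrable setT (EFin \o ball_wave y s).
Proof.
move=> y01 st; apply: (@integrable_bounded R n _ M (expR (n%:R * r'))).
- exact: ltW.
- exact: measurable_ball_wave.
- by move=> x; apply: ball_wave_le => //; case/andP: st.
- by move=> x; exact: ball_wave_cube.
Qed.

Lemma Lfun2_ball_wave (y : 'I_n' -> R) s : (forall i, 0 <= y i <= 1) ->
  0 <= s <= t1 -> ball_wave y s \in Lfun leb 2%:E.
Proof.
move=> y01 st; apply: (@Lfun2_bounded _ _ _ _ _ (@cube R n M) (expR (n%:R * r'))).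
- exact: measurable_ball_wave.
- exact: measurable_cube.
- by rewrite [ltLHS](lebesgue_cube (ltW M_gt0)) ltry.
- by move=> x; apply: ball_wave_le => //; case/andP: st.
- by move=> x; exact: ball_wave_cube.
Qed.

(** The Gaussian bound at radius s + r'. The phase is normalised at s and not at s + r', which costs
    e^(|k| r') <= e^(n r'). *)
Definition ball_wave_mass s : R :=
  expR (n%:R * r') * Num.sqrt ((s + r') * pi *+ 2) ^+ n'.

Lemma integral_ball_wave_le (y : 'I_n' -> R) s : (forall i, 0 <= y i <= 1) ->
  0 <= s <= t1 -> \int[leb]_x ball_wave y s x <= ball_wave_mass s.
Proof.
move=> y01 st; have s0 : 0 <= s by case/andP: st.
have i1 := integrable_ball_wave y01 st.
rewrite -lee_fin /Rintegral fineK; last exact: integrable_fin_num i1.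
set lam := enorm (dirvec y).
have -> : (\int[leb]_x (ball_wave y s x)%:E = \int[leb]_x ((expR (lam * r'))%:E *
    (\1_(Bs s) x * expR (dotp (dirvec y) x - lam * (s + r')))%:E))%E.
  apply: eq_integral => x _; rewrite -EFinM mulrCA -expRD /ball_wave /wave_phase.
  by congr (_ * expR _)%:E; rewrite -/lam; ring.
have sr : 0 < s + r' by rewrite ltr_wpDl.
have := ball_wave_integral y sr; rewrite -/(Bs s) -/lam => h.
rewrite ge0_integralZl//.
- rewrite EFinM; apply: lee_pmul => //; rewrite ?lee_fin ?expR_ge0//.
    by apply: integral_ge0 => x _; rewrite lee_fin mulr_ge0 ?expR_ge0.
  by rewrite ler_expR ler_wpM2r ?(ltW r'_gt0)// enorm_dirvec_le.
- apply/measurable_EFinP; apply: measurable_funM; first exact: measurable_indic.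
  apply: measurableT_comp => //; apply: measurable_funB => //.
  exact: measurable_elem (elem_dotp (dirvec y)).
Qed.

(** On the support of [ut s] the cutoff in the test function equals 1, so there the truncated plane
    wave and [ball_wave] coincide and the lower bound on the former carries over. *)
Lemma ball_wave_velocity (y : 'I_n' -> R) s : (forall i, 0 <= y i <= 1) ->
  0 <= s <= t1 -> J0 <= \int[leb]_x (`|ut s x| * ball_wave y s x) /\
  leb.-integrable setT (EFin \o (fun x => `|ut s x| * ball_wave y s x)).
Proof.
move=> y01 st; have b2 := Lfun2_ball_wave y01 st.
have sT : `[0, T[%classic s.
  by case/andP: st => s0 st; rewrite /= in_itv/= s0 (le_lt_trans st).
have ut2 t : `[0, T[%classic t -> ut t \in Lfun leb 2%:E.
  by move=> tT; case: reg => _ [_ cut _] _ _; have [] := cut t tT.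
have i1 := pairing_integrable (ut2 _ sT) b2.
have E x : `|ut s x * ball_wave y s x| = `|ut s x| * ball_wave y s x.
  by rewrite normrM (ger0_norm (ball_wave_ge0 _ _ _)).
split; last first.
  have := integrable_abse i1; apply: eq_integrable => // x _ /=.
  by rewrite E.
apply: (le_trans (wave_lower y01 st)); rewrite /wave_pairing.
have X2 := Lfun2_space_testfun (space_testfun_space_test M (dirvec y)).
rewrite -pairingZ//; last exact: ut2.
have -> : pairing leb (fun x => expR (- enorm (dirvec y) * s) * ut s x)
    (space_test M (dirvec y)) = pairing leb (ut s) (ball_wave y s).
  apply: pairing_ae => //.
  - by apply: Lfun2Z; exact: ut2.
  - exact: ut2.
  - have [[cu _ _] [_ _ dut] _ _] := reg.
    have sT' : 0 <= s < T by move: sT; rewrite /= in_itv.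
    have := velocity_support cu su dut ut2 sT'; apply: filterS => x hx.
    have [xB|xB] := leP (enorm x) (s + rad + 1); last by rewrite hx// mulr0 !mul0r.
    have xB' : Bs s x by rewrite /Bs /= /r' addrA.
    rewrite /ball_wave indicE mem_set// mul1r space_test_exp; last exact: B_cube xB'.
    by rewrite mulrAC -expRD mulrC; congr (_ * expR _); rewrite /wave_phase; ring.
apply: (le_trans (ler_norm _)); apply: (le_trans (le_normr_Rintegral _ i1)) => //.
by rewrite le_eqVlt; apply/orP; left; apply/eqP; apply: eq_Rintegral => x _.
Qed.

Definition grid_bound : R := expR (n%:R * r') * (2 / (1 - grid_ratio n')) ^+ n'.

(** The power mean inequality is applied once, with the sum W of the waves over the grid as weight:
    [grid_sum] bounds W by a constant on the ball, while the lower bound on the integral of |u_t| W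
    and the upper bound on the mass of W are both multiplied by the number of waves. *)
Lemma velocity_source : \forall s \ae lambda, 0 <= s <= t1 ->
  forall m : nat, (0 < m)%N -> m%:R ^+ 2 <= s ->
  m%:R ^+ n' * J0 * (J0 / ball_wave_mass s) `^ (p - 1) <=
  grid_bound * source_int T t1 M 0 p ut s.
Proof.
apply: aeS (source_slices0_integrable p_gt1 q_gt1 reg weak M t1_gt0 t1T) => s h st m m0 ms.
have [ip _] := h st; have s0 : 0 <= s by case/andP: st.
pose W x := \sum_(j : {ffun 'I_n' -> 'I_m}) ball_wave (grid_point j) s x.
have cardI : #|{: {ffun 'I_n' -> 'I_m}}|%:R = m%:R ^+ n' :> R by rewrite card_ffun !card_ord natrX.
have g01 (j : {ffun 'I_n' -> 'I_m}) := grid_point01 (R := R) j.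
have sumint (I' : Type) (r : seq I') (F : I' -> 'rV[R]_n -> R) :
    (forall j, leb.-integrable setT (EFin \o F j)) ->
    leb.-integrable setT (EFin \o (fun x => \sum_(j <- r) F j x)) /\
    \int[leb]_x (\sum_(j <- r) F j x)%R = \sum_(j <- r) \int[leb]_x F j x.
  move=> iF; elim: r => [|j r [ii ih]].
    split; last by under eq_Rintegral do rewrite big_nil;
      rewrite big_nil Rintegral_cst ?mul0r.
    rewrite (_ : _ \o _ = cst 0%E); first exact: integrable0.
    by apply/funext => x /=; rewrite big_nil.
  have E : (fun x => (\sum_(k <- j :: r) F k x)%R) = (fun x => F j x + (\sum_(k <- r) F k x)%R).
    by apply/funext => x; rewrite big_cons.
  rewrite E; split; first by have := integrableD measurableT (iF j) ii.
  by rewrite big_cons RintegralD ?ih.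
have [iW intW] := sumint _ (index_enum {ffun 'I_n' -> 'I_m}) _ (fun j => integrable_ball_wave (g01 j) st).
have [iutW intutW] := sumint _ (index_enum {ffun 'I_n' -> 'I_m}) (fun j x => `|ut s x| * ball_wave (grid_point j) s x)
  (fun j => (ball_wave_velocity (g01 j) st).2).
have WE : (fun x => `|ut s x| * W x) =
    (fun x => \sum_(j : {ffun 'I_n' -> 'I_m}) `|ut s x| * ball_wave (grid_point j) s x).
  by apply/funext => x; rewrite mulr_sumr.
have mass_gt0 : 0 < ball_wave_mass s.
  rewrite mulr_gt0 ?expR_gt0// exprn_gt0// sqrtr_gt0 mulrn_wgt0// mulr_gt0 ?pi_gt0//.
  by rewrite ltr_wpDl.
have mn0 : 0 < m%:R ^+ n' :> R by rewrite exprn_gt0// ltr0n.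
rewrite source_int0E//.
(* The number of grid points cancels in J / Vol; it survives only in the outer factor J, and that is
   the gain of the grid. *)
rewrite (_ : J0 / ball_wave_mass s = (m%:R ^+ n' * J0) / (m%:R ^+ n' * ball_wave_mass s)); last first.
  by field; rewrite (gt_eqF mass_gt0) (gt_eqF mn0).
apply: (power_mean_lower (W := W) p_gt1).
- by rewrite WE.
- exact: iW.
- exact: ip.
- move=> x; apply/andP; split; first by apply: sumr_ge0 => j _; exact: ball_wave_ge0.
  have [xB|xB] := pselect (Bs s x).
    rewrite cutoff_eq1; last exact: B_cube xB.
    rewrite mulr1 /W; apply: le_trans (grid_sum m0 ms (ltW r'_gt0) xB).
    by apply: ler_sum => j _; rewrite /ball_wave indicE mem_set// mul1r.
  rewrite /W big1 => [|j _]; last by rewrite /ball_wave indicE memNset// mul0r.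
  rewrite mulr_ge0 ?cutoff_ge0// mulr_ge0 ?expR_ge0// exprn_ge0//.
  by have /andP[_ h1] := grid_ratio01 (R := R) n'; rewrite divr_ge0// subr_ge0 ltW.
- by rewrite mulr_gt0.
- by rewrite mulr_gt0.
- rewrite WE intutW -cardI mulr_natl -sumr_const; apply: ler_sum => j _.
  exact: (ball_wave_velocity (g01 j) st).1.
- rewrite /W intW -cardI mulr_natl -sumr_const; apply: ler_sum => j _.
  exact: integral_ball_wave_le.
Qed.

End velocity_source.

(** * Blow-up *)

Section blowup.
Context {R : realType}.

(* [F (tau (2 - 2^-k)) >= L Gam^k] for all [k], although these points stay below
   [2 tau]. *)
Lemma superlinear_blowup (F : R -> R) (q c L tau : R) : 1 < q -> 0 < c -> 0 < L ->
  0 < tau ->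
  (forall x y, 0 <= x -> x <= y -> y <= 2 * tau -> F x <= F y) ->
  (forall x h, tau <= x -> 0 < h -> x + h <= 2 * tau -> 0 < F x ->
    c * (F x * F x `^ (q - 1)) * h ^+ 2 <= F (x + h)) ->
  L <= F tau ->
  4 `^ (q - 1)^-1 <= c * L `^ (q - 1) * tau ^+ 2 / 4 -> False.
Proof.
move=> q1 c0 L0 tau0 Fnd Fstep FL.
(* With Gam^(q-1) = 4 the growth of F^(q-1) from one stage to the next compensates the factor 1/4
   lost in h^2 when the step is halved; the last hypothesis then says that each stage multiplies the
   bound by at least Gam. *)
set Gam := 4 `^ (q - 1)^-1 => GamL.
have q10 : 0 < q - 1 by rewrite subr_gt0.
have Gam1 : 1 < Gam.
  have <- : 1 `^ (q - 1)^-1 = 1 :> R by rewrite powR1.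
  by apply: gt0_ltr_powR; rewrite ?invr_gt0 ?nnegrE// ltr1n.
have Gam0 : 0 < Gam by exact: lt_trans Gam1.
have GamE (k : nat) : (Gam ^+ k) `^ (q - 1) = 4 ^+ k.
  rewrite -powR_mulrn ?(ltW Gam0)// /Gam -!powRrM.
  rewrite (_ : (_ : R) * _ = k%:R); first by rewrite powR_mulrn.
  by field; rewrite gt_eqF.
pose t (k : nat) := tau * (2 - 2 ^- k).
have i1 (k : nat) : 0 < (2 : R) ^- k <= 1.
  apply/andP; split; first by rewrite invr_gt0 exprn_gt0.
  by rewrite invf_le1 ?exprn_gt0// exprn_ege1// ler1n.
have tS k : t k.+1 = t k + tau * 2 ^- k.+1.
  by rewrite /t exprS; field; rewrite expf_neq0.
have t_ge k : tau <= t k.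
  by rewrite /t ler_peMr ?(ltW tau0)//; have /andP[_ ?] := i1 k; lra.
have t_le k : t k <= 2 * tau.
  by rewrite /t mulrC ler_pM2r//; have /andP[? _] := i1 k; lra.
have main k : L * Gam ^+ k <= F (t k).
  elim: k => [|k ih].
    by rewrite expr0 mulr1 /t expr0 invr1 (_ : 2 - 1 = 1) ?mulr1//; ring.
  set h := tau * 2 ^- k.+1.
  have h0 : 0 < h by rewrite mulr_gt0//; case/andP: (i1 k.+1).
  have LG0 : 0 < L * Gam ^+ k by rewrite mulr_gt0// exprn_gt0.
  have f0 : 0 < F (t k) by exact: lt_le_trans ih.
  rewrite tS -/h; have := Fstep (t k) h (t_ge k) h0.
  rewrite -tS => /(_ (t_le _) f0); apply: le_trans.
  apply: (@le_trans _ _ (c * (L * Gam ^+ k * (L * Gam ^+ k) `^ (q - 1)) * h ^+ 2)); last first.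
    rewrite ler_wpM2r ?sqr_ge0// ler_pM2l//; apply: ler_pM => //.
    - exact: ltW.
    - exact: powR_ge0.
    - by apply: ge0_ler_powR; rewrite ?nnegrE ?(ltW q10) ?(ltW LG0) ?(ltW f0).
  rewrite powRM ?exprn_ge0 ?(ltW L0) ?(ltW Gam0)// GamE.
  have hE : h ^+ 2 = tau ^+ 2 / 4 * 4 ^- k.
    have E : (2 ^- k.+1) ^+ 2 = 4^-1 * 4 ^- k :> R.
      rewrite -!exprVn -exprM mulnC exprM exprS.
      by rewrite (_ : 2^-1 ^+ 2 = 4^-1 :> R)//; field.
    by rewrite /h exprMn E mulrA.
  have -> : c * (L * Gam ^+ k * (L `^ (q - 1) * 4 ^+ k)) * h ^+ 2 =
      L * Gam ^+ k * (c * L `^ (q - 1) * tau ^+ 2 / 4).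
    by rewrite hE; field; rewrite expf_neq0.
  by rewrite exprSr mulrA ler_pM2l.
(* Bernoulli's inequality: since Gam > 1, the bounds exceed the fixed value F (2 tau) for some k. *)
have bern (k : nat) : 1 + k%:R * (Gam - 1) <= Gam ^+ k.
  elim: k => [|k ih]; first by rewrite mul0r addr0 expr0.
  rewrite exprS; apply: (@le_trans _ _ (Gam * (1 + k%:R * (Gam - 1)))); last first.
    by rewrite ler_pM2l.
  rewrite -subr_ge0 -[k.+1]addn1 natrD.
  rewrite (_ : _ - _ = k%:R * (Gam - 1) ^+ 2); last by ring.
  by rewrite mulr_ge0// sqr_ge0.
pose k := (Num.trunc (F (2 * tau) / (L * (Gam - 1)))).+1.
have kP : F (2 * tau) / (L * (Gam - 1)) < k%:R by exact: truncnS_gt.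
have G10 : 0 < Gam - 1 by rewrite subr_gt0.
have := main k; rewrite leNgt => /negP; apply.
apply: (@le_lt_trans _ _ (F (2 * tau))).
  by apply: Fnd => //; exact: le_trans (ltW tau0) (t_ge k).
apply: (@lt_le_trans _ _ (L * (1 + k%:R * (Gam - 1)))); last by rewrite ler_pM2l.
move: kP; rewrite ltr_pdivrMr ?mulr_gt0// => kP; apply: (lt_trans kP).
by rewrite (_ : L * (1 + _) = L + k%:R * (L * (Gam - 1))); [rewrite ltrDr|ring].
Qed.

End blowup.

(** * Growth of the spatial mean *)

Section zero_mode_growth.
Context {R : realType} {n : nat}.
Local Notation leb := (lebesgue_rV n).
Local Notation lambda := (@lebesgue_measure R).

(** On the cube of radius M0 + 1 one has |x| <= n (M0 + 1), so k.x is bounded below uniformly in |k|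
    <= n. All waves of the grid thus start from a common lower bound. *)
Lemma space_test_pairing_ge (g : 'rV[R]_n -> R) (M0 M : R) (k : 'rV[R]_n) :
  g \in Lfun leb 2%:E -> (\forall x \ae leb, 0 <= g x) ->
  0 <= M0 -> M0 + 1 <= M -> enorm k <= n%:R ->
  expR (- (n%:R * (n%:R * (M0 + 1)))) * pairing leb g (cutoff M0) <=
  pairing leb g (space_test M k).
Proof.
move=> g2 g0 M00 M0M kn; set e := expR _.
have c2 : @cutoff R n M0 \in Lfun leb 2%:E := Lfun2_space_testfun (space_testfun_cutoff M0).
have X2 := Lfun2_space_testfun (space_testfun_space_test M k).
have i1 := pairing_integrable g2 c2; have i2 := pairing_integrable g2 X2.
rewrite /pairing -RintegralZl//.
have i3 : leb.-integrable setT (EFin \o (fun x => e * (g x * cutoff M0 x))).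
  by have := integrableZl measurableT e i1.
rewrite -subr_ge0 -RintegralB//.
apply: ae_ge0_Rintegral.
  by apply: measurable_funB; apply/measurable_EFinP;
    [exact: measurable_int i2|exact: measurable_int i3].
apply: filterS g0 => x gx; rewrite (_ : _ - _ = g x * (space_test M k x - e * cutoff M0 x)); last by ring.
rewrite mulr_ge0// subr_ge0.
have [x0|xn0] := eqVneq (cutoff M0 x) 0; first by rewrite x0 mulr0 space_test_ge0.
have xM0 := cutoff_neq0 xn0.
rewrite space_test_exp; last by move=> i; exact: le_trans (xM0 i) M0M.
apply: (@le_trans _ _ e); first by rewrite ler_piMr ?expR_ge0// cutoff_le1.
rewrite ler_expR lerNl.
have -> : - dotp k x = dotp (- k) x.
  by rewrite /dotp -sumrN; apply: eq_bigr => i _; rewrite mxE mulNr.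
apply: (le_trans (dotp_le _ _)).
have -> : enorm (- k) = enorm k.
  by rewrite /enorm; congr Num.sqrt; apply: eq_bigr => i _; rewrite mxE sqrrN.
apply: ler_pM; rewrite ?enorm_ge0//.
have M1 : 0 <= M0 + 1 by rewrite addr_ge0.
rewrite -(@ler_pXn2r _ 2) ?nnegrE ?enorm_ge0 ?mulr_ge0// exprMn enorm_sqr.
apply: (@le_trans _ _ (\sum_(i < n) (M0 + 1) ^+ 2)).
  apply: ler_sum => i _; rewrite -real_normK ?num_real//.
  by rewrite lerXn2r ?nnegrE.
rewrite sumr_const card_ord -[leLHS]mulr_natl ler_wpM2r ?sqr_ge0//.
by rewrite -natrX ler_nat; case: (n) => // m; rewrite expnS leq_pmulr// expn_gt0.
Qed.

Variables (mu beta p q eps T rad : R) (f g : 'rV[R]_n -> R).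
Variables (u ut : R -> 'rV[R]_n -> R) (du : 'I_n -> R -> 'rV[R]_n -> R).
Hypotheses (mu_gt0 : 0 < mu) (beta_gt1 : 1 < beta) (eps_gt0 : 0 < eps).
Hypotheses (p_gt1 : 1 < p) (q_gt1 : 1 < q).
Hypothesis reg : energy_regularity p q T u ut du.
Hypothesis g2 : g \in Lfun leb 2%:E.
Hypothesis f_ge0 : \forall x \ae leb, 0 <= f x.
Hypothesis init : \forall x \ae leb, u 0 x = eps * f x.
Hypothesis weak : forall phi, test_function [set z : 'rV[R]_n * R | z.2 < T] phi ->
  forall t, 0 <= t < T ->
  nonlinear_terms_integrable p q u ut phi t /\
  weak_identity mu beta p q g eps u ut du phi t.
Hypothesis su : spacetime_supp T u `<=`
  [set z | 0 <= z.2 /\ enorm z.1 <= z.2 + rad].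
Variables (t1 M : R).
Hypotheses (t1_gt0 : 0 < t1) (t1T : t1 < T) (M_ge0 : 0 <= M) (M_ge : t1 + rad + 2 <= M).
Hypothesis gX : 0 <= pairing leb g (space_test M 0).

Let F := wave_pairing M 0 u.
Let V := wave_pairing M 0 ut.
Let P := source p q T u ut t1 M 0.
Let c0 := expR (- (mu / (beta - 1))).

Let c0_gt0 : 0 < c0. Proof. exact: expR_gt0. Qed.

Let P_ge0 s : 0 <= s <= t1 -> 0 <= P s.
Proof.
move=> /andP[s0 st]; rewrite -(source0 p q T u ut t1 M 0).
exact: (source_nondecreasing weak M t1_gt0 t1T).
Qed.

Let V_ge s : 0 <= s <= t1 -> c0 * P s <= V s.
Proof.
move=> st.
have := zero_mode_velocity mu_gt0 beta_gt1 eps_gt0 reg g2 weak su t1_gt0 t1T M_ge gX st.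
apply: le_trans; rewrite ler_pM2l//.
by rewrite lerDr mulr_ge0// ltW.
Qed.

Let F_increment x y kap : 0 <= x -> x < y -> y <= t1 ->
  (forall s, x < s < y -> kap <= V s) -> kap * (y - x) <= F y - F x.
Proof.
move=> x0 xy yt kapV.
have cF : {within `[x, y], continuous F}.
  apply: continuous_subspaceW (continuous_wave_position reg t1T).
  by apply: subset_itv; rewrite bnd_simp.
have dF s : s \in `]x, y[%R -> is_derive s 1 F (V s).
  rewrite in_itv/= => /andP[xs sy].
  have st : s \in `]0, t1[%R.
    by rewrite in_itv/= (le_lt_trans x0 xs) (lt_le_trans sy yt).
  have := is_derive_wave_position reg M 0 t1T st.
  by rewrite enorm0 mul0r subr0.
have [s] := MVT xy dF cF; rewrite in_itv/= => sxy ->.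
by rewrite ler_wpM2r ?subr_ge0 ?(ltW xy)// kapV.
Qed.

Lemma zero_mode_nondecreasing x y : 0 <= x -> x <= y -> y <= t1 -> F x <= F y.
Proof.
move=> x0; rewrite le_eqVlt => /predU1P[->//|xy] yt.
have := F_increment x0 xy yt (kap := 0); rewrite mul0r subr_ge0; apply.
move=> s /andP[xs sy].
have st : 0 <= s <= t1 by rewrite (ltW (le_lt_trans x0 xs)) (ltW (lt_le_trans sy yt)).
by apply: le_trans (V_ge st); rewrite mulr_ge0 ?P_ge0// ltW.
Qed.

Lemma zero_mode_ge0 x : 0 <= x -> x <= t1 -> 0 <= F x.
Proof.
move=> x0 xt; apply: le_trans (zero_mode_nondecreasing (lexx 0) x0 xt).
exact: (wave_position0_ge0 eps_gt0 reg f_ge0 init M t1_gt0 t1T).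
Qed.

(* Lower bound on half the interval for the source, on the other half for F. *)
Let half_step x h kap : 0 <= x -> 0 < h -> x + h <= t1 ->
  kap * (h / 2) <= P (x + h / 2) - P x ->
  c0 * kap * h ^+ 2 / 4 <= F (x + h).
Proof.
move=> x0 h0 xh kapP; set y := x + h / 2.
have y0 : 0 <= y by rewrite addr_ge0// divr_ge0// ltW.
have yh : y < x + h by rewrite /y; lra.
have xt : 0 <= x <= t1 by rewrite x0 (le_trans _ xh)// lerDl ltW.
have yt : y <= t1 by exact: le_trans (ltW yh) xh.
have := F_increment y0 yh xh (kap := c0 * (kap * (h / 2))).
have -> : c0 * (kap * (h / 2)) * (x + h - y) = c0 * kap * h ^+ 2 / 4.
  by rewrite /y; field.
move=> inc; have {}inc : c0 * kap * h ^+ 2 / 4 <= F (x + h) - F y.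
  apply: inc => s /andP[ys sxh].
  have st : 0 <= s <= t1 by rewrite (ltW (le_lt_trans y0 ys)) (ltW (lt_le_trans sxh xh)).
  apply: le_trans (V_ge st); rewrite ler_pM2l//.
  have Pys : P y <= P s by case/andP: st => _ st; apply: (source_nondecreasing weak M t1_gt0 t1T) => //; exact: ltW.
  by have := P_ge0 xt; lra.
by apply: (le_trans inc); rewrite gerBl zero_mode_ge0.
Qed.

Let source_parts x y kap h : lambda.-integrable `[0, t1] (EFin \o h) ->
  (forall s, 0 <= h s) -> 0 <= x -> x <= y -> y <= t1 -> 0 <= kap ->
  (\forall s \ae lambda, 0 <= s <= t1 -> x < s -> s <= y -> kap <= h s) ->
  kap * (y - x) <= \int[lambda]_(s in `[0, y]) h s - \int[lambda]_(s in `[0, x]) h s.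
Proof.
move=> ih h0 x0 xy yt kap0 ae; apply: (integral_increment ih) => //.
apply: aeS ae => s hs /andP[xs sy]; apply: hs => //.
by rewrite (ltW (le_lt_trans x0 xs)) (le_trans sy yt).
Qed.

(** F is nondecreasing, so on [x, x + h/2] the source of |u|^q is at least the value that
    [displacement_source] gives at F x; [half_step] turns this into growth of F. *)
Lemma zero_mode_step x h : 0 <= x -> 0 < h -> x + h <= t1 -> 0 < F x ->
  c0 / 4 * ((2 * (M + 1)) ^+ n) `^ (1 - q) * (F x * F x `^ (q - 1)) * h ^+ 2 <= F (x + h).
Proof.
move=> x0 h0 xh Fx; set Vq := (2 * (M + 1)) ^+ n.
have Vq0 : 0 < Vq by rewrite exprn_gt0// mulr_gt0// ltr_wpDl.
have kapE : c0 / 4 * Vq `^ (1 - q) * (F x * F x `^ (q - 1)) * h ^+ 2 =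
    c0 * (F x * (F x / Vq) `^ (q - 1)) * h ^+ 2 / 4.
  rewrite powRM ?invr_ge0 ?(ltW Fx) ?(ltW Vq0)//.
  rewrite -(powR_inv1 (ltW Vq0)) -powRrM (_ : -1 * (q - 1) = 1 - q); last by ring.
  by field.
rewrite kapE; apply: half_step => //.
have t11 : 0 <= t1 <= t1 by rewrite lexx ltW.
have [i1 i2] := source_int_integrable weak M 0 t1T t11.
have yt : x + h / 2 <= t1 by apply: le_trans xh; rewrite lerD2l; lra.
have xy : x <= x + h / 2 by rewrite lerDl; lra.
have kap0 : 0 <= F x * (F x / Vq) `^ (q - 1) by rewrite mulr_ge0 ?powR_ge0// ltW.
have h1 := source_parts i2 (source_int_ge0 _ _ _ _ _ _) x0 xy yt kap0.
have h2 := source_parts i1 (source_int_ge0 _ _ _ _ _ _) x0 xy yt (lexx 0).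
have ae1 : \forall s \ae lambda, 0 <= s <= t1 -> x < s -> s <= x + h / 2 ->
    F x * (F x / Vq) `^ (q - 1) <= source_int T t1 M 0 q u s.
  apply: aeS (displacement_source p_gt1 q_gt1 reg weak t1_gt0 t1T M_ge0).
  move=> s hs st xs sy; have Fs : F x <= F s.
    by case/andP: st => _ st; apply: zero_mode_nondecreasing => //; exact: ltW.
  have Fs0 : 0 < F s by exact: lt_le_trans Fs.
  apply: le_trans (hs st Fs0); apply: ler_pM; rewrite ?powR_ge0 ?(ltW Fx)//.
  apply: ge0_ler_powR; first by rewrite subr_ge0 ltW.
  - by rewrite nnegrE divr_ge0// ltW.
  - by rewrite nnegrE divr_ge0// ltW.
  - by rewrite ler_pM2r ?invr_gt0.
have ae2 : \forall s \ae lambda, 0 <= s <= t1 -> x < s -> s <= x + h / 2 ->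
    0 <= source_int T t1 M 0 p ut s.
  by apply: aeW => s _ _ _; exact: source_int_ge0.
move: {h1 h2} (h1 ae1) (h2 ae2) => h1 h2.
rewrite mul0r in h2; rewrite (_ : x + h / 2 - x = h / 2) in h1; last by ring.
by rewrite /P /source opprD addrACA; exact: ler_wpDl h2 h1.
Qed.

Lemma zero_mode_source_ge tau kap : 0 < tau -> tau <= t1 -> 0 <= kap ->
  (\forall s \ae lambda, 0 <= s <= t1 -> tau / 4 <= s -> s <= tau ->
    kap <= source_int T t1 M 0 p ut s) ->
  c0 * kap * tau ^+ 2 / 16 <= F tau.
Proof.
move=> tau0 tt kap0 ae.
(* The source is bounded below from tau / 4 on, which leaves an interval of length 3 tau / 4;
   (3/4)^2 / 4 = 9/64 exceeds 1/16. *)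
have E : c0 * kap * tau ^+ 2 / 16 <= c0 * kap * (tau * 3 / 4) ^+ 2 / 4.
  rewrite (_ : c0 * kap * (tau * 3 / 4) ^+ 2 / 4 = c0 * kap * tau ^+ 2 * (9 / 64)); last by field.
  apply: ler_wpM2l; first by rewrite mulr_ge0 ?sqr_ge0// mulr_ge0// ltW.
  lra.
apply: (le_trans E); rewrite {2}(_ : tau = tau / 4 + tau * 3 / 4); last by field.
set h := tau * 3 / 4.
have h0 : 0 < h by rewrite /h; lra.
have x0 : 0 <= tau / 4 by lra.
have xh : tau / 4 + h <= t1 by rewrite /h; lra.
apply: half_step => //.
have t11 : 0 <= t1 <= t1 by rewrite lexx ltW.
have [i1 i2] := source_int_integrable weak M 0 t1T t11.
have yt : tau / 4 + h / 2 <= t1 by rewrite /h; lra.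
have xy : tau / 4 <= tau / 4 + h / 2 by lra.
have ytau : tau / 4 + h / 2 <= tau by rewrite /h; lra.
have h1 := source_parts i1 (source_int_ge0 _ _ _ _ _ _) x0 xy yt kap0.
have h2 := source_parts i2 (source_int_ge0 _ _ _ _ _ _) x0 xy yt (lexx 0).
have ae1 : \forall s \ae lambda, 0 <= s <= t1 -> tau / 4 < s -> s <= tau / 4 + h / 2 ->
    kap <= source_int T t1 M 0 p ut s.
  apply: aeS ae => s hs st xs sy; apply: (hs st (ltW xs)).
  exact: le_trans sy ytau.
have ae2 : \forall s \ae lambda, 0 <= s <= t1 -> tau / 4 < s -> s <= tau / 4 + h / 2 ->
    0 <= source_int T t1 M 0 q u s.
  by apply: aeW => s _ _ _; exact: source_int_ge0.
move: {h1 h2} (h1 ae1) (h2 ae2) => h1 h2.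
rewrite mul0r in h2; rewrite (_ : tau / 4 + h / 2 - tau / 4 = h / 2) in h1; last by ring.
by rewrite /P /source opprD addrACA; exact: ler_wpDr h2 h1.
Qed.

End zero_mode_growth.

(** * Choice of the time scale *)

Section lifespan_balance.
Context {R : realType}.

(* After taking logarithms both sides are affine in [ln sigma] and [ln eps]; the
   value of [sigma] makes the [eps]-dependence cancel. *)
Lemma lifespan_balance (n' : nat) (p q A B D j c0 : R) :
  let theta := 2 * q + 2 - n'%:R * p * (q - 1) in
  1 < q -> 0 < A -> 0 < B -> 0 < D -> 0 < j -> 0 < c0 -> 0 < theta ->
  exists2 K : R, 2 <= K & forall eps M : R, 0 < eps -> 0 <= M ->
    let sigma := K * eps `^ (- (p * (q - 1)) / theta) in
    M + 1 <= D * sigma ^+ 2 ->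
    4 `^ (q - 1)^-1 <=
    c0 / 4 * ((2 * (M + 1)) ^+ n'.+1) `^ (1 - q) *
    (c0 * ((sigma / 4) ^+ n' * (j * eps) * (j * eps / (A * sigma ^+ n')) `^ (p - 1) / B) *
      (sigma ^+ 2) ^+ 2 / 16) `^ (q - 1) * (sigma ^+ 2) ^+ 2 / 4.
Proof.
move=> theta q1 A0 B0 D0 j0 c00 theta0.
have q10 : 0 < q - 1 by rewrite subr_gt0.
(* Collects the logarithms free of sigma and eps; the remainder is theta ln sigma + p (q - 1) ln
   eps, which equals theta ln K by the definition of sigma. *)
pose K0 := ln c0 - ln 4 + (1 - q) * (ln 2 + ln D) * n'.+1%:R +
  (q - 1) * (ln c0 - ln 4 * n'%:R + ln j + (p - 1) * (ln j - ln A) - ln B - ln 16) - ln 4.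
(* The exponential gives K0 + theta ln K >= ln 4 / (q - 1); the summand 2 serves K >= 2. *)
pose K := 2 + expR ((ln 4 / (q - 1) - K0) / theta).
have K2 : 2 <= K by rewrite lerDl expR_ge0.
have K_gt0 : 0 < K by apply: lt_le_trans K2.
have lnK4 : ln 4 / (q - 1) <= K0 + theta * ln K.
  rewrite -lerBlDl [leRHS]mulrC -ler_pdivrMr// -[leLHS]expRK ler_ln ?posrE ?expR_gt0//.
  by rewrite lerDr.
exists K => // eps M eps0 M0 sigma MD.
have sigma0 : 0 < sigma by rewrite mulr_gt0// powR_gt0.
have lnsigma : theta * ln sigma = theta * ln K - p * (q - 1) * ln eps.
  rewrite lnM ?posrE ?powR_gt0// ln_powR mulrDr; congr (_ + _).
  by field; exact: lt0r_neq0.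
clearbody sigma; have M1 : 0 < M + 1 by rewrite ltr_wpDl.
have lnXr (x : R) (k : nat) : 0 < x -> ln (x ^+ k) = ln x * k%:R.
  by move=> x0; rewrite lnXn// mulr_natr.
have lnM1 : ln (M + 1) <= ln D + ln sigma * 2.
  by rewrite -lnXr// -lnM ?posrE ?exprn_gt0// ler_ln ?posrE// mulr_gt0// exprn_gt0.
have pos4 : 0 < (4 : R) by [].
set V := (2 * (M + 1)) ^+ n'.+1.
set Q := j * eps / (A * sigma ^+ n').
have V0 : 0 < V by rewrite exprn_gt0// mulr_gt0.
have Q0 : 0 < Q by rewrite divr_gt0 ?mulr_gt0// exprn_gt0.
set L := c0 * _ * _ / 16.
have S0 : 0 < sigma / 4 by rewrite divr_gt0.
have Sn0 : 0 < (sigma / 4) ^+ n' by rewrite exprn_gt0.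
have J0 : 0 < j * eps by rewrite mulr_gt0.
have Qp0 : 0 < Q `^ (p - 1) by rewrite powR_gt0.
have SJ0 := mulr_gt0 Sn0 J0; have SJQ0 := mulr_gt0 SJ0 Qp0.
have X0 := divr_gt0 SJQ0 B0; have cX0 := mulr_gt0 c00 X0.
have T0 : 0 < (sigma ^+ 2) ^+ 2 by rewrite !exprn_gt0.
have cXT0 := mulr_gt0 cX0 T0.
have L0 : 0 < L by exact: divr_gt0.
have lnV : ln V = (ln 2 + ln (M + 1)) * n'.+1%:R.
  by rewrite lnXr ?mulr_gt0// lnM ?posrE.
have lnQ : ln Q = ln j + ln eps - (ln A + ln sigma * n'%:R).
  rewrite ln_div ?posrE ?mulr_gt0 ?exprn_gt0// !lnM ?posrE ?exprn_gt0//.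
  by rewrite lnXr.
have lnL : ln L = ln c0 + ((ln sigma - ln 4) * n'%:R + (ln j + ln eps) + (p - 1) * ln Q - ln B)
    + ln sigma * 4 - ln 16.
  rewrite ln_div ?posrE// lnM ?posrE// lnM ?posrE// ln_div ?posrE//.
  rewrite lnM ?posrE// lnM ?posrE// lnXr// ln_div ?posrE// lnM ?posrE// ln_powR.
  by rewrite -exprM lnXr.
have c4 : 0 < c0 / 4 by rewrite divr_gt0.
have Vq0 : 0 < V `^ (1 - q) by rewrite powR_gt0.
have Lq0 : 0 < L `^ (q - 1) by rewrite powR_gt0.
have cV0 := mulr_gt0 c4 Vq0; have cVL0 := mulr_gt0 cV0 Lq0.
have cVLT0 := mulr_gt0 cVL0 T0; have Y0 := divr_gt0 cVLT0 pos4.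
rewrite -[leRHS]lnK ?posrE// -[leLHS]lnK ?posrE ?powR_gt0// ler_expR.
rewrite ln_powR mulrC ln_div ?posrE// lnM ?posrE// lnM ?posrE// lnM ?posrE//.
rewrite !ln_powR ln_div ?posrE// -exprM lnXr//.
rewrite lnL lnQ lnV; apply: (le_trans lnK4).
have -> : K0 + theta * ln K = K0 + (theta * ln sigma + p * (q - 1) * ln eps).
  by rewrite lnsigma subrK.
(* The volume carries the negative exponent 1 - q, so it is the upper bound on M that bounds the
   right-hand side from below. *)
have low : (1 - q) * ((ln 2 + (ln D + ln sigma * 2)) * n'.+1%:R) <=
    (1 - q) * ((ln 2 + ln (M + 1)) * n'.+1%:R).
  rewrite ler_wnM2l ?subr_le0 ?(ltW q1)// ler_wpM2r// lerD2l//.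
rewrite -subr_ge0 in low; rewrite -subr_ge0; apply: (le_trans low).
rewrite le_eqVlt; apply/orP; left; apply/eqP.
rewrite /K0 /theta -[n'.+1]addn1 natrD natrM; ring.
Qed.

End lifespan_balance.

Section lifespan.
Context {R : realType} {n' : nat}.
Local Notation n := n'.+1.
Local Notation leb := (lebesgue_rV n).
Local Notation lambda := (@lebesgue_measure R).

Lemma grid_bound_gt0 (rad : R) : 0 < @grid_bound R n' rad.
Proof.
rewrite /grid_bound mulr_gt0 ?expR_gt0// exprn_gt0// divr_gt0// subr_gt0.
by have /andP[] := grid_ratio01 (R := R) n'.
Qed.

Lemma ball_wave_mass_gt0 (rad s : R) : 0 <= rad -> 0 <= s -> 0 < @ball_wave_mass R n' rad s.
Proof.
move=> rad0 s0; rewrite /ball_wave_mass mulr_gt0 ?expR_gt0// exprn_gt0// sqrtr_gt0.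
by rewrite mulrn_wgt0// mulr_gt0 ?pi_gt0// ltr_wpDl// ltr_wpDl.
Qed.

Lemma ball_wave_mass_le (rad sigma s : R) : 0 <= rad -> 1 <= sigma -> 0 <= s ->
  s <= sigma ^+ 2 ->
  @ball_wave_mass R n' rad s <=
  expR (n%:R * (rad + 1)) * Num.sqrt ((rad + 2) * pi *+ 2) ^+ n' * sigma ^+ n'.
Proof.
move=> rad0 sigma1 s0 ss; have sigma0 : 0 <= sigma by apply: le_trans sigma1.
rewrite /ball_wave_mass -mulrA ler_wpM2l ?expR_ge0// -exprMn.
apply: lerXn2r; rewrite ?nnegrE ?mulr_ge0 ?sqrtr_ge0//.
rewrite -[X in _ <= _ * X](ger0_norm sigma0) -sqrtr_sqr -sqrtrM; last first.
  by rewrite mulrn_wge0// mulr_ge0 ?pi_ge0// addr_ge0.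
apply: ler_wsqrtr; rewrite mulrnAl lerMn2r/= mulrAC ler_wpM2r ?pi_ge0//.
have sigma2 : 1 <= sigma ^+ 2 by rewrite exprn_ege1.
rewrite (_ : (rad + 2) * _ = sigma ^+ 2 + (rad + 1) * sigma ^+ 2); last by ring.
by apply: lerD => //; rewrite ler_peMr// addr_ge0.
Qed.

Variables (mu beta p q eps T rad : R) (f g : 'rV[R]_n -> R).
Variables (u ut : R -> 'rV[R]_n -> R) (du : 'I_n -> R -> 'rV[R]_n -> R).
Hypotheses (mu_gt0 : 0 < mu) (beta_gt1 : 1 < beta) (eps_gt0 : 0 < eps).
Hypotheses (p_gt1 : 1 < p) (q_gt1 : 1 < q) (rad_ge0 : 0 <= rad).
Hypothesis reg : energy_regularity p q T u ut du.
Hypothesis g2 : g \in Lfun leb 2%:E.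
Hypothesis f_ge0 : \forall x \ae leb, 0 <= f x.
Hypothesis init : \forall x \ae leb, u 0 x = eps * f x.
Hypothesis weak : forall phi, test_function [set z : 'rV[R]_n * R | z.2 < T] phi ->
  forall t, 0 <= t < T ->
  nonlinear_terms_integrable p q u ut phi t /\
  weak_identity mu beta p q g eps u ut du phi t.
Hypothesis su : spacetime_supp T u `<=`
  [set z | 0 <= z.2 /\ enorm z.1 <= z.2 + rad].
Variables (M G0 sigma : R).
Hypotheses (sigma_ge2 : 2 <= sigma) (sigmaT : 2 * sigma ^+ 2 < T).
Hypotheses (M_ge : 2 * sigma ^+ 2 + rad + 2 <= M) (G0_gt0 : 0 < G0).
Hypothesis gX : forall k : 'rV[R]_n, enorm k <= n%:R ->
  G0 <= pairing leb g (space_test M k).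

Let c0 := expR (- (mu / (beta - 1))).
Let A := expR (n%:R * (rad + 1)) * Num.sqrt ((rad + 2) * pi *+ 2) ^+ n'.
Let B := @grid_bound R n' rad.
Let J0 := c0 / (2 + mu) * G0 * eps.
Let kap := (sigma / 4) ^+ n' * J0 * (J0 / (A * sigma ^+ n')) `^ (p - 1) / B.
Let t1 := 2 * sigma ^+ 2.

Let sigma_gt0 : 0 < sigma. Proof. by apply: lt_le_trans sigma_ge2. Qed.
Let sigma2_gt0 : 0 < sigma ^+ 2. Proof. by rewrite exprn_gt0. Qed.
Let t1_gt0 : 0 < t1. Proof. by rewrite mulr_gt0. Qed.
Let c0_gt0 : 0 < c0. Proof. exact: expR_gt0. Qed.
Let A_gt0 : 0 < A.
Proof.
rewrite mulr_gt0 ?expR_gt0// exprn_gt0// sqrtr_gt0 mulrn_wgt0// mulr_gt0 ?pi_gt0//.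
by rewrite ltr_wpDl.
Qed.
Let B_gt0 : 0 < B. Proof. exact: grid_bound_gt0. Qed.
Let J0_gt0 : 0 < J0.
Proof. by rewrite mulr_gt0// mulr_gt0// divr_gt0// addr_gt0. Qed.
Let kap_gt0 : 0 < kap.
Proof.
have S0 : 0 < (sigma / 4) ^+ n' by rewrite exprn_gt0// divr_gt0.
have Q0 : 0 < J0 / (A * sigma ^+ n') by rewrite divr_gt0// mulr_gt0// exprn_gt0.
by rewrite divr_gt0// mulr_gt0 ?powR_gt0// mulr_gt0.
Qed.

Let wave_lower (y : 'I_n' -> R) : (forall i, 0 <= y i <= 1) ->
  forall s, 0 <= s <= t1 -> J0 <= wave_pairing M (dirvec y) ut s.
Proof.
move=> y01 s st; have gk := gX (enorm_dirvec_le y01).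
have gk0 := lt_le_trans G0_gt0 gk.
have := plane_wave_velocity mu_gt0 beta_gt1 eps_gt0 reg g2 f_ge0 init weak su
  t1_gt0 sigmaT M_ge (enorm_dirvec_ge1 y) gk0 st.
apply: le_trans; rewrite /J0 -mulrA ler_wpM2l ?divr_ge0 ?(ltW c0_gt0)//.
  by rewrite addr_ge0// ltW.
by rewrite mulrC ler_wpM2l// ltW.
Qed.

Let source_lower : \forall s \ae lambda, 0 <= s <= t1 -> sigma ^+ 2 / 4 <= s ->
  s <= sigma ^+ 2 -> kap <= source_int T t1 M 0 p ut s.
Proof.
apply: aeS (velocity_source p_gt1 q_gt1 rad_ge0 reg weak su t1_gt0 sigmaT M_ge
  J0_gt0 wave_lower) => s hs st s4 ss.
have s0 : 0 <= s by case/andP: st.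
have sigma0 := sigma_gt0; have sigma2 := sigma_ge2.
have h0 : 0 <= sigma / 2 by rewrite divr_ge0// ltW.
(* This choice gives sigma / 4 <= m <= sigma / 2: large enough for the factor (sigma / 4)^n' in
   [kap], and small enough for m^2 <= sigma^2 / 4 <= s. It is nonzero because sigma >= 2. *)
set m := Num.trunc (sigma / 2).
have /andP[mle mgt] := truncn_itv h0; rewrite -/m in mle mgt.
have m0 : (0 < m)%N.
  have : 1 < m.+1%:R :> R by apply: le_lt_trans mgt; lra.
  by rewrite ltr1n.
have m1 : 1 <= m%:R :> R by rewrite ler1n.
have m4 : sigma / 4 <= m%:R.
  have mgt1 : sigma / 2 < m%:R + 1 by rewrite natr1.
  move: (m%:R) m1 mgt1 => x x1 xs; lra.
have ms : m%:R ^+ 2 <= s.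
  apply: le_trans s4; rewrite (_ : sigma ^+ 2 / 4 = (sigma / 2) ^+ 2); last by field.
  by rewrite lerXn2r ?nnegrE.
have := hs st m m0 ms; rewrite [leRHS]mulrC -ler_pdivrMr//; apply: le_trans.
rewrite ler_wpM2r ?invr_ge0 ?(ltW B_gt0)//.
have mass0 := ball_wave_mass_gt0 rad_ge0 s0.
have massA := ball_wave_mass_le rad_ge0 (le_trans (ler1n R 2) sigma2) s0 ss.
have J0_ge0 := ltW J0_gt0; have sigma_ge0 := ltW sigma0.
have q4 : 0 <= sigma / 4 by rewrite divr_ge0.
have Asigma : 0 < A * sigma ^+ n' by rewrite mulr_gt0// exprn_gt0.
apply: ler_pM; rewrite ?powR_ge0//; first by rewrite mulr_ge0// exprn_ge0.
  by rewrite ler_wpM2r// lerXn2r ?nnegrE.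
apply: ge0_ler_powR; first by rewrite subr_ge0 ltW.
- by rewrite nnegrE divr_ge0// ltW.
- by rewrite nnegrE divr_ge0// ltW.
- by rewrite ler_pM2l// lef_pV2 ?posrE.
Qed.

(** [superlinear_blowup] at tau = sigma^2, which fits since t1 = 2 tau < T: the velocity source on
    [tau / 4, tau] supplies the initial size of F at tau, the displacement source the superlinear
    step. *)
Lemma lifespan_contradiction :
  4 `^ (q - 1)^-1 <=
  c0 / 4 * ((2 * (M + 1)) ^+ n) `^ (1 - q) *
  (c0 * kap * (sigma ^+ 2) ^+ 2 / 16) `^ (q - 1) * (sigma ^+ 2) ^+ 2 / 4 -> False.
Proof.
have M0 : 0 <= M by apply: le_trans M_ge; rewrite !addr_ge0// ltW.
have gX0 : 0 <= pairing leb g (space_test M 0).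
  by apply: le_trans (ltW G0_gt0) (gX _); rewrite enorm0.
apply: (@superlinear_blowup R (wave_pairing M 0 u)) => //.
- rewrite mulr_gt0// ?divr_gt0// powR_gt0// exprn_gt0// mulr_gt0// ltr_wpDl//.
- by rewrite divr_gt0// mulr_gt0 ?exprn_gt0// mulr_gt0.
- exact: (zero_mode_nondecreasing mu_gt0 beta_gt1 eps_gt0 reg g2 weak su t1_gt0 sigmaT M_ge gX0).
- move=> x h sx h0 xh Fx.
  have x0 : 0 <= x by apply: le_trans sx; exact: ltW.
  exact: (zero_mode_step mu_gt0 beta_gt1 eps_gt0 p_gt1 q_gt1 reg g2 f_ge0 init weak su
    t1_gt0 sigmaT M0 M_ge gX0 x0 h0 xh Fx).
- have st : sigma ^+ 2 <= t1 by rewrite ler_peMl ?(ltW sigma2_gt0)// ler1n.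
  exact: (zero_mode_source_ge mu_gt0 beta_gt1 eps_gt0 reg g2 f_ge0 init weak su
    t1_gt0 sigmaT M_ge gX0 sigma2_gt0 st (ltW kap_gt0) source_lower).
Qed.

End lifespan.

(** With d = (n - 1) p - 2 the exponent is 4 - (q - 1) d. For n >= 2, a negative d would put 1 + 4/d
    below 1, against 1 < q; hence d > 0, and q < 1 + 4/d is the claim. *)
Lemma lifespan_exponent_gt0 {R : realType} (n' : nat) (p q : R) : 1 < q ->
  ((2 <= n'.+1)%N ->
    (q%:E < Order.min (1 + 4 / ((n'.+1%:R - 1) * p - 2))%:E
               (if n'.+1 == 2%N then +oo else (2 * n'.+1%:R / (n'.+1%:R - 2))%:E))%E) ->
  ((2 <= n'.+1)%N -> (n'.+1%:R - 1) * p != 2) ->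
  0 < 2 * q + 2 - n'%:R * p * (q - 1).
Proof.
move=> q1 qlt p2; case: (posnP n') => [->|n0]; first by rewrite !mul0r subr0; lra.
have n2 : (2 <= n'.+1)%N by [].
have nE : n'.+1%:R - 1 = n'%:R :> R by rewrite -natr1 addrK.
have := qlt n2; have := p2 n2; rewrite lt_min nE lte_fin => /[swap] /andP[qd _].
set d := n'%:R * p - 2 in qd *; rewrite -subr_eq0 -/d => d0.
have -> : 2 * q + 2 - n'%:R * p * (q - 1) = 4 - (q - 1) * d by rewrite /d; ring.
have dpos : 0 < d.
  rewrite lt_neqAle eq_sym d0 leNgt; apply/negP => dneg.
  have : 4 / d < 0 by rewrite pmulr_rlt0// invr_lt0.
  by move: qd q1; lra.
by rewrite subr_gt0 -ltr_pdivlMr// ltrBlDl.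
Qed.

Theorem theorem2p1 (R : realType) (n : nat) (mu beta rad p : R)
    (f g : 'rV[R]_n -> R)
    (n_ge1 : (1 <= n)%N) (mu_gt0 : 0 < mu) (beta_gt1 : 1 < beta)
    (rad_ge1 : 1 <= rad)
    (f_H1 : sobolev_H1 f) (g_L2 : g \in Lfun (lebesgue_rV n) 2%:E)
    (f_ge0 : \forall x \ae lebesgue_rV n, 0 <= f x)
    (g_ge0 : \forall x \ae lebesgue_rV n, 0 <= g x)
    (f_supp : compact (ess_supp (almost_everywhere (lebesgue_rV n)) f))
    (g_supp : compact (ess_supp (almost_everywhere (lebesgue_rV n)) g))
    (g_neq0 : ~ (\forall x \ae lebesgue_rV n, g x = 0))
    (p_gt1 : 1 < p)
    (np_neq2 : (2 <= n)%N -> (n%:R - 1) * p != 2) :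
  exists2 eps0 : R, 0 < eps0 &
  forall q : R, 1 < q ->
  ((2 <= n)%N ->
     (q%:E < Order.min (1 + 4 / ((n%:R - 1) * p - 2))%:E
               (if n == 2%N then +oo else (2 * n%:R / (n%:R - 2))%:E))%E) ->
  exists2 C : R, 0 < C &
  forall eps : R, 0 < eps <= eps0 ->
  forall (T : R) (u : R -> 'rV[R]_n -> R), 0 < T ->
  energy_solution mu beta p q f g eps T u ->
  spacetime_supp T u `<=`
    [set z | 0 <= z.2 /\ enorm z.1 <= z.2 + rad] ->
  T <= C * eps `^ (- (2 * p * (q - 1))
                    / (2 * q + 2 - (n%:R - 1) * p * (q - 1))).
Proof.
case: n f g n_ge1 f_H1 g_L2 f_ge0 g_ge0 f_supp g_supp g_neq0 np_neq2 => // n' f g _.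
(* Any eps <= 1 is small enough: a nonpositive power of eps is then at least 1, and sigma >= K >=
   2. *)
move=> _ g2 f0 g0 _ _ gN0 np2; exists 1 => // q q1 qlt.
have rad0 : 0 <= rad by apply: le_trans rad_ge1.
have [M0 M00 gM0] := cutoff_mass g2 g0 gN0.
have theta0 := lifespan_exponent_gt0 q1 qlt np2.
have -> : n'.+1%:R - 1 = n'%:R :> R by rewrite -natr1 addrK.
set theta := _ - _ in theta0 *.
pose N : R := n'.+1%:R.
pose G0 := expR (- (N * (N * (M0 + 1)))) * pairing (lebesgue_rV n'.+1) g (cutoff M0).
have G00 : 0 < G0 by rewrite mulr_gt0// expR_gt0.
pose c0 := expR (- (mu / (beta - 1))).
have c00 : 0 < c0 by exact: expR_gt0.
pose j := c0 / (2 + mu) * G0.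
have j0 : 0 < j by rewrite mulr_gt0// divr_gt0// addr_gt0.
pose A := expR (N * (rad + 1)) * Num.sqrt ((rad + 2) * pi *+ 2) ^+ n'.
have A0 : 0 < A.
  rewrite mulr_gt0 ?expR_gt0// exprn_gt0// sqrtr_gt0 mulrn_wgt0// mulr_gt0 ?pi_gt0//.
  by rewrite ltr_wpDl.
(* The coefficient in M + 1 <= D sigma^2 for the radius M chosen below: M + 1 = 2 sigma^2 + rad + M0
   + 4, and sigma >= 1. *)
have D0 : 0 < rad + M0 + 6 by rewrite ltr_wpDl// addr_ge0.
have [K K2 balance] := lifespan_balance (p := p) q1 A0 (@grid_bound_gt0 R n' rad) D0 j0 c00 theta0.
have K0 : 0 < K by apply: lt_le_trans K2.
(* The asserted bound on T is then exactly 2 sigma^2 = 2 tau. *)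
exists (2 * K ^+ 2); first by rewrite mulr_gt0// exprn_gt0.
move=> eps /andP[eps0 eps1] T u T0 [ut [du [reg init weak]]] su.
set sigma := K * eps `^ (- (p * (q - 1)) / theta).
have sigma2 : 2 <= sigma.
  rewrite -[leLHS]mulr1; apply: ler_pM => //.
  rewrite -[leLHS](powRr0 eps); apply: ger_powR; first by rewrite eps0.
  by rewrite mulNr oppr_le0 divr_ge0 ?(ltW theta0)// mulr_ge0 ?subr_ge0 ?(ltW q1)// (le_trans _ (ltW p_gt1)).
have sigma1 : 1 <= sigma ^+ 2 by rewrite exprn_ege1// (le_trans _ sigma2)// ler1n.
have -> : 2 * K ^+ 2 * eps `^ (- (2 * p * (q - 1)) / theta) = 2 * sigma ^+ 2.
  rewrite /sigma exprMn -mulrA -[(_ `^ _) ^+ 2]powR_mulrn ?powR_ge0// -powRrM; congr (_ * (_ * _ `^ _)).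
  by ring.
rewrite leNgt; apply/negP => sigmaT.
(* The first summands cover the light cone up to time 2 sigma^2 with the margin for derivatives; M0
   + 1 makes the cutoff equal to 1 on the support of [cutoff M0], where g has positive mass. *)
pose M := 2 * sigma ^+ 2 + rad + 2 + (M0 + 1).
have M_ge : 2 * sigma ^+ 2 + rad + 2 <= M by rewrite lerDl addr_ge0.
have M0M : M0 + 1 <= M.
  by rewrite lerDr !addr_ge0// mulr_ge0// (le_trans _ sigma1).
have gX (k : 'rV[R]_n'.+1) : enorm k <= N -> G0 <= pairing (lebesgue_rV n'.+1) g (space_test M k).
  exact: space_test_pairing_ge.
apply: (lifespan_contradiction mu_gt0 beta_gt1 eps0 p_gt1 q1 rad0 reg g2 f0 init weak su
  sigma2 sigmaT M_ge G00 gX).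
apply: (balance eps M) => //.
- by rewrite (le_trans _ M0M)// addr_ge0.
- rewrite (_ : M + 1 = 2 * sigma ^+ 2 + (rad + M0 + 4) * 1); last by rewrite /M; ring.
  rewrite (_ : (rad + M0 + 6) * sigma ^+ 2 = 2 * sigma ^+ 2 + (rad + M0 + 4) * sigma ^+ 2); last by ring.
  by rewrite lerD2l ler_wpM2l// !addr_ge0.
Qed.
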